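(* Let $\alpha,\beta\in\mathbb R\setminus\{0\}$ and let $\mu=\mu_{m,1/2}$ be the spectral measure, with respect to $\delta_{1/2}$, of the self-adjoint operator $H=H_{m,1/2}$ on $\ell^2(F\cdot\tfrac12)$. For $z\in\mathbb R$ consider the equation in the unknown $v\in\mathbb C$ $$\beta^4v^3+(P_*(z)+Q_*(z))\beta^2v^2+\bigl(P_*(z)Q_*(z)+\beta^2-\alpha^2\bigr)v+P_*(z)=0.\qquad(E_z)$$ For every $z\in\mathbb R$, $(E_z)$ has at most one solution with positive imaginary part; when it exists denote it by $V(z)$. Then $\mu$ is absolutely continuous with respect to the Lebesgue measure $\lambda$ on $\mathbb R$; its support $\mathrm{supp}(\mu)$ is the closure of the set of $z\in\mathbb R$ for which $(E_z)$ has a solution with positive imaginary part; in particular $\mathrm{supp}(\mu)$ is a union of at most finitely many closed intervals. For $z\in\mathrm{supp}(\mu)$ (such that $V(z)$ is defined) one has $$\frac{d\mu(z)}{d\lambda(z)}=\mathrm{Im}\,\frac{V(z)}{\pi(\beta V(z)+1)^2}.$$ The Radon–Nikodym derivative $\frac{d\mu}{d\lambda}$ (that is, a suitable representative of it) is continuous everywhere on $\mathbb R$ and is analytic everywhere except at finitely many points $z$.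
   Context: Thompson's group $F$ is the group of homeomorphisms of $[0,1]$ generated by $a,b$, where $a(x)=x/2$ for $x\in[0,\frac12)$, $a(x)=x-\frac14$ for $x\in[\frac12,\frac34)$, $a(x)=2x-1$ for $x\in[\frac34,1]$; and $b(x)=x$ for $x\in[0,\frac12)$, $b(x)=\frac12a(2x-1)+\frac12$ for $x\in[\frac12,1]$. For $x\in[0,1]$ and $m=\alpha(a+a^{-1})+\beta(b+b^{-1})\in\mathbb R[F]$, the operator $H_{m,x}$ on $\ell^2(Fx)$ ($Fx$ the orbit of $x$) is $$(H_{m,x}f)(y)=\alpha\bigl(f(a^{-1}y)+f(ay)\bigr)+\beta\bigl(f(b^{-1}y)+f(by)\bigr),\quad y\in Fx .$$ It is bounded and self-adjoint. If $E$ is its projection-valued spectral measure, $\mu_{m,x}(B)=(E(B)\delta_x,\delta_x)$ for Borel $B\subset\mathbb R$. The functions $P_*,Q_*:\mathbb R\to\mathbb C$ are $$P_*(z)=\tfrac z2\pm\tfrac12\sqrt{z^2-4(\alpha+\beta)^2},\qquad Q_*(z)=\tfrac z2+\beta\pm\tfrac12\sqrt{z^2-4\beta z+4(\beta^2-\alpha^2)}.$$ If the expression under the root is nonnegative, the sign $\pm$ (in front of the nonnegative root) is the sign of $z$ in $P_*(z)$ and the sign of $z-2\beta$ in $Q_*(z)$. If the expression under the root is negative, $\pm\sqrt{\cdot}$ denotes the square root with positive imaginary part. The support of a measure on $\mathbb R$ is the set of points all of whose open neighborhoods have positive measure. *)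

(* Defs.v *)
From HB Require Import structures.
From mathcomp Require Import all_boot all_order all_algebra.
From mathcomp Require Import complex.
From mathcomp Require Import all_classical all_reals all_analysis.
From mathcomp Require Import ring lra.

Set Implicit Arguments.
Unset Strict Implicit.
Unset Printing Implicit Defensive.

Import Order.TTheory GRing.Theory Num.Theory.
Import numFieldNormedType.Exports.

Local Open Scope classical_set_scope.
Local Open Scope ring_scope.
Local Open Scope complex_scope.

Section ell2.
Context {R : realType} {T : choiceType}.
Implicit Types f g : T -> R[i].

(* Unconditional sums over [T]; only meaningful for absolutely summable
   families, such as the products occurring in [inner] below. *)
Definition rsum (u : T -> R) : R :=
  fine (\esum_(y in [set: T]) (u ^\+ y)%:E)
  - fine (\esum_(y in [set: T]) (u ^\- y)%:E).

Definition csum f : R[i] :=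
  rsum (fun y => complex.Re (f y)) +i* rsum (fun y => complex.Im (f y)).

Definition normsq (z : R[i]) : R := complex.Re z ^+ 2 + complex.Im z ^+ 2.

Definition l2 f : Prop :=
  (\esum_(y in [set: T]) (normsq (f y))%:E < +oo)%E.

Definition inner f g : R[i] := csum (fun y => f y * (g y)^*).

Definition delta (x : T) : T -> R[i] := fun y => (y == x)%:R.

Lemma normsq_ge0 z : 0 <= normsq z.
Proof. by rewrite addr_ge0 // sqr_ge0. Qed.

Lemma l2_delta x : l2 (delta x).
Proof.
rewrite /l2.
have -> : \esum_(y in [set: T]) (normsq (delta x y))%:E =
          \esum_(y in [set x]) (normsq (delta x y))%:E.
  rewrite [RHS]esum_mkcond; apply: eq_esum => y _.
  case: ifPn => // /negP yx; rewrite /delta; case: eqP => [yx'|_].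
    by case: yx; apply/mem_set.
  by rewrite /normsq /= expr0n addr0.
by rewrite esum_set1 ?lee_fin ?normsq_ge0 // ltry.
Qed.

Lemma Re_inner_ge0 f : 0 <= complex.Re (inner f f).
Proof.
rewrite /inner /csum /= /rsum.
have h y : complex.Re (f y * (f y)^*) = normsq (f y).
  by case: (f y) => a b; rewrite /normsq /= mulrN opprK -!expr2.
rewrite [X in _ - fine X]esum1 ?subr0 /=; last first.
  move=> y _; rewrite /funrneg h; congr (_%:E).
  by apply/max_idPr; rewrite oppr_le0 normsq_ge0.
apply/fine_ge0/esum_ge0 => y _.
by rewrite lee_fin /funrpos le_max lexx orbT.
Qed.

Lemma inner0 g : inner (fun=> 0) g = 0.
Proof.
rewrite /inner /csum /rsum.
have h (p : R[i] -> R) (p0 : p 0 = 0) :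
    (\esum_(y in [set: T]) ((fun y => p (0 * (g y)^*)) ^\+ y)%:E = 0 /\
    \esum_(y in [set: T]) ((fun y => p (0 * (g y)^*)) ^\- y)%:E = 0)%E.
  split; apply: esum1 => y _; rewrite /funrpos /funrneg mul0r p0 ?oppr0;
  by rewrite maxxx.
have [-> ->] := h (@complex.Re R) erefl.
have [-> ->] := h (@complex.Im R) erefl.
by rewrite subrr.
Qed.

(* Projection-valued measure on the Borel sets of the real line acting on
   l2(T).  The operators are given on all functions and constrained only on
   square-summable ones and for Borel sets. *)
Record pvm := Pvm {
  pvm_proj :> set R -> (T -> R[i]) -> (T -> R[i]);
  pvm_l2 : forall B f, measurable B -> l2 f -> l2 (pvm_proj B f);
  pvm_linear : forall B (c : R[i]) f g, measurable B -> l2 f -> l2 g ->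
    pvm_proj B (fun y => c * f y + g y) =
    (fun y => c * pvm_proj B f y + pvm_proj B g y);
  pvm_selfadjoint : forall B f g, measurable B -> l2 f -> l2 g ->
    inner (pvm_proj B f) g = inner f (pvm_proj B g);
  pvm_setI : forall A B f, measurable A -> measurable B -> l2 f ->
    pvm_proj (A `&` B) f = pvm_proj A (pvm_proj B f);
  pvm_set0 : forall f, l2 f -> pvm_proj set0 f = (fun=> 0);
  pvm_setT : forall f, l2 f -> pvm_proj setT f = f;
  pvm_sigma_additive : forall (B : nat -> set R) f g,
    (forall n, measurable (B n)) -> trivIset setT B -> l2 f -> l2 g ->
    (fun n => \sum_(k < n) inner (pvm_proj (B k) f) g : R[i]^o) @ \oo -->
    (inner (pvm_proj (\bigcup_n B n) f) g : R[i]^o) }.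

Section spectral_measure.
Variables (E : pvm) (f : T -> R[i]) (fl2 : l2 f).

(* The Borel measure B |-> (E(B) f, f), by convention 0 on non-Borel sets. *)
Definition spectral_measure of l2 f := fun B : set (measurableTypeR R) =>
  if `[< measurable B >] then (complex.Re (inner (E B f) f))%:E else 0%E.

Local Notation mu := (spectral_measure fl2).

Lemma spectral_measureE B : measurable B ->
  mu B = (complex.Re (inner (E B f) f))%:E.
Proof. by rewrite /spectral_measure => mB; rewrite asboolT. Qed.

Let mu0 : mu set0 = 0%E.
Proof. by rewrite spectral_measureE// pvm_set0// inner0. Qed.

Let mu_ge0 B : (0 <= mu B)%E.
Proof.
rewrite /spectral_measure; case: asboolP => // mB.
rewrite lee_fin -[B in E B]setIid pvm_setI// pvm_selfadjoint//; last exact: pvm_l2.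
exact: Re_inner_ge0.
Qed.

Let mu_sigma_additive : semi_sigma_additive mu.
Proof.
move=> B mB tB mUB.
rewrite spectral_measureE//.
have -> : (fun n => \sum_(0 <= i < n) mu (B i))%E =
  (EFin \o (fun n => complex.Re (\sum_(k < n) inner (E (B k) f) f))).
  apply/funext => n /=.
  rewrite big_mkord (raddf_sum (@complex.Re R)) -sumEFin.
  by apply: eq_bigr => k _; rewrite spectral_measureE.
apply: cvg_EFin; first exact: nearW.
have := @pvm_sigma_additive E _ _ _ mB tB fl2 fl2.
move=> /cvgrPdist_lt h; apply/cvgrPdist_lt => e e0.
have /h : 0 < e%:C by rewrite ltcR.
apply: filterS => n; rewrite normc_def ltcR => /le_lt_trans; apply.
set z := (X in complex.Re X ^+ 2).
have -> : complex.Re (inner (E (\bigcup_n0 B n0) f) f) -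
    complex.Re (\sum_(k < n) inner (E (B k) f) f) = complex.Re z.
  by rewrite /z raddfB.
by rewrite -sqrtr_sqr ler_wsqrtr// lerDl sqr_ge0.
Qed.

HB.instance Definition _ :=
  isMeasure.Build _ _ _ mu mu0 mu_ge0 mu_sigma_additive.

Let mu_fin : fin_num_fun mu.
Proof.
by move=> B mB; rewrite spectral_measureE.
Qed.

HB.instance Definition _ := Measure_isFinite.Build _ _ _ mu mu_fin.

End spectral_measure.

(* [E] is the projection-valued spectral measure of the bounded self-adjoint
   operator [H]: it is carried by a bounded interval, and H is the integral of
   the identity function against E. *)
Definition spectral_resolution (H : (T -> R[i]) -> (T -> R[i])) (E : pvm) :=
  (exists M : R, forall f, l2 f -> E `[- M, M]%classic f = f) /\
  (forall f (fl2 : l2 f),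
    inner (H f) f = (\int[spectral_measure E fl2]_t t)%:C).

End ell2.
Arguments pvm : clear implicits.

Definition msupport {R : realType} (mu : set R -> \bar R) : set R :=
  [set z | forall U : set R, open U -> U z -> (0 < mu U)%E].

Definition analytic_at {R : realType} (h : R -> R) (z : R) :=
  exists (c : nat -> R) (r : R), 0 < r /\
    forall x, `|x - z| < r -> pseries c (x - z) @ \oo --> h x.

Inductive generated_group {X : Type} (S : set (X -> X)) : (X -> X) -> Prop :=
| generated_id : generated_group S id
| generated_mem g : S g -> generated_group S g
| generated_comp g h : generated_group S g -> generated_group S h ->
    generated_group S (g \o h)
| generated_inv g h : generated_group S g -> cancel g h -> cancel h g ->
    generated_group S h.

Section thompson.
Context {R : realType}.

Notation I01 := {x : R | 0 <= x <= 1}.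

Definition a_fun (x : R) : R :=
  if x < 2^-1 then x / 2 else if x < 3 / 4 then x - 4^-1 else 2 * x - 1.

Definition b_fun (x : R) : R :=
  if x < 2^-1 then x else 2^-1 * a_fun (2 * x - 1) + 2^-1.

Definition ainv_fun (y : R) : R :=
  if y < 4^-1 then 2 * y else if y < 2^-1 then y + 4^-1 else (y + 1) / 2.

Definition binv_fun (y : R) : R :=
  if y < 2^-1 then y else (ainv_fun (2 * y - 1) + 1) / 2.

Lemma a_fun01 x : 0 <= x <= 1 -> 0 <= a_fun x <= 1.
Proof. by rewrite /a_fun => h; case: ltP => ?; last case: ltP => ?; lra. Qed.

Lemma ainv_fun01 x : 0 <= x <= 1 -> 0 <= ainv_fun x <= 1.
Proof. by rewrite /ainv_fun => h; case: ltP => ?; last case: ltP => ?; lra. Qed.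

Lemma b_fun01 x : 0 <= x <= 1 -> 0 <= b_fun x <= 1.
Proof.
rewrite /b_fun => h; case: ltP => h2; first lra.
have : 0 <= a_fun (2 * x - 1) <= 1 by apply: a_fun01; lra.
lra.
Qed.

Lemma binv_fun01 x : 0 <= x <= 1 -> 0 <= binv_fun x <= 1.
Proof.
rewrite /binv_fun => h; case: ltP => h2; first lra.
have : 0 <= ainv_fun (2 * x - 1) <= 1 by apply: ainv_fun01; lra.
lra.
Qed.

Lemma a_funK : cancel a_fun ainv_fun.
Proof.
move=> x; rewrite /ainv_fun /a_fun.
by case: (ltP x) => h1; [|case: (ltP x) => h2];
  (case: ltP => h3; [|case: ltP => h4]); lra.
Qed.

Lemma ainv_funK : cancel ainv_fun a_fun.
Proof.
move=> x; rewrite /ainv_fun /a_fun.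
by case: (ltP x) => h1; [|case: (ltP x) => h2];
  (case: ltP => h3; [|case: ltP => h4]); lra.
Qed.

Lemma a_fun_ge0 x : 0 <= x -> 0 <= a_fun x.
Proof. by rewrite /a_fun => h; case: ltP => ?; last case: ltP => ?; lra. Qed.

Lemma ainv_fun_ge0 x : 0 <= x -> 0 <= ainv_fun x.
Proof. by rewrite /ainv_fun => h; case: ltP => ?; last case: ltP => ?; lra. Qed.

Lemma b_funK : cancel b_fun binv_fun.
Proof.
move=> x; rewrite /binv_fun /b_fun; case: (ltP x) => h1; first by rewrite h1.
have h : 0 <= a_fun (2 * x - 1) by apply: a_fun_ge0; lra.
case: ltP => [h2|_]; first lra.
have -> : 2 * (2^-1 * a_fun (2 * x - 1) + 2^-1) - 1 = a_fun (2 * x - 1) by lra.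
by rewrite a_funK; lra.
Qed.

Lemma binv_funK : cancel binv_fun b_fun.
Proof.
move=> x; rewrite /binv_fun /b_fun; case: (ltP x) => h1; first by rewrite h1.
have h : 0 <= ainv_fun (2 * x - 1) by apply: ainv_fun_ge0; lra.
case: ltP => [h2|_]; first lra.
have -> : 2 * ((ainv_fun (2 * x - 1) + 1) / 2) - 1 = ainv_fun (2 * x - 1) by lra.
by rewrite ainv_funK; lra.
Qed.

Definition tha (x : I01) : I01 := exist _ (a_fun (val x)) (a_fun01 (valP x)).
Definition thb (x : I01) : I01 := exist _ (b_fun (val x)) (b_fun01 (valP x)).
Definition thainv (x : I01) : I01 :=
  exist _ (ainv_fun (val x)) (ainv_fun01 (valP x)).
Definition thbinv (x : I01) : I01 :=
  exist _ (binv_fun (val x)) (binv_fun01 (valP x)).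

Lemma thaK : cancel tha thainv.
Proof. by move=> x; apply/val_inj/a_funK. Qed.
Lemma thainvK : cancel thainv tha.
Proof. by move=> x; apply/val_inj/ainv_funK. Qed.
Lemma thbK : cancel thb thbinv.
Proof. by move=> x; apply/val_inj/b_funK. Qed.
Lemma thbinvK : cancel thbinv thb.
Proof. by move=> x; apply/val_inj/binv_funK. Qed.

Definition thompsonF : set (I01 -> I01) := generated_group [set tha; thb].

Lemma thompsonF_a : thompsonF tha.
Proof. by apply: generated_mem; left. Qed.
Lemma thompsonF_b : thompsonF thb.
Proof. by apply: generated_mem; right. Qed.
Lemma thompsonF_ainv : thompsonF thainv.
Proof. exact: generated_inv thompsonF_a thaK thainvK. Qed.
Lemma thompsonF_binv : thompsonF thbinv.
Proof. exact: generated_inv thompsonF_b thbK thbinvK. Qed.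

Definition orbitF (x : I01) : set I01 := [set g x | g in thompsonF].

Lemma orbitF_refl x : x \in orbitF x.
Proof. by apply/mem_set; exists id => //; exact: generated_id. Qed.

Lemma orbitF_act x g (y : orbitF x) : thompsonF g -> g (val y) \in orbitF x.
Proof.
move=> Fg; have /set_mem[k Fk <-] := valP y.
by apply/mem_set; exists (g \o k) => //; exact: generated_comp.
Qed.

Definition base_point x : orbitF x := SigSub (orbitF_refl x).

Definition orbit_act x g (Fg : thompsonF g) (y : orbitF x) : orbitF x :=
  SigSub (orbitF_act y Fg).

(* The operator H_{m,x} for m = alpha (a + a^-1) + beta (b + b^-1). *)
Definition Hop (alpha beta : R) x (f : orbitF x -> R[i]) : orbitF x -> R[i] :=
  fun y =>
    alpha%:C * (f (orbit_act thompsonF_ainv y) + f (orbit_act thompsonF_a y))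
  + beta%:C * (f (orbit_act thompsonF_binv y) + f (orbit_act thompsonF_b y)).

Lemma half01 : 0 <= (2^-1 : R) <= 1.
Proof. lra. Qed.

Definition half_pt : I01 := exist _ 2^-1 half01.

(* The signed square root in the formulas for P_* and Q_*: for D >= 0 the
   sign in front of the nonnegative root is that of [s]; for D < 0 the root
   has positive imaginary part. *)
Definition signed_sqrt (s D : R) : R[i] :=
  if 0 <= D then (Num.sg s * Num.sqrt D)%:C else 0 +i* Num.sqrt (- D).

Definition Pstar (alpha beta z : R) : R[i] :=
  (z / 2)%:C + 2^-1 * signed_sqrt z (z ^+ 2 - 4 * (alpha + beta) ^+ 2).

Definition Qstar (alpha beta z : R) : R[i] :=
  (z / 2 + beta)%:C + 2^-1 * signed_sqrt (z - 2 * beta)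
    (z ^+ 2 - 4 * beta * z + 4 * (beta ^+ 2 - alpha ^+ 2)).

Definition eqE (alpha beta z : R) (v : R[i]) : Prop :=
  let P := Pstar alpha beta z in
  let Q := Qstar alpha beta z in
  (beta ^+ 4)%:C * v ^+ 3 + (P + Q) * (beta ^+ 2)%:C * v ^+ 2
  + (P * Q + (beta ^+ 2 - alpha ^+ 2)%:C) * v + P = 0.

(* [isV alpha beta z v] reads: V(z) is defined and equal to v. *)
Definition isV (alpha beta z : R) (v : R[i]) : Prop :=
  eqE alpha beta z v /\ 0 < complex.Im v.

End thompson.

(* Main.v *)
(** Coding the orbit of 1/2 by a side, a level and a binary word turns its Schreier
    graph into a tree-like graph, on which the resolvent equation
    (z - H) g = delta_(1/2), Im z > 0, is solved by a product ansatz: along the rays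
    g decays with ratios given by P and Q, along the branches with ratios given by
    V, and the equation at the branch points is (E_z).  Taking imaginary parts in
    -1/v = Q + beta^2 v - alpha^2 / (P + beta^2 v) gives the energy estimate
    |beta v|^2 (1 + alpha^2 / |P + beta^2 v|^2) <= 1 for roots with Im v > 0.  It
    yields uniqueness and simplicity of the root V, square summability of g, and
    |beta V| < 1 locally uniformly, so that Im (V / (beta V + 1)^2) extends
    continuously from the upper half-plane to the real line, by 0 where (E_x) has no
    root with Im v > 0.  Spectral calculus identifies this function with the Poisson
    integral of mu, and Stieltjes inversion gives the density.

    The set S where V exists is open.  At a boundary point of S that is not a branch
    point of P or Q, (E_z) has a real root for which the energy estimate is an
    equality; this is a rational curve, on which the quadratic equations of P and Q
    leave only the roots of one nonzero polynomial.  Hence the boundary is finite.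
    On S, away from the branch points, the simple root V is analytic by the implicit
    function theorem for convergent power series. *)

Require Import Defs.
From HB Require Import structures.
From mathcomp Require Import all_boot all_order all_algebra.
From mathcomp Require Import complex.
From mathcomp Require Import all_classical all_reals all_analysis.
From mathcomp Require Import measurable_realfun.
From mathcomp Require Import ring lra.
From mathcomp Require polyrcf.

Set Implicit Arguments.
Unset Strict Implicit.
Unset Printing Implicit Defensive.

Import Order.TTheory GRing.Theory Num.Theory.
Import numFieldNormedType.Exports.

Local Open Scope classical_set_scope.
Local Open Scope ring_scope.
Local Open Scope complex_scope.

(** * The cubic equation *)

(** [spectral_resolution] ties [H] to [E] only through the quadratic form, as the first moment of
    each spectral measure. The relation [d mu_f = |t - z|^2 d mu_g] for [f = (z - H) g] is therefore
    derived in stages: splitting along spectral projections shows that they commute with [H], and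
    evaluating the form at [f + (H + M) f] yields the second moment. One explicit square-summable
    [g] with [(z - H) g = delta] then gives the Poisson integral. [P] and [Q] enter through [isP],
    by a modulus condition on the roots of a quadratic. Unlike the explicit formulas this makes
    sense, uniquely and continuously, on the whole closed upper half-plane, so that resolvent values
    and boundary values obey the same relation [gsol]. The obstacle at the real line is the
    denominator [(beta v + 1)^2]: a bound [|beta v| <= 1] alone would allow it to vanish. The factor
    [1 + alpha^2 / |P + beta^2 v|^2] with [alpha != 0] is what keeps [|beta v|] away from [1]. *)

Section complex_prelim.
Context {R : realType}.
Implicit Types z w : R[i].

Lemma cReD z w : complex.Re (z + w) = complex.Re z + complex.Re w.
Proof. by case: z w => ? ? [? ?]. Qed.

Lemma cImD z w : complex.Im (z + w) = complex.Im z + complex.Im w.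
Proof. by case: z w => ? ? [? ?]. Qed.

Lemma cReN z : complex.Re (- z) = - complex.Re z.
Proof. by case: z. Qed.

Lemma cImN z : complex.Im (- z) = - complex.Im z.
Proof. by case: z. Qed.

Lemma cReM z w : complex.Re (z * w) =
  complex.Re z * complex.Re w - complex.Im z * complex.Im w.
Proof. by case: z w => ? ? [? ?]. Qed.

Lemma cImM z w : complex.Im (z * w) =
  complex.Re z * complex.Im w + complex.Im z * complex.Re w.
Proof. by case: z w => ? ? [? ?]. Qed.

Lemma cReR (x : R) : complex.Re x%:C = x. Proof. by []. Qed.
Lemma cImR (x : R) : complex.Im x%:C = 0. Proof. by []. Qed.

Lemma normsqM z w : normsq (z * w) = normsq z * normsq w.
Proof. by case: z w => a b [c d]; rewrite /normsq /=; ring. Qed.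

Lemma normsqR (x : R) : normsq x%:C = x ^+ 2.
Proof. by rewrite /normsq /= expr0n addr0. Qed.

Lemma normsq_eq0 z : (normsq z == 0) = (z == 0).
Proof.
case: z => a b; rewrite /normsq /= paddr_eq0 ?sqr_ge0// !sqrf_eq0.
by rewrite eq_complex.
Qed.

Lemma normsq_gt0 z : (0 < normsq z) = (z != 0).
Proof. by rewrite lt_def normsq_ge0 andbT normsq_eq0. Qed.

Lemma cImV z : complex.Im z^-1 = - complex.Im z / normsq z.
Proof. by case: z => a b; rewrite /normsq /= mulNr. Qed.

Lemma cReV z : complex.Re z^-1 = complex.Re z / normsq z.
Proof. by case: z. Qed.

Lemma normsqV z : normsq z^-1 = (normsq z)^-1.
Proof.
have [->|z0] := eqVneq z 0; first by rewrite invr0 normsqR expr0n invr0.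
have n0 : normsq z != 0 by rewrite normsq_eq0.
by apply: (mulfI n0); rewrite -normsqM !divff// normsqR expr1n.
Qed.

Lemma Im_gt0_neq0 z : 0 < complex.Im z -> z != 0.
Proof. by apply: contraTneq => ->; rewrite ltxx. Qed.

(** Equality case of Cauchy-Schwarz: [(1 + |z|^2)(1 + |w|^2) - |1 + z w|^2] is the squared distance
    from [z] to the conjugate of [w]. *)
Lemma one_add_normsq_eq z w :
  (1 + normsq z) * (1 + normsq w) <= normsq (1 + z * w) ->
  complex.Im z + complex.Im w = 0.
Proof.
case: z w => a b [a' b']; rewrite /normsq /= => NN.
have : (b + b') ^+ 2 <= 0.
  rewrite -oppr_ge0 (_ : - _ = (a - a') ^+ 2 - ((a - a') ^+ 2 + (b + b') ^+ 2)); last ring.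
  rewrite (_ : (a - a') ^+ 2 + (b + b') ^+ 2 = (1 + (a ^+ 2 + b ^+ 2)) * (1 + (a' ^+ 2 + b' ^+ 2)) -
    ((1 + (a * a' - b * b')) ^+ 2 + (0 + (a * b' + b * a')) ^+ 2)); last ring.
  by rewrite addr_ge0 ?sqr_ge0// oppr_ge0 subr_le0.
by rewrite le_eqVlt ltNge sqr_ge0 orbF sqrf_eq0 => /eqP.
Qed.

End complex_prelim.

Section cubic.
Context {R : realType}.
Variables alpha beta : R.
Hypothesis alpha0 : alpha != 0.

Definition cubic (P Q v : R[i]) : R[i] :=
  (beta ^+ 4)%:C * v ^+ 3 + (P + Q) * (beta ^+ 2)%:C * v ^+ 2
  + (P * Q + (beta ^+ 2 - alpha ^+ 2)%:C) * v + P.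

(** The inner denominator of the continued fraction; its inverse becomes the ratio [mS] of the Green
    function at the foot of an upward ray. *)
Definition rr (P v : R[i]) := P + (beta ^+ 2)%:C * v.

(** This is [v r] times the fixed-point form [Q + beta^2 v - alpha^2 / r + 1 / v], where
    [r = rr P v]. *)
Lemma cubicE P Q v :
  cubic P Q v = v * rr P v * (Q + (beta ^+ 2)%:C * v)
                - (alpha ^+ 2)%:C * v + rr P v.
Proof. by rewrite /cubic /rr; ring. Qed.

Lemma rr_Im_gt0 P v : beta != 0 ->
  0 <= complex.Im P -> 0 < complex.Im v -> 0 < complex.Im (rr P v).
Proof.
move=> b0 P0 v0; rewrite /rr cImD cImM cImR mul0r addr0 cReR.
by rewrite ltr_wpDl// mulr_gt0// exprn_even_gt0.
Qed.

Lemma cubic_inv P Q v : beta != 0 -> 0 <= complex.Im P -> 0 < complex.Im v ->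
  cubic P Q v = 0 ->
  - v^-1 = Q + (beta ^+ 2)%:C * v - (alpha ^+ 2)%:C / rr P v.
Proof.
move=> b0 P0 vgt0; rewrite cubicE => h.
have v0 := Im_gt0_neq0 vgt0.
have r0 : rr P v != 0 by apply/Im_gt0_neq0/rr_Im_gt0.
have h2 : v * (rr P v) * (- v^-1) =
   v * rr P v * (Q + (beta ^+ 2)%:C * v - (alpha ^+ 2)%:C / rr P v).
  by rewrite -[LHS]addr0 -[in LHS]h; field; apply/andP.
by apply: (mulfI _ h2); rewrite mulf_neq0.
Qed.

(* Comparing imaginary parts in [- v^-1 = Q + beta^2 v - alpha^2 / r]. *)
Lemma cubic_energy_eq P Q v : beta != 0 ->
  0 <= complex.Im P -> 0 < complex.Im v -> cubic P Q v = 0 ->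
  normsq (beta%:C * v) * (1 + normsq (alpha%:C / rr P v))
    + (complex.Im Q + alpha ^+ 2 * (complex.Im P / normsq (rr P v)))
      * (normsq v / complex.Im v) = 1.
Proof.
move=> b0 P0 v0 h.
have r0 := rr_Im_gt0 b0 P0 v0.
have := congr1 (@complex.Im R) (cubic_inv b0 P0 v0 h).
rewrite cImN cImV 2!cImD cImN 2!cImM !cImR !cReR !mul0r !addr0 cImV.
rewrite !normsqM !normsqR normsqV.
have Nv : 0 < normsq v by rewrite normsq_gt0 Im_gt0_neq0.
have Nr : 0 < normsq (rr P v) by rewrite normsq_gt0 Im_gt0_neq0.
have rE : complex.Im (rr P v) = complex.Im P + beta ^+ 2 * complex.Im v.
  by rewrite /rr cImD cImM cImR mul0r addr0 cReR.
move: Nv Nr rE; move: (normsq v) (normsq (rr P v)) => N M N0 M0 -> h2.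
have h3 : 1 = N / complex.Im v * (complex.Im Q + beta ^+ 2 * complex.Im v
    + alpha ^+ 2 * ((complex.Im P + beta ^+ 2 * complex.Im v) / M)).
  have -> : complex.Im Q + beta ^+ 2 * complex.Im v
    + alpha ^+ 2 * ((complex.Im P + beta ^+ 2 * complex.Im v) / M) =
    complex.Im v / N.
    move: h2; set u := _ / M; rewrite !mulNr opprK => ->.
    by rewrite /u; ring.
  by field; rewrite !gt_eqF.
by rewrite [RHS]h3; field; apply/andP; split; exact: lt0r_neq0.
Qed.

(** The term with [Im Q] is kept because it makes the estimate strict when [Im z > 0], which square
    summability of the Green function requires. *)
Lemma cubic_energy P Q v : beta != 0 ->
  0 <= complex.Im P -> 0 <= complex.Im Q -> 0 < complex.Im v ->
  cubic P Q v = 0 ->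
  normsq (beta%:C * v) * (1 + normsq (alpha%:C / rr P v))
    + complex.Im Q * (normsq v / complex.Im v) <= 1.
Proof.
move=> b0 P0 Q0 v0 h; rewrite -[leRHS](cubic_energy_eq b0 P0 v0 h).
have c0 : 0 <= normsq v / complex.Im v by apply: divr_ge0 (ltW v0); exact: normsq_ge0.
rewrite lerD2l ler_wpM2r// lerDl mulr_ge0 ?sqr_ge0//.
by apply: divr_ge0 P0 _; exact: normsq_ge0.
Qed.

Lemma cubic_energy_le P Q v : beta != 0 ->
  0 <= complex.Im P -> 0 <= complex.Im Q -> 0 < complex.Im v ->
  cubic P Q v = 0 ->
  normsq (beta%:C * v) * (1 + normsq (alpha%:C / rr P v)) <= 1.
Proof.
move=> b0 P0 Q0 v0 h; apply: le_trans (cubic_energy b0 P0 Q0 v0 h).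
by rewrite lerDl mulr_ge0// divr_ge0 ?normsq_ge0// ltW.
Qed.

(* [w (1 + |c|^2) <= 1], together with the same bound for [w', c'] and
   [w w' (1 + c c') = 1], is the equality case of Cauchy-Schwarz and forces
   [c' = c^*], contradicting the signs of the imaginary parts. *)
Lemma cubic_pair P Q v P' Q' v' : beta != 0 ->
  0 <= complex.Im P -> 0 <= complex.Im Q -> 0 < complex.Im v ->
  cubic P Q v = 0 ->
  0 <= complex.Im P' -> 0 <= complex.Im Q' -> 0 < complex.Im v' ->
  cubic P' Q' v' = 0 ->
  (beta ^+ 2)%:C * v * v' * (1 + (alpha ^+ 2)%:C / (rr P v * rr P' v')) != 1.
Proof.
move=> b0 P0 Q0 v0 h P0' Q0' v0' h'; apply/eqP => E.
have H := cubic_energy_le b0 P0 Q0 v0 h.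
have H' := cubic_energy_le b0 P0' Q0' v0' h'.
have r0 := rr_Im_gt0 b0 P0 v0.
have r0' := rr_Im_gt0 b0 P0' v0'.
have rn0 := Im_gt0_neq0 r0.
have rn0' := Im_gt0_neq0 r0'.
pose c := alpha%:C / rr P v; pose c' := alpha%:C / rr P' v'.
have {}E : (beta%:C * v) * (beta%:C * v') * (1 + c * c') = 1.
  by rewrite -[RHS]E /c /c'; field; apply/andP.
have {}E : normsq (beta%:C * v) * normsq (beta%:C * v') * normsq (1 + c * c') = 1.
  by rewrite -!normsqM E normsqR expr1n.
have Ic r : 0 < complex.Im r -> complex.Im (alpha%:C / r) * alpha < 0.
  move=> rp; rewrite cImM cImR cReR mul0r addr0 cImV mulrAC -expr2.
  by rewrite pmulr_rlt0 ?exprn_even_gt0// mulNr oppr_lt0 divr_gt0// normsq_gt0 Im_gt0_neq0.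
have := ltrD (Ic _ r0) (Ic _ r0').
rewrite -/c -/c' -mulrDl.
suff -> : complex.Im c + complex.Im c' = 0 by rewrite mul0r addr0 ltxx.
have NN : (1 + normsq c) * (1 + normsq c') <= normsq (1 + c * c').
  have Np : 0 < normsq (beta%:C * v) * normsq (beta%:C * v').
    have := normsq_ge0 (1 + c * c').
    rewrite lt_def mulr_ge0 ?normsq_ge0// andbT; case: eqP => // e.
    by move: E; rewrite e mul0r => /eqP; rewrite eq_sym oner_eq0.
  rewrite -(ler_pM2l Np) E mulrACA mulr_ile1// mulr_ge0 ?normsq_ge0//.
    by rewrite addr_ge0 ?normsq_ge0.
  by rewrite addr_ge0 ?normsq_ge0.
exact: one_add_normsq_eq NN.
Qed.

(** Subtracting the two fixed-point equations leaves [v - v'] times the expression that [cubic_pair]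
    shows to be nonzero. *)
Lemma cubic_uniq P Q v v' : beta != 0 ->
  0 <= complex.Im P -> 0 <= complex.Im Q ->
  0 < complex.Im v -> cubic P Q v = 0 ->
  0 < complex.Im v' -> cubic P Q v' = 0 -> v = v'.
Proof.
move=> b0 P0 Q0 v0 h v0' h'; apply/eqP; rewrite -subr_eq0.
have vn0 := Im_gt0_neq0 v0; have vn0' := Im_gt0_neq0 v0'.
have r0 := Im_gt0_neq0 (rr_Im_gt0 b0 P0 v0).
have r0' := Im_gt0_neq0 (rr_Im_gt0 b0 P0 v0').
have := cubic_pair b0 P0 Q0 v0 h P0 Q0 v0' h'.
apply: contraR => vv; rewrite -subr_eq0.
have : (v - v') * ((beta ^+ 2)%:C * v * v' *
    (1 + (alpha ^+ 2)%:C / (rr P v * rr P v')) - 1) == 0.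
  have e := cubic_inv b0 P0 v0 h; have e' := cubic_inv b0 P0 v0' h'.
  have -> : (v - v') * ((beta ^+ 2)%:C * v * v' *
    (1 + (alpha ^+ 2)%:C / (rr P v * rr P v')) - 1) =
    v * v' * ((Q + (beta ^+ 2)%:C * v - (alpha ^+ 2)%:C / rr P v + v^-1)
       - (Q + (beta ^+ 2)%:C * v' - (alpha ^+ 2)%:C / rr P v' + v'^-1)).
    move: r0 r0'; rewrite /rr; move: (_ ^+ 2)%:C (_ ^+ 2)%:C => s t r0 r0'.
    by field; rewrite vn0 vn0' r0 r0'.
  by rewrite -e -e' !addNr subr0 mulr0.
by rewrite mulf_eq0 (negbTE vv).
Qed.

Definition dcubic (P Q v : R[i]) : R[i] :=
  (beta ^+ 4)%:C * v ^+ 2 *+ 3 + (P + Q) * (beta ^+ 2)%:C * v *+ 2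
  + (P * Q + (beta ^+ 2 - alpha ^+ 2)%:C).

(** The confluent case of uniqueness: modulo the equation itself, the derivative [dcubic] is a
    nonzero multiple of the factor in [cubic_pair] with both roots equal. *)
Lemma cubic_simple P Q v : beta != 0 ->
  0 <= complex.Im P -> 0 <= complex.Im Q ->
  0 < complex.Im v -> cubic P Q v = 0 -> dcubic P Q v != 0.
Proof.
move=> b0 P0 Q0 v0 h.
have vn0 := Im_gt0_neq0 v0.
have r0 := Im_gt0_neq0 (rr_Im_gt0 b0 P0 v0).
have := cubic_pair b0 P0 Q0 v0 h P0 Q0 v0 h.
apply: contraNN => dv; rewrite -subr_eq0.
have -> : (beta ^+ 2)%:C * v * v * (1 + (alpha ^+ 2)%:C / (rr P v * rr P v)) - 1
  = v * dcubic P Q v / rr P v - cubic P Q v / rr P v *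
     (1 + (beta ^+ 2)%:C * v / rr P v).
  move: r0; rewrite /dcubic /cubic /rr.
  rewrite (_ : (beta ^+ 2 - alpha ^+ 2)%:C = (beta ^+ 2)%:C - (alpha ^+ 2)%:C); last by rewrite rmorphB.
  rewrite (_ : (beta ^+ 4)%:C = (beta ^+ 2)%:C ^+ 2); last by rewrite -rmorphXn -exprM.
  by move: (_ ^+ 2)%:C (_ ^+ 2)%:C => s t r0; field.
by rewrite h (eqP dv) mulr0 !mul0r subrr.
Qed.

End cubic.

(** * The branches P and Q *)

Notation nc := Normc.normc.

Section modulus.
Context {R : realType}.
Implicit Types z w : R[i].

Lemma ncE z : (nc z)%:C = `|z|.
Proof. by case: z. Qed.

Lemma nc_ge0 z : 0 <= nc z.
Proof. by case: z => a b; exact: sqrtr_ge0. Qed.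

Lemma nc_sqr z : nc z ^+ 2 = normsq z.
Proof. by case: z => a b; rewrite /normsq sqr_sqrtr// addr_ge0 ?sqr_ge0. Qed.

Lemma nc0 : nc (0 : R[i]) = 0.
Proof. by apply/eqP; rewrite -sqrf_eq0 nc_sqr normsq_eq0. Qed.

Lemma nc_eq0 z : (nc z == 0) = (z == 0).
Proof. by rewrite -sqrf_eq0 nc_sqr normsq_eq0. Qed.

Lemma nc_gt0 z : (0 < nc z) = (z != 0).
Proof. by rewrite lt_def nc_eq0 nc_ge0 andbT. Qed.

Lemma ncM z w : nc (z * w) = nc z * nc w.
Proof. exact: Normc.normcM. Qed.

Lemma ncV z : nc z^-1 = (nc z)^-1.
Proof. exact: Normc.normcV. Qed.

Lemma ncX z n : nc (z ^+ n) = nc z ^+ n.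
Proof.
elim: n => [|n ih]; last by rewrite !exprS ncM ih.
by apply: complexI; rewrite ncE normr1.
Qed.

Lemma ncN z : nc (- z) = nc z.
Proof. by apply: complexI; rewrite !ncE normrN. Qed.

Lemma ncB z w : nc (z - w) = nc (w - z).
Proof. by rewrite -ncN opprB. Qed.

Lemma ncD z w : nc (z + w) <= nc z + nc w.
Proof. by rewrite -lecR rmorphD !ncE ler_normD. Qed.

Lemma ncR (x : R) : nc x%:C = `|x|.
Proof. by rewrite /= expr0n addr0 sqrtr_sqr. Qed.

Lemma ler_Re z : `|complex.Re z| <= nc z.
Proof.
by case: z => a b /=; rewrite -sqrtr_sqr ler_wsqrtr// lerDl sqr_ge0.
Qed.

Lemma ler_Im z : `|complex.Im z| <= nc z.
Proof.
by case: z => a b /=; rewrite -sqrtr_sqr ler_wsqrtr// lerDr sqr_ge0.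
Qed.

End modulus.

Section quadratic_branch.
Context {R : realType}.
Variable p : R.
Implicit Types z P : R[i].

(* The root of larger modulus of [X^2 - z X + p^2]; when both roots have the
   same modulus, the one in the closed upper half-plane. *)
Definition isP z P :=
  [/\ P * (z - P) = (p ^+ 2)%:C, nc (z - P) <= nc P & 0 <= complex.Im P].

Let conj_root P P' : P * P' = (p ^+ 2)%:C -> nc P = nc P' -> P' = P^*.
Proof.
move=> PP e; have [P0|P0] := eqVneq P 0.
  by move: e; rewrite P0 nc0 => /esym/eqP; rewrite nc_eq0 => /eqP ->; rewrite conjc0.
apply: (mulfI P0); rewrite -sqr_normc -ncE PP -rmorphXn.
congr (_%:C); have := congr1 (@Normc.normc R) PP; rewrite ncM -e -expr2 => ->.
by rewrite ncR ger0_norm ?sqr_ge0.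
Qed.

(** If [P'] were the other root [z - P], the moduli would agree, so the roots would be conjugate;
    both lying in the closed upper half-plane, they are then real and equal. *)
Lemma isP_uniq z P P' : isP z P -> isP z P' -> P = P'.
Proof.
move=> [e1 h1 i1] [e2 h2 i2]; apply/eqP; rewrite -subr_eq0.
have : (P - P') * (P - (z - P')) == 0.
  by rewrite -(subrr ((p ^+ 2)%:C : R[i])) -[in X in _ == X - _]e2 -e1; apply/eqP; ring.
rewrite mulf_eq0 => /orP[//|/eqP/subr0_eq e].
have e' : P' = z - P by rewrite e opprB addrC subrK.
move: e1 h1 h2; rewrite -e' -e => e1 h1 h2.
have := conj_root e1 (le_anti (_ : nc P <= nc P' <= nc P)).
rewrite h1 h2 => /(_ isT); move: i1 i2; case: (P) => a b; case: (P') => c d /=.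
by move=> b0 d0 [-> db]; apply/eqP; congr (_ +i* _); lra.
Qed.

Lemma isP_Im z P : isP z P -> P != 0 ->
  complex.Im z = complex.Im P * (1 - p ^+ 2 / normsq P) /\ p ^+ 2 <= normsq P.
Proof.
move=> [e h i] P0; have N0 : 0 < normsq P by rewrite normsq_gt0.
split.
  have -> : z = P + (p ^+ 2)%:C / P by rewrite -e; field.
  by rewrite cImD cImM cImR cReR mul0r addr0 cImV mulrBr mulr1; ring.
have := congr1 (@Normc.normc R) e; rewrite ncM ncR ger0_norm ?sqr_ge0// => <-.
by rewrite -nc_sqr expr2 ler_wpM2l ?nc_ge0.
Qed.

Lemma isP_Im_gt0 z P : isP z P -> 0 < complex.Im z ->
  0 < complex.Im P /\ p ^+ 2 < normsq P.
Proof.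
move=> PP z0; have P0 : P != 0.
  case: PP => _ + _; apply: contraTneq => P0; rewrite P0 nc0 subr0.
  by rewrite -ltNge nc_gt0 Im_gt0_neq0.
have [zE hP] := isP_Im PP P0.
have N0 : 0 < normsq P by rewrite normsq_gt0.
have i0 : 0 < complex.Im P.
  case: PP => _ _; rewrite le_eqVlt => /orP[/eqP e|//].
  by move: z0; rewrite zE -e mul0r ltxx.
split=> //; move: z0; rewrite zE pmulr_rgt0// subr_gt0.
by rewrite ltr_pdivrMr// mul1r.
Qed.

Lemma isP_bound z P : isP z P -> nc P <= nc z + `|p|.
Proof.
move=> [e h i]; have -> : P = z + - (z - P) by rewrite subKr.
apply: (le_trans (ncD _ _)); rewrite lerD2l ncN.
rewrite -(ler_pXn2r (ltn0Sn 1)) ?nnegrE ?nc_ge0// real_normK ?num_real//.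
have := congr1 (@Normc.normc R) e; rewrite ncM ncR ger0_norm ?sqr_ge0// => <-.
by rewrite expr2 ler_wpM2r ?nc_ge0.
Qed.

(** If the root of larger modulus lies below the real axis, [z = P + p^2 / P] and [Im z >= 0] force
    [|P|^2 <= p^2]. The moduli are then equal and the other root, being the conjugate, qualifies. *)
Lemma isP_exists z : 0 <= complex.Im z -> exists P, isP z P.
Proof.
move=> z0; pose s := sqrtc (z ^+ 2 - 4 * (p ^+ 2)%:C).
pose P1 := (z + s) / 2.
have : exists P1, P1 * (z - P1) = (p ^+ 2)%:C /\ nc (z - P1) <= nc P1.
  have e : P1 * (z - P1) = (p ^+ 2)%:C.
    rewrite (_ : P1 * _ = (z ^+ 2 - s ^+ 2) / 4); last by rewrite /P1; field.
    by rewrite /s sqr_sqrtc opprB addrC subrK; field.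
  have [h|/ltW h] := leP (nc (z - P1)) (nc P1); first by exists P1.
  by exists (z - P1); rewrite subKr mulrC; split.
move=> [{s}{}P1 [e h]].
have [i0|i0] := leP 0 (complex.Im P1); first by exists P1.
have N0 : 0 < normsq P1.
  by rewrite normsq_gt0; apply: contraTneq i0 => ->; rewrite ltxx.
have Pn : P1 != 0 by rewrite -normsq_gt0.
have zE : complex.Im z = complex.Im P1 * (1 - p ^+ 2 / normsq P1).
  have -> : z = P1 + (p ^+ 2)%:C / P1 by rewrite -e; field.
  by rewrite cImD cImM cImR cReR mul0r addr0 cImV mulrBr mulr1; ring.
have pN : normsq P1 <= p ^+ 2.
  move: z0; rewrite zE nmulr_rge0// subr_le0 ler_pdivlMr// mul1r.
  by [].
have h' : nc P1 <= nc (z - P1).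
  rewrite -(ler_pM2l (_ : 0 < nc P1)) ?nc_gt0// -expr2 nc_sqr -ncM e ncR.
  by rewrite ger0_norm ?sqr_ge0.
have e2 := conj_root e (le_anti (introT andP (conj h' h))).
exists (z - P1); split; rewrite ?subKr//; first by rewrite mulrC.
by rewrite e2; move: i0; case: (P1) => a b /=; lra.
Qed.

(** With [P0' = z0 - P0] one has [(P - P0)(P - P0') = P (z - z0)], so [P] is close to one of the two
    limiting roots. Closeness to [P0'] is excluded unless [P0' = P0]: either [Im P0' < 0], or
    [|P0'| < |P0|], and then [|z - P| <= |P|] would fail. *)
Lemma isP_cont z0 P0 : isP z0 P0 -> forall e, 0 < e -> exists2 d, 0 < d &
  forall z P, isP z P -> nc (z - z0) < d -> nc (P - P0) < e.
Proof.
move=> PP0 e e0; pose P0' := z0 - P0.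
have near0 : forall e, 0 < e -> exists2 d, 0 < d & forall z P, isP z P ->
   nc (z - z0) < d -> nc (P - P0) < e \/ nc (P - P0') < e.
  move=> {}e {}e0; pose K := nc z0 + 1 + `|p|.
  have K0 : 0 < K by rewrite ltr_wpDr// ltr_wpDl// nc_ge0.
  exists (Num.min 1 (e ^+ 2 / K)); first by rewrite lt_min ltr01 divr_gt0// exprn_gt0.
  move=> z P PP; rewrite lt_min => /andP[z1 zd].
  have PK : nc P <= K.
    apply: (le_trans (isP_bound PP)); rewrite lerD2r.
    by rewrite -[z](subrK z0) addrC (le_trans (ncD _ _))// lerD2l ltW.
  case: (ltP (nc (P - P0)) e) => [|h1]; first by left.
  case: (ltP (nc (P - P0')) e) => [|h2]; first by right.
  have : e ^+ 2 <= nc ((P - P0) * (P - P0')).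
    by rewrite ncM expr2 ler_pM// ltW.
  have -> : (P - P0) * (P - P0') = P * (z - z0) - P * (z - P) + P0 * (z0 - P0).
    by rewrite /P0'; ring.
  case: PP PP0 => [-> _ _] [-> _ _]; rewrite subrK ncM leNgt => /negP[].
  rewrite -(divfK (lt0r_neq0 K0) (e ^+ 2)) mulrC.
  by rewrite (le_lt_trans (ler_wpM2l (nc_ge0 _) PK))// ltr_pM2r.
have [P0P|P0P] := eqVneq P0' P0.
  have [d d0 hd] := near0 _ e0; exists d => // z P PP zd.
  by have [] := hd _ _ PP zd; rewrite ?P0P.
have [i0|i0] := ltP (complex.Im P0') 0.
  have e1 : 0 < Num.min e (- complex.Im P0') by rewrite lt_min e0 oppr_gt0.
  have [d d0 hd] := near0 _ e1; exists d => // z P PP zd.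
  have [|] := hd _ _ PP zd; rewrite lt_min => /andP[//].
  move=> _ /(le_lt_trans (ler_Im _)); rewrite cImD cImN ltr_norml => /andP[_].
  by case: PP => _ _ iP; lra.
have [n0|n0] := ltP (nc P0') (nc P0); last first.
  exfalso; move/negP: P0P; apply; apply/eqP.
  apply: isP_uniq (PP0); case: PP0 => [ee hh ii]; split => //.
    by rewrite /P0' subKr mulrC.
  by rewrite /P0' opprB addrC subrK.
have e1 : 0 < Num.min e ((nc P0 - nc P0') / 4).
  by rewrite lt_min e0 divr_gt0// subr_gt0.
have [d d0 hd] := near0 _ e1.
(* Three errors of at most a quarter of the modulus gap cannot close it. *)
exists (Num.min d ((nc P0 - nc P0') / 4)).
  by rewrite lt_min d0 divr_gt0// subr_gt0.
move=> z P PP; rewrite lt_min => /andP[zd zd2].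
have [|] := hd _ _ PP zd; rewrite lt_min => /andP[//].
move=> _ h; case: PP => _ hP _; exfalso.
have h1 : nc P <= nc P0' + nc (P - P0').
  by rewrite -[in leLHS](subrK P0' P) addrC ncD.
have h2 : nc P0 <= nc (z - P) + nc (P - P0') + nc (z - z0).
  have -> : P0 = (z - P) + (P - P0') + - (z - z0) by rewrite /P0'; ring.
  by rewrite (le_trans (ncD _ _))// ncN lerD2r ncD.
lra.
Qed.

End quadratic_branch.

Section star.
Context {R : realType}.

(** At [z = 0] the sign factor is [0] and would erase a positive [D]; the discriminants used below
    are nonpositive there. *)
Lemma signed_sqrt_sqr (z D : R) : (z == 0 -> D <= 0) ->
  signed_sqrt z D ^+ 2 = D%:C.
Proof.
rewrite /signed_sqrt => zD; case: (leP 0 D) => D0.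
  rewrite -rmorphXn; congr (_%:C); rewrite exprMn sqr_sqrtr//.
  have [z0|z0] := eqVneq z 0; last by rewrite sqr_sg z0 mul1r.
  by have /le_anti -> : D <= 0 <= D; rewrite ?mulr0// D0 zD// z0.
apply/eqP; rewrite eq_complex [_ ^+ 2]expr2 cReM cImM; apply/andP; split; apply/eqP => /=.
  by rewrite mul0r sub0r -expr2 sqr_sqrtr ?opprK// oppr_ge0 ltW.
by rewrite mulr0 mul0r addr0.
Qed.

(** For a nonnegative discriminant, giving the root the sign of [z] selects the solution of larger
    modulus; for a negative one the solutions are conjugate and the upper one is taken. *)
Lemma signed_sqrt_isP (p z : R) :
  isP p z%:C ((z / 2)%:C + 2^-1 * signed_sqrt z (z ^+ 2 - 4 * p ^+ 2)).
Proof.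
set D := _ - _; set S := signed_sqrt z D.
have half : (2^-1 : R[i]) = (2^-1 : R)%:C by rewrite fmorphV rmorph_nat.
have SD : S ^+ 2 = D%:C.
  apply: signed_sqrt_sqr => /eqP z0.
  by rewrite /D z0 expr0n sub0r oppr_le0 mulr_ge0// sqr_ge0.
have zP : z%:C - ((z / 2)%:C + 2^-1 * S) = (z / 2)%:C - 2^-1 * S.
  by rewrite (_ : (z / 2)%:C = z%:C * 2^-1); [field | rewrite half -rmorphM].
split.
- rewrite zP mulrC -subr_sqr exprMn SD !half -!rmorphXn -rmorphM -rmorphB /D.
  by congr (_%:C); field.
- rewrite zP; move: SD; rewrite half /S /signed_sqrt; case: (leP 0 D) => D0 SD.
    have : 0 <= z * (Num.sg z * Num.sqrt D).
      by rewrite mulrA [z * _]mulrC -normrEsg mulr_ge0 ?sqrtr_ge0.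
    set s := Num.sg z * _ => sz.
    rewrite -!rmorphM -rmorphB -rmorphD !ncR -ler_sqr ?nnegrE//.
    by rewrite !real_normK ?num_real//; nra.
  by rewrite /= !(mul0r,mulr0,subr0,addr0,sub0r,add0r,oppr0) sqrrN.
- rewrite cImD cImR add0r half cImM cImR cReR mul0r addr0.
  rewrite mulr_ge0 ?invr_ge0// /S /signed_sqrt.
  by case: ifP => //= _; exact: sqrtr_ge0.
Qed.

Lemma Pstar_isP (alpha beta z : R) :
  isP (alpha + beta) z%:C (Pstar alpha beta z).
Proof. exact: signed_sqrt_isP. Qed.

(** Completing the square in the discriminant shows that [Q - 2 beta] is the same kind of branch at
    [z - 2 beta]. This shifted quantity is the [D] of the later sections. *)
Lemma Qstar_isP (alpha beta z : R) :
  isP alpha (z - 2 * beta)%:C (Qstar alpha beta z - (2 * beta)%:C).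
Proof.
rewrite /Qstar (_ : _ - _ + _ = (z - 2 * beta) ^+ 2 - 4 * alpha ^+ 2); last ring.
rewrite (_ : _ - _ = ((z - 2 * beta) / 2)%:C +
  2^-1 * signed_sqrt (z - 2 * beta) ((z - 2 * beta) ^+ 2 - 4 * alpha ^+ 2)).
  exact: signed_sqrt_isP.
by rewrite addrAC -rmorphB; congr (_%:C + _); field.
Qed.

End star.

Section cubic_roots.
Context {R : realType}.
Variables alpha beta : R.
Hypothesis beta0 : beta != 0.
Implicit Types P Q v : R[i].

Lemma cubic_split P Q : exists r1 r2 r3, forall v,
  cubic alpha beta P Q v = (beta ^+ 4)%:C * (v - r1) * (v - r2) * (v - r3).
Proof.
pose b4 := (beta ^+ 4)%:C : R[i].
have b40 : b4 != 0 by rewrite /b4 fmorph_eq0 expf_neq0.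
pose c2 := (P + Q) * (beta ^+ 2)%:C / b4.
pose c1 := (P * Q + (beta ^+ 2 - alpha ^+ 2)%:C) / b4.
pose c0 := P / b4.
have cE v : cubic alpha beta P Q v = b4 * (v ^+ 3 + c2 * v ^+ 2 + c1 * v + c0).
  by rewrite /cubic -/b4 /c2 /c1 /c0; move: b40; move: (b4) => b b0; field.
have [r1 r1E] : exists r, r ^+ 3 = \sum_(i < 3) (tnth [tuple - c0; - c1; - c2] i) * r ^+ i.
  have [r h] := @solve_monicpoly R[i] 3 (fun i => nth 0 [:: - c0; - c1; - c2] i) isT.
  by exists r; rewrite h; apply: eq_bigr => i _; rewrite (tnth_nth 0).
move: r1E; rewrite !big_ord_recl big_ord0 /= !(tnth_nth 0) /= => r1E.
pose d1 := c2 + r1; pose d0 := c1 + r1 * d1.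
pose s := sqrtc (d1 ^+ 2 - 4 * d0).
have sE : s ^+ 2 = d1 ^+ 2 - 4 * d0 by rewrite sqr_sqrtc.
exists r1, ((- d1 + s) / 2), ((- d1 - s) / 2) => v.
rewrite cE -[RHS]mulrA -[RHS]mulrA; congr (_ * _).
have -> : (v - (- d1 + s) / 2) * (v - (- d1 - s) / 2) = v ^+ 2 + d1 * v + d0.
  transitivity (v ^+ 2 + d1 * v + (d1 ^+ 2 - s ^+ 2) / 4); first by field.
  by rewrite sE; field.
have e : c0 = - (r1 ^+ 3 + c1 * r1 + c2 * r1 ^+ 2).
  by rewrite r1E /bump /=; ring.
by rewrite e /d0 /d1; ring.
Qed.

(** If all three roots were at distance at least [e], the factored cubic would have modulus at least
    [beta^4 e^3]. This serves as quantitative continuity of roots. *)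
Lemma cubic_near_root P Q v e : 0 < e ->
  nc (cubic alpha beta P Q v) < beta ^+ 4 * e ^+ 3 ->
  exists2 r, cubic alpha beta P Q r = 0 & nc (v - r) < e.
Proof.
move=> e0; have [r1 [r2 [r3 h]]] := cubic_split P Q; rewrite h.
case: (ltP (nc (v - r1)) e) => [|h1].
  by exists r1; rewrite // h subrr mulr0 !mul0r.
case: (ltP (nc (v - r2)) e) => [|h2].
  by exists r2; rewrite // h subrr mulr0 !mul0r.
case: (ltP (nc (v - r3)) e) => [|h3].
  by exists r3; rewrite // h subrr mulr0.
rewrite !ncM ncR ger0_norm ?exprn_even_ge0// ltNge => /negP[].
rewrite -[leRHS]mulrA -[leRHS]mulrA ler_pM2l ?exprn_even_gt0//.
rewrite (_ : e ^+ 3 = e * (e * e)); last by rewrite -expr2 -exprS.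
by rewrite !ler_pM ?mulr_ge0// ltW.
Qed.

(** Since [|rr P v| <= K + |beta|], the energy estimate bounds [1 - |beta v|^2] from below by the
    displayed fraction; the last factor [1/2] comes from [1 - w^2 <= 2 (1 - w)]. *)
Lemma cubic_root_gap P Q v K : alpha != 0 -> nc P <= K ->
  0 <= complex.Im P -> 0 <= complex.Im Q -> 0 < complex.Im v ->
  cubic alpha beta P Q v = 0 ->
  nc (beta%:C * v) <= 1 /\
  alpha ^+ 2 / (alpha ^+ 2 + (K + `|beta|) ^+ 2) / 2 <= 1 - nc (beta%:C * v).
Proof.
move=> a0 PK P0 Q0 v0 h.
have E := cubic_energy_le beta0 P0 Q0 v0 h.
have r0 : 0 < normsq (rr beta P v) by rewrite normsq_gt0 Im_gt0_neq0// rr_Im_gt0.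
have w1 : nc (beta%:C * v) <= 1.
  rewrite -(ler_pXn2r (ltn0Sn 1)) ?nnegrE ?nc_ge0// expr1n nc_sqr.
  by apply: le_trans E; rewrite mulrDr mulr1 lerDl mulr_ge0 ?normsq_ge0.
split=> //.
have rK : nc (rr beta P v) <= K + `|beta|.
  rewrite /rr (le_trans (ncD _ _))// lerD// expr2 rmorphM -mulrA ncM ncR.
  by rewrite ler_piMr.
have a2 : 0 < alpha ^+ 2 by rewrite exprn_even_gt0.
have K0 : 0 <= K + `|beta| by apply: le_trans rK; exact: nc_ge0.
have L0 : 0 < alpha ^+ 2 + (K + `|beta|) ^+ 2 by rewrite ltr_pwDl ?sqr_ge0.
have W0 : 0 <= nc (beta%:C * v) by exact: nc_ge0.
have w2 : alpha ^+ 2 / (alpha ^+ 2 + (K + `|beta|) ^+ 2) <= 1 - nc (beta%:C * v) ^+ 2.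
  rewrite lerBrDr -lerBrDl.
  have -> : 1 - alpha ^+ 2 / (alpha ^+ 2 + (K + `|beta|) ^+ 2) =
            (K + `|beta|) ^+ 2 / (alpha ^+ 2 + (K + `|beta|) ^+ 2).
    by field; rewrite gt_eqF.
  rewrite ler_pdivlMr// nc_sqr mulrDr -lerBrDr.
  rewrite -{1}[(K + _) ^+ 2]mul1r -mulrBl.
  have rK2 : normsq (rr beta P v) <= (K + `|beta|) ^+ 2.
    by rewrite -nc_sqr ler_pXn2r ?nnegrE ?nc_ge0.
  apply: (@le_trans _ _ ((1 - normsq (beta%:C * v)) * normsq (rr beta P v))).
    move: E; rewrite mulrDr mulr1 -lerBrDl [normsq (alpha%:C / _)]normsqM normsqV normsqR => E.
    by rewrite -ler_pdivrMr// -mulrA.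
  rewrite ler_wpM2l// subr_ge0 -nc_sqr.
  by rewrite -(expr1n _ 2) ler_pXn2r ?nnegrE ?nc_ge0.
rewrite ler_pdivrMr//; apply: (le_trans w2).
have -> : 1 - nc (beta%:C * v) ^+ 2 = (1 - nc (beta%:C * v)) * (1 + nc (beta%:C * v)) by ring.
by rewrite ler_wpM2l ?subr_ge0// -[2]/(1 + 1) lerD2l.
Qed.

Lemma cubic_sub P Q P' Q' v :
  nc (beta%:C * v) <= 1 ->
  nc (cubic alpha beta P Q v - cubic alpha beta P' Q' v) <=
  (nc (P - P') + nc (Q - Q')) * (2 + (nc P + nc Q + nc Q') / `|beta|).
Proof.
move=> w1.
have vb : nc v <= `|beta|^-1.
  by rewrite -[leRHS]mul1r ler_pdivlMr ?normr_gt0// mulrC -ncR -ncM.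
have -> : cubic alpha beta P Q v - cubic alpha beta P' Q' v =
  (P - P' + (Q - Q')) * (beta%:C * v) ^+ 2 + ((P - P') * Q' + P * (Q - Q')) * v
  + (P - P').
  by rewrite /cubic rmorphXn; ring.
have n0 := @nc_ge0 R.
have hA : nc ((P - P' + (Q - Q')) * (beta%:C * v) ^+ 2) <= nc (P - P') + nc (Q - Q').
  rewrite ncM ncX -[leRHS]mulr1 ler_pM ?exprn_ge0// ?ncD//.
  by rewrite -(expr1n _ 2) ler_pXn2r ?nnegrE.
have hB : nc (((P - P') * Q' + P * (Q - Q')) * v) <=
    (nc (P - P') + nc (Q - Q')) * ((nc P + nc Q + nc Q') / `|beta|).
  rewrite ncM mulrA; apply: ler_pM => //; apply: (le_trans (ncD _ _)); rewrite !ncM.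
  have H (A B p q q' : R) : 0 <= A -> 0 <= B -> 0 <= p -> 0 <= q -> 0 <= q' ->
      A * q' + p * B <= (A + B) * (p + q + q').
    move=> A0 B0 p0 q0 q'0; rewrite -subr_ge0.
    rewrite (_ : _ - _ = A * p + A * q + B * q + B * q'); last ring.
    by rewrite !addr_ge0 ?mulr_ge0.
  exact: H.
rewrite (le_trans (ncD _ _))//; apply: le_trans (lerD (ncD _ _) (lexx _)) _.
by have := n0 (Q - Q'); lra.
Qed.

(** For real [v] the fixed-point equation has imaginary part [Im Q + alpha^2 Im P / |r|^2], which is
    positive. *)
Lemma cubic_real_root_false P Q v : 0 < complex.Im P -> 0 < complex.Im Q ->
  cubic alpha beta P Q v = 0 -> complex.Im v != 0.
Proof.
move=> P0 Q0; rewrite cubicE => h; apply/eqP => v0.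
have vE : v = (complex.Re v)%:C by move: v0; case: (v) => a b /= ->.
have rI : complex.Im (rr beta P v) = complex.Im P.
  by rewrite /rr vE cImD -rmorphM cImR addr0.
have r0 : rr beta P v != 0 by rewrite Im_gt0_neq0// rI.
have vn0 : v != 0.
  apply: contra_eq_neq h => ->; rewrite !(mul0r, mulr0, sub0r, add0r, subr0) oppr0 add0r.
  by rewrite /rr mulr0 addr0 Im_gt0_neq0.
have e : v^-1 + Q + (beta ^+ 2)%:C * v - (alpha ^+ 2)%:C / rr beta P v = 0.
  apply: (mulfI (mulf_neq0 vn0 r0)); rewrite mulr0 -[RHS]h.
  by move: r0; move: (rr _ _ _) => r r0; field; rewrite vn0 r0.
have := congr1 (@complex.Im R) e; rewrite 3!cImD cImN cImV v0 oppr0 mul0r add0r.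
rewrite [in _ * v]vE -rmorphM cImR addr0 cImM cImR cReR mul0r addr0 cImV rI.
rewrite -[complex.Im 0]/0 => /eqP; rewrite gt_eqF//.
rewrite mulNr mulrN opprK ltr_pwDl// mulr_ge0 ?sqr_ge0// divr_ge0 ?normsq_ge0//.
exact: ltW.
Qed.

End cubic_roots.

(** * Boundary values of the resolvent *)

Section density.
Context {R : realType}.
Variables alpha beta : R.
Hypotheses (alpha0 : alpha != 0) (beta0 : beta != 0).
Implicit Types z P D v : R[i].

Let b2 : R[i] := (2 * beta)%:C.

(** The relation [isV] with a complex parameter [z], so that the resolvent set and the real line are
    treated together; [D] stands for [Q - 2 beta]. *)
Definition gsol z v := exists P D,
  [/\ isP (alpha + beta) z P, isP alpha (z - (2 * beta)%:C) D,
      cubic alpha beta P (D + (2 * beta)%:C) v = 0 & 0 < complex.Im v].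

Lemma isV_gsol (x : R) v : isV alpha beta x v <-> gsol x%:C v.
Proof.
have PP := Pstar_isP alpha beta x; have QQ := Qstar_isP alpha beta x.
rewrite rmorphB in QQ; split.
  move=> [h v0]; exists (Pstar alpha beta x), (Qstar alpha beta x - b2).
  by split=> //; rewrite subrK.
move=> [P [D [/isP_uniq/(_ PP) -> /isP_uniq/(_ QQ) -> h v0]]]; split => //.
by move: h; rewrite subrK.
Qed.

Let ImD2 D : complex.Im (D + b2) = complex.Im D.
Proof. by rewrite cImD cImR addr0. Qed.

Lemma gsol_uniq z v v' : gsol z v -> gsol z v' -> v = v'.
Proof.
move=> [P [D [hP hD h v0]]] [P' [D' [hP' hD' h' v0']]].
have PP := isP_uniq hP' hP; have DD := isP_uniq hD' hD.
move: h'; rewrite PP DD => h'.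
case: hP hD => _ _ P0 [_ _ D0].
by apply: (cubic_uniq alpha0 beta0 P0 _ v0 h v0' h'); rewrite ImD2.
Qed.

Lemma gsol_gap z v K : gsol z v -> nc z + `|alpha + beta| <= K ->
  nc (beta%:C * v) <= 1 /\
  alpha ^+ 2 / (alpha ^+ 2 + (K + `|beta|) ^+ 2) / 2 <= 1 - nc (beta%:C * v).
Proof.
move=> [P [D [hP hD h v0]]] zK.
have PK : nc P <= K by apply: le_trans zK; exact: isP_bound.
case: hP hD => _ _ P0 [_ _ D0].
by apply: (cubic_root_gap beta0 alpha0 PK P0 _ v0 h); rewrite ImD2.
Qed.

Lemma gsol_lt1 z v : gsol z v -> nc (beta%:C * v) < 1.
Proof.
move=> h; have [_] := gsol_gap h (lexx _); rewrite -subr_gt0.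
apply: lt_le_trans; rewrite !divr_gt0// ?exprn_even_gt0//.
by rewrite ltr_pwDl ?sqr_ge0 ?exprn_even_gt0.
Qed.

(* [- Gf V(z)] is the diagonal entry of [(z - H)^-1] at the base point. *)
Definition Gf v : R[i] := v / (beta%:C * v + 1) ^+ 2.

Lemma one_sub_le v : 1 - nc (beta%:C * v) <= nc (beta%:C * v + 1).
Proof.
have n1 : nc (1%:C : R[i]) = 1 by rewrite ncR normr1.
rewrite lerBlDr -[leLHS]n1.
have -> : (1%:C : R[i]) = (beta%:C * v + 1) + - (beta%:C * v) by rewrite rmorph1; ring.
by rewrite (le_trans (ncD _ _))// ncN.
Qed.

(** Multiplying by the conjugate of [(beta v + 1)^2] leaves the imaginary part
    [Im v (1 - |beta v|^2)], so [|beta v| < 1] makes the density positive wherever [V] exists. If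
    [beta v + 1 = 0], both sides are [0] by the convention for inverses. *)
Lemma Im_Gf v : complex.Im (Gf v) =
  complex.Im v * (1 - nc (beta%:C * v) ^+ 2) / nc (beta%:C * v + 1) ^+ 4.
Proof.
have [h0|h0] := eqVneq (beta%:C * v + 1) 0.
  by rewrite /Gf h0 nc0 !expr0n invr0 mulr0 invr0 mulr0.
have N0 : normsq (beta%:C * v + 1) != 0 by rewrite normsq_eq0.
rewrite (_ : nc (beta%:C * v + 1) ^+ 4 = normsq (beta%:C * v + 1) ^+ 2); last first.
  by rewrite -nc_sqr -exprM.
have rw : complex.Re (beta%:C * v + 1) = beta * complex.Re v + 1.
  by rewrite cReD cReM cReR cImR mul0r subr0.
have iw : complex.Im (beta%:C * v + 1) = beta * complex.Im v.
  by rewrite cImD cImM cReR cImR mul0r !addr0.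
rewrite nc_sqr normsqM normsqR /Gf -exprVn expr2 !(cImM, cReM) cReV cImV rw iw.
have -> : normsq v = complex.Re v ^+ 2 + complex.Im v ^+ 2 by [].
move: N0; have -> : normsq (beta%:C * v + 1) =
  (beta * complex.Re v + 1) ^+ 2 + (beta * complex.Im v) ^+ 2.
  by rewrite {1}/normsq rw iw.
by move: (complex.Re v) (complex.Im v) => a b N0; field.
Qed.

Lemma Gf_sub v v' : beta%:C * v + 1 != 0 -> beta%:C * v' + 1 != 0 ->
  Gf v - Gf v' = (v - v') * (1 - (beta%:C * v) * (beta%:C * v')) /
    ((beta%:C * v + 1) ^+ 2 * (beta%:C * v' + 1) ^+ 2).
Proof. by move=> h h'; rewrite /Gf; field; rewrite h h'. Qed.

Lemma coef_cont z0 P0 D0 : isP (alpha + beta) z0 P0 -> isP alpha (z0 - b2) D0 ->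
  forall e, 0 < e -> exists2 d, 0 < d & forall z P D, isP (alpha + beta) z P ->
    isP alpha (z - b2) D -> nc (z - z0) < d -> forall v, nc (beta%:C * v) <= 1 ->
    nc (cubic alpha beta P (D + b2) v - cubic alpha beta P0 (D0 + b2) v) < e.
Proof.
move=> hP0 hD0 e e0.
pose C := 2 + (nc P0 + 1 + (nc (D0 + b2) + 1) + nc (D0 + b2)) / `|beta|.
have C0 : 0 < C.
  by rewrite /C ltr_pwDl// divr_ge0// !addr_ge0 ?nc_ge0.
pose e1 := Num.min 1 (e / C / 2).
have e10 : 0 < e1 by rewrite lt_min ltr01 !divr_gt0.
have [d1 d10 h1] := isP_cont hP0 e10.
have [d2 d20 h2] := isP_cont hD0 e10.
exists (Num.min d1 d2); first by rewrite lt_min d10.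
move=> z P D hP hD; rewrite lt_min => /andP[zd1 zd2] v w1.
have hp := h1 _ _ hP zd1.
have hd : nc (D - D0) < e1.
  by apply: (h2 _ _ hD); rewrite opprB addrA subrK.
have hd' : nc (D + b2 - (D0 + b2)) < e1.
  by rewrite (_ : D + b2 - _ = D - D0)//; ring.
have le1 x y : nc (x - y) < e1 -> nc x <= nc y + 1.
  rewrite lt_min => /andP[/ltW xy _].
  by rewrite -[in leLHS](subrK y x) addrC (le_trans (ncD _ _))// lerD2l.
apply: (le_lt_trans (cubic_sub alpha beta0 P (D + b2) P0 (D0 + b2) w1)).
apply: (@le_lt_trans _ _ ((nc (P - P0) + nc (D + b2 - (D0 + b2))) * C)).
  rewrite ler_wpM2l ?addr_ge0 ?nc_ge0// /C lerD2l ler_wpM2r ?invr_ge0// lerD2r.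
  by rewrite lerD// le1.
rewrite -ltr_pdivlMr//.
have e1e : e1 <= e / C / 2 by rewrite ge_min lexx orbT.
by have := ltrD hp hd'; lra.
Qed.

(* The junk value [0] makes [ImG] vanish where there is no solution. *)
Definition Vc z : R[i] := xget 0 [set v | gsol z v].
Definition ImG z : R := complex.Im (Gf (Vc z)).

Lemma Vc_gsol z v : gsol z v -> Vc z = v.
Proof.
move=> h; apply: (@gsol_uniq z) => //.
by apply: (@xgetPex _ 0 [set v | gsol z v]); exists v.
Qed.

Lemma Vc_none z : ~ (exists v, gsol z v) -> Vc z = 0.
Proof. by move=> h; apply: xgetPN => v; apply: contra_not h => ?; exists v. Qed.

Lemma ImG_none z : ~ (exists v, gsol z v) -> ImG z = 0.
Proof. by move=> h; rewrite /ImG Vc_none// /Gf mul0r. Qed.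

Lemma gsol_den z v : gsol z v -> 0 < nc (beta%:C * v + 1).
Proof.
by move=> /gsol_lt1 h; apply: lt_le_trans (one_sub_le v); rewrite subr_gt0.
Qed.

Lemma ImG_gt0 z v : gsol z v -> 0 < ImG z.
Proof.
move=> h; rewrite /ImG (Vc_gsol h) Im_Gf divr_gt0 ?exprn_gt0 ?(gsol_den h)//.
rewrite mulr_gt0 ?subr_gt0 ?expr_lt1 ?nc_ge0 ?(gsol_lt1 h)//.
by case: h => P [D []].
Qed.

Lemma ImG_ge0 z : 0 <= ImG z.
Proof.
have [[v h]|h] := pselect (exists v, gsol z v); first exact: ltW (ImG_gt0 h).
by rewrite ImG_none.
Qed.

(** The bound of [gsol_gap]: it controls [1 - |beta v|], hence also [|beta v + 1|], from below when
    [|z| + |alpha + beta| <= K]. *)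
Definition gap K := alpha ^+ 2 / (alpha ^+ 2 + (K + `|beta|) ^+ 2) / 2.

Lemma gap_gt0 K : 0 < gap K.
Proof.
rewrite /gap !divr_gt0// ?exprn_even_gt0//.
by rewrite ltr_pwDl ?sqr_ge0 ?exprn_even_gt0.
Qed.

Lemma ImG_le z v K : gsol z v -> nc z + `|alpha + beta| <= K ->
  ImG z <= complex.Im v / gap K ^+ 4.
Proof.
move=> h zK; rewrite /ImG (Vc_gsol h) Im_Gf.
have [w1 wK] := gsol_gap h zK; rewrite -/(gap K) in wK.
have v0 : 0 < complex.Im v by case: h => P [D []].
have den := gsol_den h.
have gden : gap K <= nc (beta%:C * v + 1) := le_trans wK (one_sub_le v).
apply: ler_pM.
- by rewrite mulr_ge0 ?(ltW v0)// subr_ge0 -(expr1n _ 2) ler_pXn2r ?nnegrE ?nc_ge0.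
- by rewrite invr_ge0 exprn_ge0// ltW.
- by rewrite ler_piMr ?(ltW v0)// gerBl exprn_ge0 ?nc_ge0.
- by rewrite lef_pV2 ?posrE ?exprn_gt0 ?gap_gt0// ler_pXn2r ?nnegrE ?nc_ge0 ?(ltW (gap_gt0 K)).
Qed.

Lemma nc_v_le v : nc (beta%:C * v) <= 1 -> nc v <= `|beta|^-1.
Proof.
by move=> w1; rewrite -[leRHS]mul1r ler_pdivlMr ?normr_gt0// mulrC -ncR -ncM.
Qed.

Lemma ImG_bound z K : nc z + `|alpha + beta| <= K ->
  ImG z <= `|beta|^-1 / gap K ^+ 4.
Proof.
move=> zK; have g0 : 0 < gap K ^+ 4 by rewrite exprn_gt0// gap_gt0.
have [[v h]|h] := pselect (exists v, gsol z v); last first.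
  by rewrite ImG_none// divr_ge0 ?invr_ge0// ltW.
apply: le_trans (ImG_le h zK) _; rewrite ler_pM2r ?invr_gt0//.
have [w1 _] := gsol_gap h zK.
by apply: le_trans (nc_v_le w1); apply: le_trans (ler_Im v); exact: ler_norm.
Qed.

Lemma gsol_cont z0 v0 : gsol z0 v0 -> forall e, 0 < e ->
  exists2 d, 0 < d & forall z, 0 <= complex.Im z -> nc (z - z0) < d ->
    exists2 v, gsol z v & nc (v0 - v) < e.
Proof.
move=> h0 e e0; have [P0 [D0 [hP0 hD0 hv0 v00]]] := h0.
(* A root within [Im v0] of [v0] still has positive imaginary part. *)
pose e2 := Num.min e (complex.Im v0).
have e20 : 0 < e2 by rewrite lt_min e0.
have ep : 0 < beta ^+ 4 * e2 ^+ 3.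
  by rewrite mulr_gt0 ?(exprn_gt0 _ e20)// exprn_even_gt0.
have [d d0 hd] := coef_cont hP0 hD0 ep.
exists d => // z zI zd.
have [P hP] := isP_exists (alpha + beta) zI.
have zb : 0 <= complex.Im (z - b2) by rewrite cImD cImN cImR oppr0 addr0.
have [D hD] := isP_exists alpha zb.
have := hd _ _ _ hP hD zd v0 (ltW (gsol_lt1 h0)).
rewrite hv0 subr0 => /(cubic_near_root beta0 e20)[v hv].
rewrite lt_min => /andP[vv1 vv2]; exists v => //; exists P, D; split=> //.
by have := le_lt_trans (ler_Im _) vv2; rewrite cImD cImN ltr_norml => /andP[_]; lra.
Qed.

(** If [V(z0)] exists it moves continuously and the gap controls the denominators. If not, any
    solution near [z0] is close to a root of the limiting cubic with [Im <= 0], so its own imaginary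
    part is small, and [ImG_le] makes [ImG] small. *)
Lemma ImG_cont z0 : 0 <= complex.Im z0 -> forall e, 0 < e ->
  exists2 d, 0 < d & forall z, 0 <= complex.Im z -> nc (z - z0) < d ->
    `|ImG z - ImG z0| < e.
Proof.
move=> z00 e e0.
have [P0 hP0] := isP_exists (alpha + beta) z00.
have z0b : 0 <= complex.Im (z0 - b2) by rewrite cImD cImN cImR oppr0 addr0.
have [D0 hD0] := isP_exists alpha z0b.
pose K := nc z0 + 1 + `|alpha + beta|.
have zK z : nc (z - z0) < 1 -> nc z + `|alpha + beta| <= K.
  move=> h; rewrite lerD2r -[in leLHS](subrK z0 z) addrC (le_trans (ncD _ _))//.
  by rewrite lerD2l ltW.
have g0 := gap_gt0 K; have g40 : 0 < gap K ^+ 4 by rewrite exprn_gt0.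
have b40 : 0 < beta ^+ 4 by rewrite exprn_even_gt0.
pose e1 := e * gap K ^+ 4 / 4.
have e10 : 0 < e1 by rewrite !divr_gt0// mulr_gt0.
have [[v0 h0]|h0] := pselect (exists v, gsol z0 v).
- have v00 : 0 < complex.Im v0 by case: h0 => P [D []].
  have [d d0 hd] := gsol_cont h0 e10.
  exists (Num.min 1 d); first by rewrite lt_min ltr01 d0.
  move=> z zI; rewrite lt_min => /andP[z1 zd].
  have [v h vv1] := hd z zI zd.
  have z00' : nc (z0 - z0) < 1 by rewrite subrr nc0.
  have [w1 wK0] := gsol_gap h0 (zK z0 z00').
  rewrite /ImG (Vc_gsol h) (Vc_gsol h0) -cImN -cImD.
  rewrite (le_lt_trans (ler_Im _))// Gf_sub -?nc_gt0 ?(gsol_den h) ?(gsol_den h0)//.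
  have [w2 wK] := gsol_gap h (zK z z1).
  rewrite !(ncM, ncV, ncX).
  have W : nc (1 - beta%:C * v * (beta%:C * v0)) <= 2.
    rewrite (le_trans (ncD _ _))// ncN ncM -[2]/(1 + 1) lerD//.
      by rewrite -(rmorph1 (real_complex R)) ncR normr1.
    by rewrite mulr_ile1 ?nc_ge0.
  apply: (@le_lt_trans _ _ (e1 * 2 / gap K ^+ 4)); last first.
    have eg : 0 < e * gap K ^+ 4 by rewrite mulr_gt0.
    by rewrite ltr_pdivrMr// /e1; lra.
  apply: ler_pM.
  + by rewrite mulr_ge0 ?nc_ge0.
  + by rewrite invr_ge0 mulr_ge0 ?exprn_ge0 ?nc_ge0.
  + by rewrite ler_pM ?nc_ge0// ncB ltW.
  have c1 : gap K <= nc (beta%:C * v + 1) := le_trans wK (one_sub_le _).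
  have c0 : gap K <= nc (beta%:C * v0 + 1) := le_trans wK0 (one_sub_le _).
  have D2 : gap K ^+ 4 <= nc (beta%:C * v + 1) ^+ 2 * nc (beta%:C * v0 + 1) ^+ 2.
    rewrite (_ : gap K ^+ 4 = gap K ^+ 2 * gap K ^+ 2); last by rewrite -exprD.
    by rewrite ler_pM ?exprn_ge0 ?(ltW g0)// ler_pXn2r ?nnegrE ?nc_ge0 ?(ltW g0).
  by rewrite lef_pV2 ?posrE// (lt_le_trans g40).
- have ep : 0 < beta ^+ 4 * e1 ^+ 3 by rewrite mulr_gt0// exprn_gt0.
  have [d d0 hd] := coef_cont hP0 hD0 ep.
  exists (Num.min 1 d); first by rewrite lt_min ltr01 d0.
  move=> z zI; rewrite lt_min => /andP[z1 zd].
  rewrite (ImG_none h0) subr0 ger0_norm ?ImG_ge0//.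
  have [[v h]|h] := pselect (exists v, gsol z v); last by rewrite ImG_none.
  have [w2 wK] := gsol_gap h (zK z z1).
  apply: (le_lt_trans (ImG_le h (zK z z1))); rewrite ltr_pdivrMr//.
  case: h => P [D [hP hD hv v0]].
  have := hd _ _ _ hP hD zd v w2.
  rewrite hv sub0r ncN => /(cubic_near_root beta0 e10)[r hr vr].
  have rI : complex.Im r <= 0.
    by rewrite leNgt; apply/negP => rI; apply: h0; exists r, P0, D0.
  have := le_lt_trans (ler_Im _) vr; rewrite cImD cImN ltr_norml => /andP[_].
  by have := e10; rewrite /e1; lra.
Qed.

End density.

(** * Existence of the root for [Im z > 0] *)

Section existence.
Context {R : realType}.
Variables alpha beta : R.
Hypothesis beta0 : beta != 0.
Variables P Q : R[i].
Hypotheses (P0 : 0 < complex.Im P) (Q0 : 0 < complex.Im Q).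

Let has_root (s : R) :=
  exists2 v, cubic (s * alpha) beta P Q v = 0 & 0 < complex.Im v.

(** Without [alpha] the cubic is [(P + beta^2 v)(beta^2 v^2 + Q v + 1)]. The roots of the second
    factor are not real and have product [1 / beta^2 > 0], so their imaginary parts have opposite
    signs. *)
Let decoupled_root : has_root 0.
Proof.
have [b2 b2E] : exists b2, b2 = (beta ^+ 2)%:C :> R[i] by exists (beta ^+ 2)%:C.
have b20 : b2 != 0 by rewrite b2E fmorph_eq0 expf_neq0.
pose s := sqrtc (Q ^+ 2 - 4 * b2).
have sE : s ^+ 2 = Q ^+ 2 - 4 * b2 by rewrite sqr_sqrtc.
have root v : b2 * v ^+ 2 + Q * v + 1 = 0 -> cubic (0 * alpha) beta P Q v = 0.
  move=> h; rewrite cubicE /rr -b2E mul0r expr0n /= mul0r subr0.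
  transitivity ((P + b2 * v) * (b2 * v ^+ 2 + Q * v + 1)); last by rewrite h mulr0.
  by ring.
pose v1 := (- Q + s) / (2 * b2); pose v2 := (- Q - s) / (2 * b2).
have r1 : b2 * v1 ^+ 2 + Q * v1 + 1 = 0.
  transitivity ((s ^+ 2 - (Q ^+ 2 - 4 * b2)) / (4 * b2)); first by rewrite /v1; field.
  by rewrite sE subrr mul0r.
have r2 : b2 * v2 ^+ 2 + Q * v2 + 1 = 0.
  transitivity ((s ^+ 2 - (Q ^+ 2 - 4 * b2)) / (4 * b2)); first by rewrite /v2; field.
  by rewrite sE subrr mul0r.
have v12 : b2 * v1 * v2 = 1.
  transitivity ((Q ^+ 2 - s ^+ 2) / (4 * b2)); first by rewrite /v1 /v2; field.
  by rewrite sE; field.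
have v1n : v1 != 0.
  by apply: contra_eq_neq v12 => ->; rewrite mulr0 mul0r eq_sym oner_eq0.
have I1 : complex.Im v1 != 0.
  by apply: (@cubic_real_root_false R (0 * alpha) beta P Q v1 P0 Q0); exact: (root _ r1).
have [i1|i1] := ltP 0 (complex.Im v1); first by exists v1 => //; exact: (root _ r1).
exists v2; first exact: (root _ r2).
have -> : v2 = ((beta ^+ 2)^-1)%:C * v1^-1.
  by apply: (mulfI (mulf_neq0 b20 v1n)); rewrite v12 fmorphV /= -b2E; field; rewrite v1n.
rewrite cImM cImR cReR mul0r addr0 cImV mulr_gt0 ?invr_gt0 ?exprn_even_gt0//.
by rewrite divr_gt0 ?normsq_gt0// oppr_gt0 lt_neqAle I1.
Qed.

Let root_le1 s v : cubic (s * alpha) beta P Q v = 0 -> 0 < complex.Im v ->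
  nc (beta%:C * v) <= 1.
Proof.
move=> h v0; have E := cubic_energy_le beta0 (ltW P0) (ltW Q0) v0 h.
rewrite -(ler_pXn2r (ltn0Sn 1)) ?nnegrE ?nc_ge0// expr1n nc_sqr.
by apply: le_trans E; rewrite mulrDr mulr1 lerDl mulr_ge0 ?normsq_ge0.
Qed.

Let root_sub s t v : nc (beta%:C * v) <= 1 ->
  nc (cubic (s * alpha) beta P Q v - cubic (t * alpha) beta P Q v) <=
  `|s ^+ 2 - t ^+ 2| * (alpha ^+ 2 / `|beta|).
Proof.
move=> w1; rewrite /cubic.
have -> (a x y b z u : R[i]) : a + (z + x) * u + b - (a + (z + y) * u + b) = (x - y) * u.
  by ring.
rewrite -rmorphB ncM ncR mulrA ler_pM ?nc_ge0//; last exact: (nc_v_le beta0).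
rewrite (_ : _ - _ - _ = (t ^+ 2 - s ^+ 2) * alpha ^+ 2); last ring.
by rewrite normrM distrC ger0_norm ?sqr_ge0// [leRHS]mulrC mulrC ger0_norm ?sqr_ge0.
Qed.

Let has_root_near s : exists2 d, 0 < d & forall t, `|s ^+ 2 - t ^+ 2| < d ->
  has_root s <-> has_root t.
Proof.
have [r1 [r2 [r3 rE]]] := cubic_split (s * alpha) beta0 P Q.
have rI r : cubic (s * alpha) beta P Q r = 0 -> 0 < `|complex.Im r|.
  by rewrite normr_gt0; exact: cubic_real_root_false.
(* No root at parameter [s] is real, so a displacement smaller than [e] cannot carry a root across
   the real axis in either direction. *)
pose e := Num.min `|complex.Im r1| (Num.min `|complex.Im r2| `|complex.Im r3|).
have e0 : 0 < e.
  rewrite !lt_min !rI// rE subrr ?mulr0 ?mul0r//.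
have eI r : cubic (s * alpha) beta P Q r = 0 -> e <= `|complex.Im r|.
  rewrite rE => /eqP; rewrite !mulf_eq0 fmorph_eq0 expf_eq0 (negbTE beta0) andbF /=.
  by move=> /orP[/orP[]|]; rewrite subr_eq0 => /eqP ->; rewrite !ge_min lexx ?orbT.
have b40 : 0 < beta ^+ 4 * e ^+ 3 by apply: mulr_gt0; [rewrite exprn_even_gt0|rewrite exprn_gt0].
pose C := alpha ^+ 2 / `|beta| + 1.
have C0 : 0 < C by rewrite ltr_wpDl// divr_ge0 ?sqr_ge0.
exists (beta ^+ 4 * e ^+ 3 / C); first by rewrite divr_gt0.
move=> t st.
have small v : nc (beta%:C * v) <= 1 ->
    nc (cubic (s * alpha) beta P Q v - cubic (t * alpha) beta P Q v) < beta ^+ 4 * e ^+ 3.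
  move=> w1; apply: (le_lt_trans (root_sub _ _ w1)).
  apply: (@le_lt_trans _ _ (`|s ^+ 2 - t ^+ 2| * C)).
    by rewrite ler_wpM2l// lerDl.
  by rewrite -ltr_pdivlMr.
split=> -[v hv v0]; have := small v (root_le1 hv v0); rewrite hv.
  rewrite sub0r ncN => /(cubic_near_root beta0 e0)[r hr vr]; exists r => //.
  have := le_lt_trans (ler_Im _) vr; rewrite cImD cImN ltr_norml => /andP[_].
  by have := eI _ hv; rewrite (gtr0_norm v0); lra.
rewrite subr0 => /(cubic_near_root beta0 e0)[r hr vr]; exists r => //.
rewrite ltNge; apply/negP => r0.
have := le_lt_trans (ler_Im _) vr; rewrite cImD cImN ltr_norml => /andP[_].
by have := eI _ hr; rewrite (ler0_norm r0); lra.
Qed.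

(* Homotopy [alpha ~> s alpha]: no root crosses the real axis for [s] in [0, 1],
   so the existence of a root in the upper half-plane is locally constant in
   [s], and at [s = 0] the cubic factors explicitly. *)
Lemma cubic_root_exists : exists2 v, cubic alpha beta P Q v = 0 & 0 < complex.Im v.
Proof.
suff : has_root 1 by rewrite /has_root mul1r.
apply: contrapT => n1.
(* A locally constant indicator is continuous; with [f 0 = 1] and [f 1 = 0] it would have to take
   the value [1/2]. *)
pose f (s : R) : R := if `[< has_root s >] then 1 else 0.
have fc : continuous f.
  move=> s; have [d d0 hd] := has_root_near s.
  have sq : (fun t : R => t ^+ 2) @ s --> s ^+ 2 by exact: exprn_continuous.
  have near_d : \forall t \near s, `|s ^+ 2 - t ^+ 2| < d.
    by move/cvgrPdist_lt : sq => /(_ _ d0).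
  apply/cvgrPdist_lt => e e0; apply: filterS near_d => t td /=.
  have h := hd _ td; rewrite /f.
  have -> : `[< has_root t >] = `[< has_root s >].
    by apply/asbool_equiv_eq; split=> ?; apply/h.
  by rewrite subrr normr0.
have f0 : f 0 = 1 by rewrite /f asboolT.
have f1 : f 1 = 0 by rewrite /f asboolF.
have [|c _] := @IVT R f 0 1 2^-1 ler01 (continuous_subspaceT fc).
  by rewrite f0 f1 ge_min le_max; lra.
by rewrite /f; case: ifP => _; lra.
Qed.

End existence.

Lemma gsol_exists (R : realType) (alpha beta : R) (z : R[i]) : beta != 0 ->
  0 < complex.Im z -> exists v, gsol alpha beta z v.
Proof.
move=> b0 z0.
have zb : 0 < complex.Im (z - (2 * beta)%:C) by rewrite cImD cImN cImR oppr0 addr0.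
have [P hP] := isP_exists (alpha + beta) (ltW z0).
have [D hD] := isP_exists alpha (ltW zb).
have [P0 _] := isP_Im_gt0 hP z0; have [D0 _] := isP_Im_gt0 hD zb.
have Q0 : 0 < complex.Im (D + (2 * beta)%:C) by rewrite cImD cImR addr0.
by have [v hv v0] := cubic_root_exists alpha b0 P0 Q0; exists v, P, D.
Qed.

(** * Spectral calculus of a projection-valued measure *)

Section density_measure.
Local Open Scope ereal_scope.
Context d (T : measurableType d) (R : realType).
Variables (m : {measure set T -> \bar R}) (s : T -> R).
Hypotheses (s0 : forall x, (0 <= s x)%R) (ms : measurable_fun setT s).

(* The unused proof arguments let the measure instance depend on them. *)
Definition with_density (s0' : forall x, (0 <= s x)%R)
  (ms' : measurable_fun setT s) (B : set T) := \int[m]_(x in B) (s x)%:E.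

Local Notation nu := (with_density s0 ms).

Let mEs : measurable_fun [set: T] (EFin \o s : T -> \bar R). Proof. exact/measurable_EFinP. Qed.

Let nu0 : nu set0 = 0. Proof. exact: integral_set0. Qed.

Let nu_ge0 B : 0 <= nu B.
Proof. by apply: integral_ge0 => x _; rewrite lee_fin. Qed.

Let nu_sigma_additive : semi_sigma_additive nu.
Proof.
move=> F mF tF mUF; rewrite /with_density.
rewrite ge0_integral_bigcup//.
- by apply: is_cvg_ereal_nneg_natsum => n _; exact: nu_ge0.
- exact: measurable_funTS.
- by move=> x _; rewrite lee_fin.
Qed.

HB.instance Definition _ :=
  isMeasure.Build _ _ _ nu nu0 nu_ge0 nu_sigma_additive.

Import HBNNSimple.

Lemma integral_with_density (f : T -> \bar R) : (forall x, 0 <= f x) ->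
  measurable_fun setT f -> \int[nu]_x f x = \int[m]_x (f x * (s x)%:E).
Proof.
move=> f0 mf; pose h := nnsfun_approx measurableT mf.
have hf x : (h n x)%:E @[n --> \oo] --> f x by exact: cvg_nnsfun_approx.
have -> : \int[nu]_x f x = lim (\int[nu]_x (EFin \o h n) x @[n --> \oo]).
  have fE x : f x = lim ((EFin \o h n) x @[n --> \oo]).
    by apply/esym/cvg_lim => //; exact: hf.
  under eq_integral => x _ do rewrite fE.
  apply: monotone_convergence => //.
  - by move=> n; exact/measurable_EFinP/measurable_funP.
  - by move=> n x _; rewrite lee_fin.
  - by move=> x _ a b ab; rewrite lee_fin; exact/lefP/nd_nnsfun_approx.
have -> : \int[m]_x (f x * (s x)%:E) =
    lim (\int[m]_x ((EFin \o h n) \* (EFin \o s)) x @[n --> \oo]).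
  have fs x : f x * (s x)%:E = lim (((EFin \o h n) \* (EFin \o s)) x @[n --> \oo]).
    by apply/esym/cvg_lim => //=; apply: cvgeZr => //; exact: hf.
  under eq_integral => x _ do rewrite fs.
  apply: monotone_convergence => //.
  - move=> n; apply: emeasurable_funM => //.
    exact/measurable_EFinP/measurable_funP.
  - by move=> n x _; rewrite mule_ge0 ?lee_fin.
  - move=> x _ a b ab; rewrite lee_wpmul2r ?lee_fin//.
    exact/lefP/nd_nnsfun_approx.
congr (lim _); apply: congr2 => //; apply/funext => n /=.
have nn r x : 0 <= (r * \1_(h n @^-1` [set r]) x)%:E by exact: nnfun_muleindic_ge0.
have ind r : measurable_fun setT (fun x => (r * \1_(h n @^-1` [set r]) x)%:E).
  by apply/measurable_EFinP; exact: measurable_funM.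
transitivity (\int[nu]_x
   (\sum_(y \in range (h n)) (y * \1_(h n @^-1` [set y]) x)%:E)).
  by apply: eq_integral => t _; rewrite /= fimfunE -fsumEFin.
rewrite ge0_integral_fsum//.
transitivity (\int[m]_x (\sum_(y \in range (h n))
    (y * \1_(h n @^-1` [set y]) x)%:E * (s x)%:E)); last first.
  apply: eq_integral => x _.
  by rewrite -ge0_mule_fsuml// fsumEFin// -(fimfunE _ x).
rewrite ge0_integral_fsum//; last 2 first.
  - by move=> y; exact: emeasurable_funM.
  - by move=> y x _; rewrite mule_ge0// lee_fin.
apply: eq_fsbigr => r; rewrite inE => -[t _ tr].
have r0 : (0 <= r)%R by rewrite -tr.
under eq_integral do rewrite EFinM.
have m1 : measurable_fun setT (fun x : T => (\1_(h n @^-1` [set r]) x)%:E : \bar R).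
  by apply: measurableT_comp.
rewrite ge0_integralZl ?lee_fin//.
rewrite integral_indic// setIT.
under [RHS]eq_integral do rewrite EFinM -muleA.
rewrite ge0_integralZl ?lee_fin//; last 2 first.
  - exact: emeasurable_funM.
  - by move=> x _; rewrite mule_ge0 ?lee_fin.
congr (_ * _); rewrite /= /with_density integral_mkcond; apply: eq_integral => x _.
by rewrite /patch indicE; case: (x \in _); rewrite ?mul1e ?mul0e.
Qed.

End density_measure.

(** * Unconditional real sums *)

Section real_sums.
Context {R : realType} {T : choiceType}.
Implicit Types u v : T -> R.

Definition rsummable u := (\esum_(y in [set: T]) `|u y|%:E < +oo)%E.

Lemma esumZl (a : R) u : 0 <= a -> (forall y, 0 <= u y) ->
  (\esum_(y in [set: T]) (a * u y)%:E = a%:E * \esum_(y in [set: T]) (u y)%:E)%E.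
Proof.
have le (b : R) (w : T -> R) : 0 <= b -> (forall y, 0 <= w y) ->
   (\esum_(y in [set: T]) (b * w y)%:E <= b%:E * \esum_(y in [set: T]) (w y)%:E)%E.
  move=> b0 w0; apply: ge_ereal_sup => _ [A [fA _] <-].
  have -> : (\sum_(y \in A) (b * w y)%:E = b%:E * \sum_(y \in A) (w y)%:E)%E.
    by rewrite ge0_mule_fsumr// => y; rewrite lee_fin.
  apply: lee_wpmul2l; first by rewrite lee_fin.
  apply: esum_ge; exists A => //; split.
move=> a0 u0; apply/le_anti/andP; split; first exact: le.
move: a0; rewrite [0 <= a]le_eqVlt => /orP[/eqP <-|a0].
  by rewrite mul0e esum_ge0// => y _; rewrite mul0r.
have := le a^-1 (fun y => a * u y); rewrite invr_ge0 (ltW a0) => /(_ isT) h.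
have {h} : (\esum_(y in [set: T]) (u y)%:E <= a^-1%:E * \esum_(y in [set: T]) (a * u y)%:E)%E.
  rewrite [X in (X <= _)%E](_ : _ = \esum_(y in [set: T]) (a^-1 * (a * u y))%:E)%E.
    by apply: h => y; rewrite mulr_ge0// ltW.
  by apply: eq_esum => y _; rewrite mulKf// gt_eqF.
move=> /(lee_wpmul2l (_ : 0 <= a%:E)%E) h; apply: le_trans (h _) _.
  by rewrite lee_fin ltW.
by rewrite muleA -EFinM divff ?gt_eqF// mul1e.
Qed.

Lemma rsummable_le u v : rsummable v -> (forall y, `|u y| <= `|v y|) -> rsummable u.
Proof.
by move=> sv h; apply: le_lt_trans sv; apply: le_esum => y _; rewrite lee_fin.
Qed.

Lemma rsummableD u v : rsummable u -> rsummable v -> rsummable (fun y => u y + v y).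
Proof.
move=> su sv; have := lte_add_pinfty su sv; rewrite -esumD//.
by apply: le_lt_trans; apply: le_esum => y _; rewrite -EFinD lee_fin ler_normD.
Qed.

Lemma rsummableZ a u : rsummable u -> rsummable (fun y => a * u y).
Proof.
move=> su; rewrite /rsummable.
under eq_esum do rewrite normrM.
by rewrite esumZl// lte_mul_pinfty ?lee_fin.
Qed.

Lemma rsummableN u : rsummable u -> rsummable (fun y => - u y).
Proof. by move=> su; apply: rsummable_le su _ => y; rewrite normrN. Qed.

Lemma rsummable_fin u : (forall y, 0 <= u y) -> rsummable u ->
  (\esum_(y in [set: T]) (u y)%:E)%E \is a fin_num.
Proof.
move=> u0 su; rewrite ge0_fin_numE; last by apply: esum_ge0 => y _; rewrite lee_fin.
by move: su; rewrite /rsummable; under eq_esum do rewrite ger0_norm//.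
Qed.

Lemma rsum_posneg u : rsummable u -> [/\ rsummable u^\+%R, rsummable u^\-%R,
  forall y, 0 <= u^\+%R y, forall y, 0 <= u^\-%R y & forall y, u y = u^\+%R y - u^\-%R y].
Proof.
move=> su; split.
- apply: rsummable_le su _ => y; rewrite /funrpos ger0_norm ?le_max ?lexx ?orbT//.
  by rewrite ge_max normr_ge0 ler_norm.
- apply: rsummable_le su _ => y; rewrite /funrneg ger0_norm ?le_max ?lexx ?orbT//.
  by rewrite ge_max normr_ge0 -normrN ler_norm.
- by move=> y; rewrite /funrpos le_max lexx orbT.
- by move=> y; rewrite /funrneg le_max lexx orbT.
- by move=> y; rewrite /funrpos /funrneg !maxElt; case: (ltP (u y) 0); case: (ltP (- u y) 0); lra.
Qed.

(** [rsum] is defined by the positive and negative parts; additivity follows once every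
    decomposition into nonnegative summable families is known to give the same value. *)
Lemma rsum_diff u v : (forall y, 0 <= u y) -> (forall y, 0 <= v y) ->
  rsummable u -> rsummable v ->
  rsum (fun y => u y - v y) = fine (\esum_(y in [set: T]) (u y)%:E)%E
    - fine (\esum_(y in [set: T]) (v y)%:E)%E.
Proof.
move=> u0 v0 su sv; rewrite /rsum.
have suE : summable setT (EFin \o u) by exact: su.
have svE : summable setT (EFin \o v) by exact: sv.
have := @esumB R T setT (EFin \o u) (EFin \o v) suE svE.
have pE y : (((EFin \o u) \- (EFin \o v))^\+ y = ((fun y => u y - v y)^\+ y)%:E)%E.
  by rewrite funeposE /funrpos EFin_max.
have nE y : (((EFin \o u) \- (EFin \o v))^\- y = ((fun y => u y - v y)^\- y)%:E)%E.
  by rewrite funenegE /funrneg EFin_max.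
under eq_esum => y _ do rewrite pE.
under [X in (_ - X)%E]eq_esum => y _ do rewrite nE.
have su_v := rsummableD su (rsummableN sv).
have [sp sn p0 n0 _] := rsum_posneg su_v.
have fp := rsummable_fin p0 sp; have fn := rsummable_fin n0 sn.
move=> /(_ (fun y _ => u0 y) (fun y _ => v0 y)) e.
rewrite -fineB// -fineB ?rsummable_fin//; congr fine; exact: e.
Qed.

Lemma rsumD u v : rsummable u -> rsummable v ->
  rsum (fun y => u y + v y) = rsum u + rsum v.
Proof.
move=> su sv.
have [sup sun u0 u0' uE] := rsum_posneg su.
have [svp svn v0 v0' vE] := rsum_posneg sv.
have -> : (fun y => u y + v y) = (fun y => (u^\+%R y + v^\+%R y) - (u^\-%R y + v^\-%R y)).
  by apply/funext => y; rewrite uE vE; ring.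
rewrite rsum_diff ?addr_ge0//; try exact: rsummableD; try by move=> y; rewrite addr_ge0.
under eq_esum do rewrite EFinD.
under [X in _ - fine X]eq_esum do rewrite EFinD.
rewrite !esumD; try by move=> y _; rewrite lee_fin.
by rewrite !fineD ?rsummable_fin// /rsum; ring.
Qed.

Lemma rsumN u : rsummable u -> rsum (fun y => - u y) = - rsum u.
Proof.
move=> su; have [sup sun u0 u0' uE] := rsum_posneg su.
have -> : (fun y => - u y) = (fun y => u^\-%R y - u^\+%R y).
  by apply/funext => y; rewrite uE; ring.
by rewrite rsum_diff// /rsum opprB.
Qed.

Lemma rsumZ a u : rsummable u -> rsum (fun y => a * u y) = a * rsum u.
Proof.
wlog a0 : a u / 0 <= a.
  move=> h su; have [a0|a0] := leP 0 a; first exact: h.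
  have -> : (fun y => a * u y) = (fun y => - a * - u y).
    by apply/funext => y; rewrite mulrNN.
  by rewrite h ?oppr_ge0 1?ltW// ?rsumN ?mulrNN//; exact: rsummableN.
move=> su; have [sup sun u0 u0' uE] := rsum_posneg su.
have -> : (fun y => a * u y) = (fun y => a * u^\+%R y - a * u^\-%R y).
  by apply/funext => y; rewrite {1}uE mulrBr.
rewrite rsum_diff; try (by move=> y; rewrite mulr_ge0); try exact: rsummableZ.
by rewrite !esumZl// !fineM ?rsummable_fin// -mulrBr.
Qed.

Lemma rsum_reindex (e e' : T -> T) u : cancel e e' -> cancel e' e ->
  rsum (fun y => u (e y)) = rsum u.
Proof.
move=> ee' e'e.
have re (w : T -> \bar R) : (forall y, (0 <= w y)%E) ->
    (\esum_(y in [set: T]) w (e y) = \esum_(y in [set: T]) w y)%E.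
  move=> w0; rewrite -(@reindex_esum R T T setT setT e w)//.
  split=> //; first by move=> y y' _ _ /(can_inj ee').
  by move=> y _; exists (e' y).
rewrite /rsum; congr (fine _ - fine _).
  by apply: (re (fun y => (u^\+%R y)%:E)) => y; rewrite lee_fin /funrpos le_max lexx orbT.
by apply: (re (fun y => (u^\-%R y)%:E)) => y; rewrite lee_fin /funrneg le_max lexx orbT.
Qed.

End real_sums.

Section real_form.
Context {R : realType} {T : choiceType}.
Implicit Types (f g h : T -> R[i]) (a : R) (c : R[i]).

Definition ladd f g := fun y => f y + g y.
Definition lscale c f := fun y => c * f y.

(** A symmetric real bilinear form. Imaginary parts of inner products are recovered by pairing with
    [lscale 'i%C g], so all computations with projections and [H] stay real. *)
Definition rin f g : R := complex.Re (inner f g).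

Lemma l2P f : l2 f <-> rsummable (fun y => normsq (f y)).
Proof.
rewrite /l2 /rsummable.
have -> // : (\esum_(y in [set: T]) `|normsq (f y)|%:E =
  \esum_(y in [set: T]) (normsq (f y))%:E)%E.
by apply: eq_esum => y _; rewrite ger0_norm ?normsq_ge0.
Qed.

Lemma l2D f g : l2 f -> l2 g -> l2 (ladd f g).
Proof.
move=> /l2P sf /l2P sg; apply/l2P.
apply: rsummable_le (rsummableZ 2 (rsummableD sf sg)) _ => y.
have n0 u := @normsq_ge0 R u.
rewrite [leRHS]ger0_norm; last exact: mulr_ge0 (addr_ge0 (n0 _) (n0 _)).
rewrite ger0_norm//.
rewrite /ladd; case: (f y) (g y) => a b [a' b']; rewrite /normsq /=.
rewrite -subr_ge0 (_ : _ - _ = (a - a') ^+ 2 + (b - b') ^+ 2); last ring.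
by rewrite addr_ge0 ?sqr_ge0.
Qed.

Lemma l2Z c f : l2 f -> l2 (lscale c f).
Proof.
move=> /l2P sf; apply/l2P; apply: rsummable_le (rsummableZ (normsq c) sf) _ => y.
by rewrite /lscale normsqM.
Qed.

Lemma l2_0 : l2 (fun _ : T => 0 : R[i]).
Proof.
apply/l2P; rewrite /rsummable esum1// => y _.
by rewrite normsqR expr0n normr0.
Qed.

Let pr f g y : R := complex.Re (f y * (g y)^*).

Let prE f g y : pr f g y =
  complex.Re (f y) * complex.Re (g y) + complex.Im (f y) * complex.Im (g y).
Proof. by rewrite /pr; case: (f y) (g y) => a b [a' b'] /=; rewrite mulrN opprK. Qed.

Let rinE f g : rin f g = rsum (pr f g). Proof. by []. Qed.

Let pr_summable f g : l2 f -> l2 g -> rsummable (pr f g).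
Proof.
move=> /l2P sf /l2P sg; apply: rsummable_le (rsummableD sf sg) _ => y.
rewrite [leRHS]ger0_norm; last by apply: addr_ge0; exact: normsq_ge0.
rewrite prE.
move: (f y) (g y) => [a b] [a' b']; rewrite /normsq /= ler_norml.
have h1 := sqr_ge0 (a - a'); have h2 := sqr_ge0 (b - b').
have h3 := sqr_ge0 (a + a'); have h4 := sqr_ge0 (b + b').
have h5 := sqr_ge0 a; have h6 := sqr_ge0 b.
have h7 := sqr_ge0 a'; have h8 := sqr_ge0 b'.
by rewrite sqrrB in h1; rewrite sqrrB in h2; rewrite sqrrD in h3; rewrite sqrrD in h4; apply/andP; split; lra.
Qed.

Lemma rinC f g : rin f g = rin g f.
Proof.
rewrite !rinE; congr (rsum _); apply/funext => y; rewrite !prE; ring.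
Qed.

Lemma rinDl f g h : l2 f -> l2 g -> l2 h -> rin (ladd f g) h = rin f h + rin g h.
Proof.
move=> lf lg lh; rewrite !rinE -rsumD; try exact: pr_summable.
by congr (rsum _); apply/funext => y; rewrite !prE /ladd cReD cImD; ring.
Qed.

Lemma rinDr f g h : l2 f -> l2 g -> l2 h -> rin h (ladd f g) = rin h f + rin h g.
Proof. by move=> *; rewrite rinC rinDl// !(rinC h). Qed.

Lemma rinZl a f g : l2 f -> l2 g -> rin (lscale a%:C f) g = a * rin f g.
Proof.
move=> lf lg; rewrite !rinE -rsumZ; last exact: pr_summable.
congr (rsum _); apply/funext => y.
by rewrite !prE /lscale cReM cImM cReR cImR; ring.
Qed.

Lemma rinZr a f g : l2 f -> l2 g -> rin g (lscale a%:C f) = a * rin g f.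
Proof. by move=> *; rewrite rinC rinZl// rinC. Qed.

Lemma rin_i f g : l2 f -> l2 g -> rin (lscale 'i%C f) g = - rin f (lscale 'i%C g).
Proof.
move=> lf lg; rewrite !rinE -rsumN; last exact: pr_summable (l2Z _ _).
congr (rsum _); apply/funext => y; rewrite !prE /lscale !cReM !cImM /=; ring.
Qed.

Lemma rin_ii f g : l2 f -> l2 g -> rin (lscale 'i%C f) (lscale 'i%C g) = rin f g.
Proof.
move=> lf lg; rewrite !rinE.
congr (rsum _); apply/funext => y; rewrite !prE /lscale !cReM !cImM /=; ring.
Qed.

Lemma rin0l g : rin (fun=> 0) g = 0.
Proof. by rewrite /rin inner0. Qed.

Lemma rin_delta f x : rin f (delta x) = complex.Re (f x).
Proof.
have dE y : pr f (delta x) y = (y == x)%:R * complex.Re (f x).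
  rewrite prE /delta; case: eqP => [->|_] /=; first by rewrite mulr1 mul1r mulr0 addr0.
  by rewrite !mulr0 mul0r addr0.
rewrite rinE (_ : pr f (delta x) = fun y => complex.Re (f x) * (y == x)%:R); last first.
  by apply/funext => y; rewrite dE mulrC.
have e1 : \esum_(y in [set: T]) ((y == x)%:R%:E : \bar R) = 1%:E.
  transitivity (\esum_(y in [set x]) ((y == x)%:R%:E : \bar R)); last first.
    by rewrite esum_set1 ?eqxx ?lee_fin.
  rewrite [RHS]esum_mkcond; apply: eq_esum => y _.
  by case: ifPn => // /negP yx; case: eqP => // yx'; case: yx; exact/mem_set.
have sd : rsummable (fun y => (y == x)%:R : R).
  by rewrite /rsummable; under eq_esum do rewrite ger0_norm//; rewrite e1 ltry.
rewrite rsumZ// -[RHS]mulr1; congr (_ * _).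
rewrite /rsum [X in _ - fine X]esum1; last first.
  by move=> y _; rewrite /funrneg; congr EFin; apply/max_idPr; rewrite oppr_le0.
rewrite subr0 (_ : \esum_(_ in _) _ = 1%:E)//= -e1; apply: eq_esum => y _.
by rewrite /funrpos; congr EFin; apply/max_idPl.
Qed.

Lemma rin_reindex (e e' : T -> T) f g : cancel e e' -> cancel e' e ->
  rin (fun y => f (e y)) (fun y => g (e y)) = rin f g.
Proof. by move=> ee' e'e; rewrite !rinE -(rsum_reindex (pr f g) ee' e'e). Qed.

Lemma l2_reindex (e e' : T -> T) f : cancel e e' -> cancel e' e ->
  l2 f -> l2 (fun y => f (e y)).
Proof.
move=> ee' e'e; rewrite /l2 -(@reindex_esum R T T setT setT e (fun y => (normsq (f y))%:E))//.
by split=> //; [move=> y y' _ _ /(can_inj ee') | move=> y _; exists (e' y)].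
Qed.

End real_form.

Lemma measurable_inv_ge d (T : measurableType d) (R : realType) (c : R)
    (u : T -> R) : 0 < c ->
  (forall t, c <= u t) -> measurable_fun setT u ->
  measurable_fun setT (fun t => (u t)^-1).
Proof.
move=> c0 cu mu; have -> : (fun t => (u t)^-1) = (fun w => (Num.max c w)^-1) \o u.
  by apply/funext => t /=; rewrite (max_idPr (cu t)).
apply: measurableT_comp => //; apply: continuous_measurable_fun => t.
apply: cvgV; first by rewrite gt_eqF// lt_max c0.
by apply: (@continuous_max R R (cst c) id t); [exact: cvg_cst|exact: cvg_id].
Qed.

Section pvm_form.
Context {R : realType} {T : choiceType}.
Variable E : pvm R T.
Implicit Types (f g h : T -> R[i]) (B : set R).

Lemma pvmD B f g : measurable B -> l2 f -> l2 g ->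
  E B (ladd f g) = ladd (E B f) (E B g).
Proof.
move=> mB lf lg; have := pvm_linear E 1 mB lf lg.
have -> : (fun y => 1 * f y + g y) = ladd f g by apply/funext => y; rewrite mul1r.
by move=> ->; apply/funext => y; rewrite mul1r.
Qed.

Lemma pvm0 B : measurable B -> E B (fun=> 0) = (fun=> 0).
Proof.
move=> mB; have := pvm_linear E 1 mB (@l2_0 R T) (@l2_0 R T).
rewrite (_ : (fun _ : T => 1 * 0 + 0) = (fun=> 0)); last first.
  by apply/funext => y; rewrite mulr0 addr0.
move=> e; apply/funext => y; have := congr1 (fun u => u y) e => /=.
by rewrite mul1r => /eqP; rewrite -subr_eq0 opprD addrA subrr sub0r oppr_eq0 => /eqP.
Qed.

Lemma pvmZ B c f : measurable B -> l2 f -> E B (lscale c f) = lscale c (E B f).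
Proof.
move=> mB lf; have := pvm_linear E c mB lf (@l2_0 R T).
rewrite pvm0// (_ : (fun y => c * f y + 0) = lscale c f); last first.
  by apply/funext => y; rewrite addr0.
by move=> ->; apply/funext => y; rewrite addr0.
Qed.

Lemma pvm_rin B f g : measurable B -> l2 f -> l2 g -> rin (E B f) g = rin f (E B g).
Proof. by move=> mB lf lg; rewrite /rin pvm_selfadjoint. Qed.

Lemma pvm_idem B f : measurable B -> l2 f -> E B (E B f) = E B f.
Proof. by move=> mB lf; rewrite -pvm_setI// setIid. Qed.

Lemma spectral_rin f (lf : l2 f) B : measurable B ->
  spectral_measure E lf B = (rin (E B f) f)%:E.
Proof. exact: spectral_measureE. Qed.

Lemma spectral_proj f (lf : l2 f) (A B : set R) (lB : l2 (E B f)) :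
  measurable A -> measurable B ->
  spectral_measure E lB A = spectral_measure E lf (A `&` B).
Proof.
move=> mA mB; have mAB := measurableI _ _ mA mB; rewrite !spectral_rin//.
congr (_%:E); rewrite -(pvm_setI E mA mB lf).
rewrite -(pvm_rin mB (pvm_l2 E mAB lf) lf) -(pvm_setI E mB mAB lf).
by rewrite setICA setIid.
Qed.

End pvm_form.

(** * Spectral densities of vectors [(z - H) g], from the quadratic form *)

Section spectral_calculus.
Context {R : realType} {T : choiceType}.
Variables (E : pvm R T) (H : (T -> R[i]) -> (T -> R[i])) (M : R).
Implicit Types (f g h : T -> R[i]) (B : set R).

Hypothesis Hl2 : forall f, l2 f -> l2 (H f).
Hypothesis HD : forall f g, H (ladd f g) = ladd (H f) (H g).
Hypothesis HZ : forall c f, H (lscale c f) = lscale c (H f).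
Hypothesis Hsym : forall f g, l2 f -> l2 g -> rin (H f) g = rin f (H g).
Hypothesis HE : forall f (lf : l2 f),
  inner (H f) f = (\int[spectral_measure E lf]_t t)%:C.
Hypothesis EM : forall f, l2 f -> E `[- M, M]%classic f = f.

Local Notation mu lf := (spectral_measure E lf).
Let I := `[- M, M]%classic : set R.
Let mI : measurable I. Proof. exact: measurable_itv. Qed.

Definition shiftH f := ladd (H f) (lscale M%:C f).
(** On [[-M, M]], which carries every spectral measure, this is [t + M]. Being nonnegative
    everywhere, it can be integrated additively over measures without integrability conditions. *)
Definition shift_pos (t : R) : R := Num.max 0 (t + M).

Lemma spectral_ae f (lf : l2 f) (P : R -> Prop) :
  (forall t, I t -> P t) -> {ae mu lf, forall t, P t}.
Proof.
move=> IP; exists (~` I); split; first exact: measurableC.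
  rewrite spectral_rin; last exact: measurableC.
  have -> : E (~` I) f = fun=> 0; last by rewrite rin0l.
  rewrite -[X in E _ X = _](EM lf) -pvm_setI//; last exact: measurableC.
  by rewrite setICl pvm_set0.
by move=> t /= nP It; apply: nP; exact: IP.
Qed.

Lemma spectral_eq_integral f (lf : l2 f) (u v : R -> \bar R) :
  measurable_fun setT u -> measurable_fun setT v ->
  (forall t, I t -> u t = v t) ->
  (\int[mu lf]_t u t = \int[mu lf]_t v t)%E.
Proof.
move=> mu' mv uv; apply: ae_eq_integral => //.
by apply: (spectral_ae lf) => t It _; exact: uv.
Qed.

Lemma shift_pos_ge0 t : 0 <= shift_pos t. Proof. by rewrite /shift_pos le_max lexx. Qed.

Lemma measurable_sM : measurable_fun setT shift_pos.
Proof. by apply: measurable_maxr => //; exact: measurable_funD. Qed.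

Lemma shiftH_integral f (lf : l2 f) : (rin (shiftH f) f)%:E = (\int[mu lf]_t (shift_pos t)%:E)%E.
Proof.
(* Clamping to [[-M, M]] replaces the identity by a bounded, hence integrable, function with the
   same integral. *)
pose cl (t : R) := Num.max (- M) (Num.min M t).
have mcl : measurable_fun setT cl.
  by apply: measurable_maxr => //; exact: measurable_minr.
have icl : (mu lf).-integrable setT (EFin \o cl).
  apply: measurable_bounded_integrable => //.
    by rewrite ltey_eq fin_num_measure.
  exists `|M|; split; first exact: num_real.
  move=> x Mx t _ /=; apply: le_trans (ltW Mx); rewrite /cl ler_norml.
  have := ler_norm M; have := ler_norm (- M); rewrite normrN => h1 h2.
  rewrite le_max ge_max ge_min; apply/andP; split; first by apply/orP; left; lra.
  by apply/andP; split; [lra | apply/orP; left; lra].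
have clI t : I t -> cl t = t.
  rewrite /I /= in_itv /= => /andP[h1 h2]; rewrite /cl (min_r h2).
  by apply/max_idPr.
have e1 : (\int[mu lf]_t (shift_pos t)%:E = \int[mu lf]_t ((cl t)%:E + M%:E))%E.
  apply: spectral_eq_integral.
  - apply/measurable_EFinP; exact: measurable_sM.
  - by apply/measurable_EFinP; exact: measurable_funD.
  - move=> t It; rewrite (clI _ It) -EFinD; congr (_%:E); apply/max_idPr.
    by move: It; rewrite /I /= in_itv /= => /andP[? ?]; lra.
have ic : (mu lf).-integrable setT (EFin \o cst M).
  by apply: finite_measure_integrable_cst.
have muT : mu lf setT = (rin f f)%:E by rewrite spectral_rin// pvm_setT.
have eM : (\int[mu lf]_t M%:E = (M * rin f f)%:E)%E.
  by rewrite integral_cst// EFinM; congr (_ * _)%E.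
rewrite e1 integralD_EFin//= eM.
have := congr1 (@complex.Re R) (HE lf); rewrite -/(rin (H f) f) /= => e2.
have -> : (\int[mu lf]_t (cl t)%:E = (rin (H f) f)%:E)%E.
  rewrite e2 /Rintegral -[LHS]fineK ?integrable_fin_num//.
  congr (_%:E); congr fine; apply: spectral_eq_integral.
  - exact/measurable_EFinP.
  - exact/measurable_EFinP.
  - by move=> t It; rewrite clI.
rewrite -EFinD; congr (_%:E).
by rewrite /shiftH rinDl ?rinZl//; [exact: Hl2|exact: l2Z].
Qed.

Lemma l2_K f : l2 f -> l2 (shiftH f).
Proof. by move=> lf; apply: l2D; [exact: Hl2 | exact: l2Z]. Qed.

Lemma shiftH_D f g : shiftH (ladd f g) = ladd (shiftH f) (shiftH g).
Proof. by rewrite /shiftH HD; apply/funext => y; rewrite /ladd /lscale; ring. Qed.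

Lemma shiftH_Z c f : shiftH (lscale c f) = lscale c (shiftH f).
Proof. by rewrite /shiftH HZ; apply/funext => y; rewrite /ladd /lscale; ring. Qed.

Lemma shiftH_sym f g : l2 f -> l2 g -> rin (shiftH f) g = rin f (shiftH g).
Proof.
move=> lf lg; have lHf := Hl2 lf; have lHg := Hl2 lg.
by rewrite /shiftH rinDl ?rinDr ?rinZl ?rinZr ?Hsym//; exact: l2Z.
Qed.

Definition compl B f := ladd f (lscale (-1)%:C (E B f)).

Lemma l2_compl B f : measurable B -> l2 f -> l2 (compl B f).
Proof. by move=> mB lf; apply: l2D => //; apply: l2Z; exact: pvm_l2. Qed.

Lemma complK B f : ladd (E B f) (compl B f) = f.
Proof.
by apply/funext => y; rewrite /compl /ladd /lscale rmorphN rmorph1; ring.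
Qed.

Lemma pvm_compl B f : measurable B -> l2 f -> E B (compl B f) = fun=> 0.
Proof.
move=> mB lf; have lBf := pvm_l2 E mB lf.
rewrite /compl pvmD// ?pvmZ ?pvm_idem//; last exact: l2Z.
by apply/funext => y; rewrite /ladd /lscale rmorphN rmorph1; ring.
Qed.

(* [f1] and [f2] are orthogonal for every spectral projection, so the spectral
   measure of [f1 + f2] is the sum of those of [f1] and [f2]. *)
Lemma shiftH_cross B f1 f2 : measurable B -> l2 f1 -> l2 f2 ->
  E B f1 = f1 -> E B f2 = (fun=> 0) -> rin (shiftH f1) f2 = 0.
Proof.
move=> mB l1 l2' e1 e2; have lf := l2D l1 l2'.
have cross A : measurable A -> rin (E A f1) f2 = 0.
  move=> mA; rewrite -e1 -pvm_setI// setIC pvm_setI//.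
  by rewrite (pvm_rin E mB (pvm_l2 E mA l1) l2') e2 rinC rin0l.
have muE A : measurable A -> A `<=` setT ->
    mu lf A = measure_add (mu l1) (mu l2') A.
  move=> mA _; rewrite measure_addE; transitivity (rin (E A (ladd f1 f2)) (ladd f1 f2))%:E.
    exact: spectral_rin.
  transitivity ((rin (E A f1) f1)%:E + (rin (E A f2) f2)%:E)%E; last first.
    by congr (_ + _)%E; symmetry; exact: spectral_rin.
  rewrite -EFinD; congr (_%:E).
  have lA1 := pvm_l2 E mA l1; have lA2 := pvm_l2 E mA l2'.
  rewrite pvmD// rinDl// !rinDr// cross// addr0.
  by rewrite (pvm_rin E mA l2' l1) (rinC f2) cross// add0r.
have := shiftH_integral lf; rewrite (eq_measure_integral _ muE).
rewrite ge0_integral_measure_add//; last 2 first.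
- by move=> t _; rewrite lee_fin shift_pos_ge0.
- by apply/measurable_EFinP; exact: measurable_sM.
have lK1 := l2_K l1; have lK2 := l2_K l2'.
rewrite -!shiftH_integral -EFinD => -[].
rewrite shiftH_D rinDl// !rinDr// (shiftH_sym l2' l1) (rinC f2).
lra.
Qed.

(** [shift_H] has no off-diagonal part with respect to [E B] and its complement, by [shiftH_cross];
    expanding [f] on one side and [h] on the other leaves the same diagonal term. *)
Lemma shiftH_comm B f h : measurable B -> l2 f -> l2 h ->
  rin (E B (shiftH f)) h = rin (shiftH (E B f)) h.
Proof.
move=> mB lf lh; have lKf := l2_K lf.
have lf1 := pvm_l2 E mB lf; have lh1 := pvm_l2 E mB lh.
have lf2 := l2_compl mB lf; have lh2 := l2_compl mB lh.
have lKf1 := l2_K lf1; have lKf2 := l2_K lf2.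
rewrite pvm_rin//.
rewrite -[in LHS](complK B f) shiftH_D rinDl//.
rewrite (shiftH_sym lf2 lh1) (rinC (compl B f)).
rewrite (shiftH_cross mB lh1 lf2) ?pvm_idem ?pvm_compl// addr0.
rewrite -[in RHS](complK B h) rinDr//.
by rewrite (shiftH_cross mB lf1 lh2) ?pvm_idem ?pvm_compl// addr0.
Qed.

Lemma integral_proj (u : R -> R) f (lf : l2 f) B (lB : l2 (E B f)) :
  (forall t, 0 <= u t) -> measurable_fun setT u -> measurable B ->
  (\int[mu lB]_t (u t)%:E = \int[mu lf]_(t in B) (u t)%:E)%E.
Proof.
move=> u0 mu' mB.
have i0 (t : measurableTypeR R) : 0 <= \1_B t :> R by [].
have mi : measurable_fun setT (\1_B : measurableTypeR R -> R) by [].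
rewrite (eq_measure_integral (with_density (mu lf) i0 mi)); last first.
  move=> A mA _; rewrite /= /with_density integral_indic// setIC.
  exact: spectral_proj.
rewrite integral_with_density; last 2 first.
- by move=> t; rewrite lee_fin.
- exact/measurable_EFinP.
rewrite [RHS]integral_mkcond; apply: eq_integral => t _.
by rewrite /patch indicE; case: (t \in B); rewrite ?mule1 ?mule0.
Qed.

Lemma shiftH_density f (lf : l2 f) B : measurable B ->
  (rin (E B (shiftH f)) f)%:E = (\int[mu lf]_(t in B) (shift_pos t)%:E)%E.
Proof.
move=> mB; have lf1 := pvm_l2 E mB lf; have lf2 := l2_compl mB lf; have lKf1 := l2_K lf1.
rewrite shiftH_comm// -[X in rin _ X](complK B f) rinDr//.
rewrite (shiftH_cross mB lf1 lf2) ?pvm_idem ?pvm_compl// addr0 shiftH_integral.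
by rewrite (integral_proj lf)//; [exact: shift_pos_ge0 | exact: measurable_sM].
Qed.

(** Write [K = shiftH] and [s = shift_pos]. The spectral measure of [f + K f] is
    [mu_f + mu_(K f) + 2 s mu_f], so integrating [s] against it produces [2] times the integral of
    [s^2]. On the form side the cross terms are [(K f, K f) + (K K f, f) = 2 |K f|^2]. *)
Lemma shiftH_sq f (lf : l2 f) :
  (rin (shiftH f) (shiftH f))%:E = (\int[mu lf]_t (shift_pos t ^+ 2)%:E)%E.
Proof.
have lK := l2_K lf; have lF := l2D lf lK; have lKK := l2_K lK.
pose nu := with_density (mu lf) shift_pos_ge0 measurable_sM.
have muE A : measurable A -> A `<=` setT -> mu lF A =
    measure_add (measure_add (mu lf) (mu lK)) (measure_add nu nu) A.
  move=> mA _; have lA := pvm_l2 E mA lf; have lAK := pvm_l2 E mA lK.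
  transitivity ((rin (E A f) f + rin (E A (shiftH f)) (shiftH f))%:E +
    ((rin (E A (shiftH f)) f)%:E + (rin (E A (shiftH f)) f)%:E))%E; last first.
    transitivity ((mu lf A + mu lK A) + (nu A + nu A))%E; last first.
      by rewrite measure_addE; congr (_ + _)%E; symmetry; exact: measure_addE.
    congr (_ + _)%E; last by congr (_ + _)%E; exact: shiftH_density.
    by rewrite EFinD; congr (_ + _)%E; symmetry; exact: spectral_rin.
  transitivity (rin (E A (ladd f (shiftH f))) (ladd f (shiftH f)))%:E; first exact: spectral_rin.
  rewrite -!EFinD; congr (_%:E).
  rewrite pvmD// (rinDl lA lAK lF) (rinDr lf lK lA) (rinDr lf lK lAK).
  rewrite (pvm_rin E mA lf lK) (rinC f).
  by ring.
have msM : measurable_fun setT (EFin \o shift_pos) by apply/measurable_EFinP; exact: measurable_sM.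
have s0 t : (0 <= (shift_pos t)%:E)%E by rewrite lee_fin shift_pos_ge0.
have := shiftH_integral lF; rewrite (eq_measure_integral _ muE).
rewrite !ge0_integral_measure_add// -(shiftH_integral lf) -(shiftH_integral lK).
rewrite integral_with_density//.
have -> : (\int[mu lf]_t ((shift_pos t)%:E * (shift_pos t)%:E) = \int[mu lf]_t (shift_pos t ^+ 2)%:E)%E.
  by apply: eq_integral => t _; rewrite -EFinM expr2.
rewrite shiftH_D (rinDl lK lKK lF) (rinDr lf lK lK) (rinDr lf lK lKK) (shiftH_sym lK lf).
case: (\int[_]_t _)%E => [r| |]//=.
by rewrite -!EFinD => -[h]; congr (_%:E); lra.
Qed.

Lemma shiftH_sq_density f (lf : l2 f) B : measurable B ->
  (rin (E B (shiftH f)) (shiftH f))%:E = (\int[mu lf]_(t in B) (shift_pos t ^+ 2)%:E)%E.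
Proof.
move=> mB; have lKf := l2_K lf; have lf1 := pvm_l2 E mB lf.
have lKf1 := l2_K lf1; have lBK := pvm_l2 E mB lKf.
have -> : rin (E B (shiftH f)) (shiftH f) = rin (shiftH (E B f)) (shiftH (E B f)).
  rewrite -(shiftH_comm mB lf lKf1) [RHS]rinC -(shiftH_comm mB lf lBK).
  by rewrite -(pvm_rin E mB lBK lKf) pvm_idem.
rewrite (shiftH_sq lf1) (integral_proj lf lf1 (u := fun t => shift_pos t ^+ 2))//.
  by move=> t; exact: sqr_ge0.
by apply: measurable_funX; exact: measurable_sM.
Qed.

(** [(E B f, f)] is real because [E B] is symmetric; in the real form this is orthogonality to
    [i f]. *)
Lemma rin_pvm_i B f : measurable B -> l2 f -> rin (E B f) (lscale 'i%C f) = 0.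
Proof.
move=> mB lf; have lBf := pvm_l2 E mB lf; have lif := l2Z 'i%C lf.
have := rin_i lBf lf; rewrite -(pvmZ E 'i%C mB lf) (pvm_rin E mB lif lf) rinC.
lra.
Qed.

Lemma rin_pvm_Ki B f : measurable B -> l2 f ->
  rin (E B (shiftH f)) (lscale 'i%C f) = 0.
Proof.
move=> mB lf; have lBf := pvm_l2 E mB lf; have lif := l2Z 'i%C lf.
have lKf := l2_K lf; have lKBf := l2_K lBf; have lBif := pvm_l2 E mB lif.
have := rin_i lKBf lf; rewrite -shiftH_Z -(pvmZ E 'i%C mB lf) (shiftH_sym lBif lf).
rewrite (pvm_rin E mB lif lKf) rinC -(shiftH_comm mB lf lif); lra.
Qed.

(** [z - H = (xi - shiftH) + i y] with [xi = x + M]. The cross terms with [i] vanish, so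
    [(E B f, f)] is a combination of the moments of order [0], [1], [2] of [mu_g] on [B]. *)
Lemma resolvent_density x y g f (lg : l2 g) (lf : l2 f) B : 0 <= x + M ->
  f = ladd (lscale (x +i* y) g) (lscale (-1)%:C (H g)) -> measurable B ->
  mu lf B = (\int[mu lg]_(t in B) ((shift_pos t - (x + M)) ^+ 2 + y ^+ 2)%:E)%E.
Proof.
set xi := x + M => xi0 fE mB; have lKg := l2_K lg.
pose u := ladd (lscale xi%:C g) (lscale (-1)%:C (shiftH g)).
have {}fE : f = ladd u (lscale y%:C (lscale 'i%C g)).
  rewrite fE; apply/funext => t; rewrite /u /ladd /lscale /shiftH /ladd /lscale.
  rewrite /xi rmorphD (_ : x +i* y = x%:C + y%:C * 'i%C); first by rewrite rmorphN rmorph1; ring.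
  by rewrite [LHS]complexE /= mulrC.
have lig := l2Z 'i%C lg; have lyig := l2Z y%:C lig.
have lxg := l2Z xi%:C lg; have lNKg := l2Z (-1)%:C lKg.
have lu : l2 u by exact: l2D.
have P := fun h (lh : l2 h) => pvm_l2 E mB lh.
pose a := rin (E B g) g; pose b := rin (E B (shiftH g)) g; pose c := rin (E B (shiftH g)) (shiftH g).
have uE h : l2 h -> rin (E B u) h = xi * rin (E B g) h - rin (E B (shiftH g)) h.
  move=> lh; rewrite /u (pvmD E mB lxg lNKg) (pvmZ E _ mB lg) (pvmZ E _ mB lKg).
  rewrite (rinDl (l2Z _ (P _ lg)) (l2Z _ (P _ lKg)) lh).
  by rewrite (rinZl _ (P _ lg) lh) (rinZl _ (P _ lKg) lh) mulN1r.
have uu : rin (E B u) u = xi ^+ 2 * a - 2 * xi * b + c.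
  rewrite (uE _ lu) -/u [in rin (E B g) u]/u [in rin (E B (shiftH g)) u]/u.
  rewrite (rinDr lxg lNKg (P _ lg)) (rinDr lxg lNKg (P _ lKg)).
  rewrite (rinZr _ lg (P _ lg)) (rinZr _ lKg (P _ lg)) (rinZr _ lg (P _ lKg)) (rinZr _ lKg (P _ lKg)).
  by rewrite (pvm_rin E mB lg lKg) (rinC g) -/a -/b -/c; ring.
have ui : rin (E B u) (lscale 'i%C g) = 0.
  by rewrite (uE _ lig) rin_pvm_i// rin_pvm_Ki// mulr0 subrr.
have ff : rin (E B f) f = (xi ^+ 2 + y ^+ 2) * a - 2 * xi * b + c.
  rewrite fE (pvmD E mB lu lyig) (rinDl (P _ lu) (P _ lyig) (l2D lu lyig)).
  rewrite (rinDr lu lyig (P _ lu)) (rinDr lu lyig (P _ lyig)) uu.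
  rewrite (rinZr _ lig (P _ lu)) ui mulr0 addr0.
  rewrite (pvm_rin E mB lyig lu) (rinC _ (E B u)) (rinZr _ lig (P _ lu)) ui mulr0 add0r.
  rewrite (pvmZ E _ mB lig) (rinZl _ (P _ lig) lyig) (rinZr _ lig (P _ lig)).
  by rewrite (pvmZ E _ mB lg) (rin_ii (P _ lg) lg) -/a; ring.
have msM := measurable_sM.
have m1 : measurable_fun B (fun t => ((shift_pos t - xi) ^+ 2 + y ^+ 2)%:E : \bar R).
  apply/measurable_EFinP; apply: measurable_funTS; apply: measurable_funD => //.
  by apply: measurable_funX; apply: measurable_funB.
have m2 : measurable_fun B (fun t => (2 * xi * shift_pos t)%:E : \bar R).
  by apply/measurable_EFinP; apply: measurable_funTS; exact: measurable_funM.
have m3 : measurable_fun B (fun t => (shift_pos t ^+ 2)%:E : \bar R).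
  by apply/measurable_EFinP; apply: measurable_funTS; exact: measurable_funX.
have m4 : measurable_fun B (fun t => (xi ^+ 2 + y ^+ 2)%:E : \bar R).
  by [].
have q0 : 0 <= xi ^+ 2 + y ^+ 2 by rewrite addr_ge0 ?sqr_ge0.
(* The square is expanded with its negative term moved to the other side, so that only nonnegative
   functions are integrated; this is where [0 <= x + M] enters. *)
have : (\int[mu lg]_(t in B) (((shift_pos t - xi) ^+ 2 + y ^+ 2)%:E + (2 * xi * shift_pos t)%:E) =
   \int[mu lg]_(t in B) ((shift_pos t ^+ 2)%:E + (xi ^+ 2 + y ^+ 2)%:E))%E.
  by apply: eq_integral => t _; rewrite -!EFinD; congr (_%:E); ring.
rewrite ge0_integralD//; last 2 first.
- by move=> t _; rewrite lee_fin addr_ge0 ?sqr_ge0.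
- by move=> t _; rewrite lee_fin !mulr_ge0 ?shift_pos_ge0.
rewrite ge0_integralD//; last by move=> t _; rewrite lee_fin sqr_ge0.
rewrite -(shiftH_sq_density lg mB) -/c integral_cst//.
under [X in (_ + X)%E = _ -> _]eq_integral do rewrite EFinM.
rewrite ge0_integralZl//; last 3 first.
- by apply/measurable_EFinP; exact: measurable_funTS.
- by move=> t _; rewrite lee_fin shift_pos_ge0.
- by rewrite lee_fin mulr_ge0.
rewrite -(shiftH_density lg mB) -/b -EFinM.
have -> : ((xi ^+ 2 + y ^+ 2)%:E * mu lg B = ((xi ^+ 2 + y ^+ 2) * a)%:E)%E.
  by rewrite EFinM; congr (_ * _)%E; exact: spectral_rin.
have -> : mu lf B = (rin (E B f) f)%:E by exact: spectral_rin.
rewrite ff -EFinD; case: (\int[_]_(_ in _) _)%E => [r| |]//=.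
by rewrite -EFinD => -[h]; congr (_%:E); lra.
Qed.

(** Dividing by the density of [mu_f] with respect to [mu_g] leaves the total mass of [mu_g]. *)
Lemma resolvent_integral x y g f (lg : l2 g) (lf : l2 f) : 0 <= x + M -> y != 0 ->
  f = ladd (lscale (x +i* y) g) (lscale (-1)%:C (H g)) ->
  (\int[mu lf]_t (((t - x) ^+ 2 + y ^+ 2)^-1)%:E = (rin g g)%:E)%E.
Proof.
set xi := x + M => xi0 y0 fE.
pose phi t := (shift_pos t - xi) ^+ 2 + y ^+ 2.
have phi0 t : 0 < phi t by rewrite ltr_wpDl ?sqr_ge0// exprn_even_gt0.
have phi_ge0 (t : measurableTypeR R) : 0 <= phi t by exact: ltW.
have mphi : measurable_fun setT (phi : measurableTypeR R -> R).
  apply: measurable_funD => //; apply: measurable_funX; apply: measurable_funB => //.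
  exact: measurable_sM.
have y20 : 0 < y ^+ 2 by rewrite exprn_even_gt0.
have mphiV : measurable_fun setT (fun t : measurableTypeR R => (phi t)^-1).
  by apply: (measurable_inv_ge y20) => // t; rewrite /phi lerDr sqr_ge0.
have mV : measurable_fun setT (fun t : measurableTypeR R => (((t - x) ^+ 2 + y ^+ 2)^-1)).
  apply: (measurable_inv_ge y20); first by move=> t; rewrite lerDr sqr_ge0.
  by apply: measurable_funD => //; apply: measurable_funX; exact: measurable_funB.
rewrite (@spectral_eq_integral _ lf _ (fun t => ((phi t)^-1)%:E)); last 3 first.
- exact/measurable_EFinP.
- exact/measurable_EFinP.
- move=> t It; congr (_%:E); congr (_^-1); rewrite /phi /shift_pos max_r.
    by rewrite /xi; congr (_ ^+ 2 + _); ring.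
  by move: It; rewrite /I /= in_itv /= => /andP[? ?]; lra.
rewrite (eq_measure_integral (with_density (mu lg) phi_ge0 mphi)); last first.
  by move=> A mA _; exact: resolvent_density.
rewrite integral_with_density; last 2 first.
- by move=> t; rewrite lee_fin invr_ge0.
- exact/measurable_EFinP.
transitivity (\int[mu lg]_t (cst 1%:E t))%E.
  by apply: eq_integral => t _; rewrite -EFinM mulVf ?gt_eqF.
rewrite integral_cst// mul1e.
transitivity (rin (E setT g) g)%:E; first exact: spectral_rin.
by rewrite pvm_setT.
Qed.

End spectral_calculus.

(** * The orbit of 1/2 and its Green function *)

Section coordinates.
Context {R : realType}.

(* Vertex [(up, k, w)]: [w] is the binary expansion, without trailing zeros, of
   a dyadic [u] in [[0, 1)]; [(true, 0, w)] is the point [(2 + u) / 4] of the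
   fundamental domain [[1/2, 3/4)] of [a], and the other vertices are its
   translates under the powers of [a^-1] ([up = true]) and [a] ([up = false]). *)
Definition vertex := (bool * nat * seq bool)%type.

Fixpoint bin (w : seq bool) : R :=
  if w is b :: w' then (b%:R + bin w') / 2 else 0.

(** The default [true] admits the empty word, the expansion of [0]. *)
Definition canon (w : seq bool) := last true w.

Definition pos (c : vertex) : R :=
  let: (up, k, w) := c in
  if up then 1 - (2 - bin w) / 2 ^+ k.+2 else (1 + bin w) / 2 ^+ k.+2.

Definition cons0 w := if w is [::] then [::] else false :: w.

Definition va (c : vertex) : vertex :=
  match c with
  | (true, k.+1, w) => (true, k, w)
  | (true, 0%N, w) => (false, 0%N, w)
  | (false, k, w) => (false, k.+1, w)
  end.

Definition va' (c : vertex) : vertex :=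
  match c with
  | (true, k, w) => (true, k.+1, w)
  | (false, 0%N, w) => (true, 0%N, w)
  | (false, k.+1, w) => (false, k, w)
  end.

(** The map [b] fixes [[0, 1/2)], acts by [u -> u / 2] on the fundamental domain, sends [[3/4, 7/8)]
    back to it by [u -> (1 + u) / 2], and agrees with [a] above [7/8]. Hence each word starts a
    branch, and edges further up the rays carry weight [alpha + beta]. *)
Definition vb (c : vertex) : vertex :=
  match c with
  | (true, 0%N, w) => (true, 0%N, cons0 w)
  | (true, 1%N, w) => (true, 0%N, true :: w)
  | (true, k.+2, w) => (true, k.+1, w)
  | _ => c
  end.

Definition vb' (c : vertex) : vertex :=
  match c with
  | (true, 0%N, false :: w) => (true, 0%N, w)
  | (true, 0%N, true :: w) => (true, 1%N, w)
  | (true, k.+1, w) => (true, k.+2, w)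
  | _ => c
  end.

Lemma canon_cons b w : canon (b :: w) -> canon w.
Proof. by case: w => //; case: b. Qed.

Lemma canon_cons0 w : canon w -> canon (cons0 w).
Proof. by case: w. Qed.

Lemma canon_va c : canon c.2 -> canon (va c).2.
Proof. by case: c => [[[] [|k]] w]. Qed.
Lemma canon_va' c : canon c.2 -> canon (va' c).2.
Proof. by case: c => [[[] [|k]] w]. Qed.
Lemma canon_vb c : canon c.2 -> canon (vb c).2.
Proof. by case: c => [[[] [|[|k]]] w] //=; exact: canon_cons0. Qed.
Lemma canon_vb' c : canon c.2 -> canon (vb' c).2.
Proof. by case: c => [[[] [|k]] [|[] w]] //=; exact: canon_cons. Qed.

Lemma va'K c : va (va' c) = c.
Proof. by case: c => [[[] [|k]] w]. Qed.

Lemma vb'K c : canon c.2 -> vb (vb' c) = c.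
Proof. by case: c => [[[] [|k]] [|[] [|b w]]]. Qed.

Lemma bin01 w : 0 <= bin w < 1.
Proof. by elim: w => [|b w]/=; [lra | case: b => /=; lra]. Qed.

Lemma bin_canon_gt0 b w : canon (b :: w) -> 0 < bin (b :: w).
Proof.
elim: w b => [|b' w ih] b; first by case: b => //= _; lra.
move=> /canon_cons h; have := ih b' h; rewrite /= => h0.
by case: b; rewrite /=; lra.
Qed.

Lemma bin_inj w w' : canon w -> canon w' -> bin w = bin w' -> w = w'.
Proof.
elim: w w' => [|b w ih] [|b' w'] // cw cw'.
- by move=> e; have := bin_canon_gt0 cw'; rewrite -e /= ltxx.
- by move=> e; have := bin_canon_gt0 cw; rewrite e /= ltxx.
have := bin01 w; have := bin01 w'; move=> h' h /= e.
have bb : b = b' by case: b b' e {cw cw'} => [] [] //=; lra.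
by rewrite bb (ih w')//; [exact: canon_cons cw|exact: canon_cons cw'|move: e; rewrite bb; lra].
Qed.

Let two_pow k : 1 <= 2 ^+ k :> R.
Proof. by rewrite exprn_ege1// ler1n. Qed.

Lemma pos_up k w : pos (true, k, w) = 1 - (2 - bin w) / 2 ^+ k / 4.
Proof.
rewrite /pos !exprS; have : 2 ^+ k != 0 :> R by rewrite expf_neq0.
by move=> h; field.
Qed.

Lemma pos_down k w : pos (false, k, w) = (1 + bin w) / 2 ^+ k / 4.
Proof.
rewrite /pos !exprS; have : 2 ^+ k != 0 :> R by rewrite expf_neq0.
by move=> h; field.
Qed.

Lemma up_bounds k w : 0 < (2 - bin w) / 2 ^+ k <= 2.
Proof.
have := bin01 w => h; have p := two_pow k.
rewrite divr_gt0 ?exprn_gt0//=; last lra.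
by rewrite ler_pdivrMr ?exprn_gt0//; nra.
Qed.

Lemma down_bounds k w : 0 < (1 + bin w) / 2 ^+ k < 2.
Proof.
have := bin01 w => h; have p := two_pow k.
rewrite divr_gt0 ?exprn_gt0//=; last lra.
by rewrite ltr_pdivrMr ?exprn_gt0//; nra.
Qed.

Let halfS (x : R) k : x / 2 ^+ k.+1 = x / 2 ^+ k / 2.
Proof.
rewrite exprS; have : 2 ^+ k != 0 :> R by rewrite expf_neq0.
by move=> h; field.
Qed.

Lemma a_fun_pos c : a_fun (pos c) = pos (va c).
Proof.
case: c => [[[] [|k]] w]; rewrite /va ?pos_up ?pos_down ?halfS ?expr0 ?divr1 /a_fun.
- by have := bin01 w => h; do 2 (case: ltP => ?; try lra).
- by have := up_bounds k w => h; do 2 (case: ltP => ?; try lra).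
- by have := bin01 w => h; do 2 (case: ltP => ?; try lra).
- by have := down_bounds k w => h; do 2 (case: ltP => ?; try lra).
Qed.

Lemma b_fun_pos c : b_fun (pos c) = pos (vb c).
Proof.
case: c => [[[] [|[|k]]] w]; rewrite /vb ?pos_up ?pos_down ?halfS ?expr0 ?divr1 /b_fun /a_fun.
- have -> : bin (cons0 w) = bin w / 2 by case: w => [|b w] /=; lra.
  by have := bin01 w => h; do 3 (case: ltP => ?; try lra).
- by have := bin01 w => h /=; do 3 (case: ltP => ?; try lra).
- by have := up_bounds k w => h; do 3 (case: ltP => ?; try lra).
- by have := bin01 w => h; do 3 (case: ltP => ?; try lra).
- by have := bin01 w => h; do 3 (case: ltP => ?; try lra).
- by have := down_bounds k w => h; do 3 (case: ltP => ?; try lra).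
Qed.

Lemma ainv_fun_pos c : ainv_fun (pos c) = pos (va' c).
Proof. by rewrite -{1}(va'K c) -a_fun_pos a_funK. Qed.

Lemma binv_fun_pos c : canon c.2 -> binv_fun (pos c) = pos (vb' c).
Proof. by move=> h; rewrite -{1}(vb'K h) -b_fun_pos b_funK. Qed.

Lemma pos_inj c c' : canon c.2 -> canon c'.2 -> pos c = pos c' -> c = c'.
Proof.
have down_up k w k' w' : pos (false, k, w) <> pos (true, k', w').
  by rewrite pos_up pos_down; have := down_bounds k w; have := up_bounds k' w'; lra.
(* The numerators range over a half-open interval with endpoints [1] and [2], so the quotient
   determines the exponent. *)
have aux (x y : R) k k' : 0 < x -> x < 2 * y -> x / 2 ^+ k = y / 2 ^+ k' -> (k <= k')%N.
  move=> x0 xy /eqP; rewrite eqr_div ?expf_neq0// => /eqP e.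
  rewrite leqNgt; apply/negP => kk.
  have h : 2 * 2 ^+ k' <= 2 ^+ k :> R by rewrite -exprS ler_eXn2l ?ltr1n.
  have p : 1 <= 2 ^+ k' :> R by exact: two_pow.
  by nra.
case: c c' => [[[] k] w] [[[] k'] w']; rewrite /fst/snd => cw cw' e.
- move: e; rewrite !pos_up => e.
  have {}e : (2 - bin w) / 2 ^+ k = (2 - bin w') / 2 ^+ k' by lra.
  have h := bin01 w; have h' := bin01 w'.
  have kk : k = k'.
    by apply/anti_leq/andP; split; [apply: aux e|apply: aux (esym e)]; lra.
  move/(congr1 ( *%R^~ (2 ^+ k'))): e; rewrite kk !divfK ?expf_neq0// => e.
  by rewrite (@bin_inj w w')//; lra.
- by case: (@down_up k' w' k w).
- by case: (@down_up k w k' w').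
- move: e; rewrite !pos_down => e.
  have {}e : (1 + bin w) / 2 ^+ k = (1 + bin w') / 2 ^+ k' by lra.
  have h := bin01 w; have h' := bin01 w'.
  have kk : k = k'.
    by apply/anti_leq/andP; split; [apply: aux e|apply: aux (esym e)]; lra.
  move/(congr1 ( *%R^~ (2 ^+ k'))): e; rewrite kk !divfK ?expf_neq0// => e.
  by rewrite (@bin_inj w w')//; lra.
Qed.

Definition vroot : vertex := (true, 0%N, [::]).

Lemma pos_vroot : pos vroot = 2^-1.
Proof. by rewrite /pos /=; lra. Qed.

Notation I01 := {x : R | 0 <= x <= 1}.

Lemma orbit_pos (y : I01) : orbitF half_pt y -> exists2 c, canon c.2 & val y = pos c.
Proof.
pose P (x : I01) := exists2 c, canon c.2 & val x = pos c.
(* Stating invariance as an equivalence makes the case of inverses immediate. *)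
suff inv g : thompsonF g -> forall x, P (g x) <-> P x.
  by move=> [g Fg <-]; apply/(inv g Fg); exists vroot => //; rewrite pos_vroot.
elim=> {g}.
- by [].
- move=> g [] -> x; split=> -[c cc e].
  + exists (va' c); first exact: canon_va'.
    by rewrite -ainv_fun_pos -e a_funK.
  + by exists (va c); [exact: canon_va | rewrite -a_fun_pos -e].
  + exists (vb' c); first exact: canon_vb'.
    by rewrite -binv_fun_pos// -e b_funK.
  + by exists (vb c); [exact: canon_vb | rewrite -b_fun_pos -e].
- by move=> g h _ ihg _ ihh x; rewrite /= ihg ihh.
- by move=> g h _ ih gh hg x; rewrite -ih hg.
Qed.

Lemma orbit_vertex (y : orbitF (@half_pt R)) :
  exists c, canon c.2 /\ val (val y) = pos c.
Proof. by have /set_mem/orbit_pos[c ? ?] := valP y; exists c. Qed.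

Definition vcoord (y : orbitF (@half_pt R)) : vertex := sval (cid (orbit_vertex y)).

Lemma coord_canon y : canon (vcoord y).2.
Proof. by rewrite /vcoord; case: cid => c []. Qed.

Lemma coord_pos y : val (val y) = pos (vcoord y).
Proof. by rewrite /vcoord; case: cid => c []. Qed.

Lemma coord_inj : injective vcoord.
Proof. by move=> y y' e; do 2 apply: val_inj; rewrite !coord_pos e. Qed.

Lemma coord_eq y c : canon c.2 -> val (val y) = pos c -> vcoord y = c.
Proof. by move=> cc e; apply: pos_inj => //; [exact: coord_canon | rewrite -coord_pos]. Qed.

Lemma coord_a y : vcoord (orbit_act thompsonF_a y) = va (vcoord y).
Proof.
by apply: coord_eq; [exact/canon_va/coord_canon | rewrite -a_fun_pos -coord_pos].
Qed.

Lemma coord_ainv y : vcoord (orbit_act thompsonF_ainv y) = va' (vcoord y).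
Proof.
by apply: coord_eq; [exact/canon_va'/coord_canon | rewrite -ainv_fun_pos -coord_pos].
Qed.

Lemma coord_b y : vcoord (orbit_act thompsonF_b y) = vb (vcoord y).
Proof.
by apply: coord_eq; [exact/canon_vb/coord_canon | rewrite -b_fun_pos -coord_pos].
Qed.

Lemma coord_binv y : vcoord (orbit_act thompsonF_binv y) = vb' (vcoord y).
Proof.
apply: coord_eq; first exact/canon_vb'/coord_canon.
by rewrite -binv_fun_pos -?coord_pos//; exact: coord_canon.
Qed.

Lemma coord_base : vcoord (base_point half_pt) = vroot.
Proof. by apply: coord_eq => //; rewrite pos_vroot. Qed.

End coordinates.

Section finite_sums.
Context {R : realType}.

Lemma ler_sum_subset (T : eqType) (s l : seq T) (u : T -> R) :
  (forall t, 0 <= u t) -> uniq s -> {subset s <= l} ->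
  \sum_(t <- s) u t <= \sum_(t <- l) u t.
Proof.
move=> u0; elim: s l => [|x s ih] l; first by rewrite big_nil sumr_ge0.
move=> /= /andP[xs us] sl; rewrite big_cons.
have xl : x \in l by rewrite sl// mem_head.
rewrite (perm_big _ (perm_to_rem xl)) big_cons lerD2l ih// => t ts.
have := sl t; rewrite in_cons ts orbT => /(_ isT) tl.
rewrite (perm_mem (perm_to_rem xl)) in_cons in tl.
by case/orP: tl => // /eqP tx; rewrite -tx ts in xs.
Qed.

Lemma esum_le_seq (T : choiceType) (u : T -> R) (C : R) :
  (forall t, 0 <= u t) ->
  (forall s : seq T, exists2 l : seq T, {subset s <= l} & \sum_(t <- l) u t <= C) ->
  (\esum_(t in [set: T]) (u t)%:E <= C%:E)%E.
Proof.
move=> u0 h; apply: ge_ereal_sup => _ [A [fA _] <-].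
rewrite fsbig_finite//= sumEFin lee_fin.
have [l sl lC] := h (finmap.enum_fset (fset_set A)); apply: le_trans lC.
by apply: ler_sum_subset => //; exact: finmap.fset_uniq.
Qed.

Lemma geom_le (r : R) N : 0 <= r -> r < 1 -> \sum_(k <- iota 0 N) r ^+ k <= (1 - r)^-1.
Proof.
move=> r0 r1; rewrite -[(1 - r)^-1]mul1r ler_pdivlMr ?subr_gt0//.
have -> : (\sum_(k <- iota 0 N) r ^+ k) * (1 - r) = 1 - r ^+ N.
  have -> : iota 0 N = index_iota 0 N by rewrite /index_iota subn0.
  rewrite big_mkord.
  by rewrite mulrC -[RHS]opprB subrX1 -mulNr opprB.
by rewrite gerBl exprn_ge0.
Qed.

Fixpoint words N : seq (seq bool) :=
  if N is N'.+1 then [::] :: map (cons false) (words N') ++ map (cons true) (words N')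
  else [:: [::]].

Lemma mem_words N w : (size w <= N)%N -> w \in words N.
Proof.
elim: N w => [|N ih] [|b w] //= h; rewrite in_cons mem_cat.
by case: b; rewrite map_f ?orbT// ih.
Qed.

(** Weights are multiplicative along a word, so the words of length [n] contribute [om [::] (q +
    s)^n]. *)
Lemma words_sum (om : seq bool -> R) (q s : R) N : 0 <= q -> 0 <= s -> q + s < 1 ->
  0 <= om [::] ->
  (forall w, om (false :: w) = om w * q) -> (forall w, om (true :: w) = om w * s) ->
  \sum_(w <- words N) om w <= om [::] / (1 - (q + s)).
Proof.
move=> q0 s0 qs o0 hq hs; have d0 : 0 < 1 - (q + s) by rewrite subr_gt0.
elim: N => [|N ih] /=.
  rewrite big_cons big_nil addr0 ler_pdivlMr// ler_piMr//.
  by rewrite lerBlDr lerDl addr_ge0.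
rewrite big_cons big_cat /= !big_map.
under eq_bigr do rewrite hq; under [X in _ + (_ + X)]eq_bigr do rewrite hs.
rewrite -!mulr_suml -mulrDr.
apply: (@le_trans _ _ (om [::] + om [::] / (1 - (q + s)) * (q + s))).
  by rewrite lerD2l ler_wpM2r// addr_ge0.
by rewrite le_eqVlt; apply/orP; left; apply/eqP; field; rewrite gt_eqF.
Qed.

End finite_sums.

(** * The product ansatz for the Green function *)

Section green.
Context {R : realType}.
Variables alpha beta : R.
Variables mD mP mS mT G : R[i].

(** Every edge leading away from the root contributes its weight times the resolvent ratio of the
    branch it enters: [mD] on downward rays, [mP] inside upward rays, [mS] at the foot of an upward
    ray, [mT] at the foot of a word branch. A digit [true] passes through such an upward foot, hence
    its extra factor [alpha mS]. *)
Fixpoint gam (w : seq bool) : R[i] :=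
  match w with
  | [::] => G
  | false :: w' => gam w' * (beta%:C * mT)
  | true :: w' => gam w' * (alpha%:C * beta%:C * mS * mT)
  end.

Definition green (c : vertex) : R[i] :=
  match c with
  | (false, k, w) => gam w * (alpha%:C * mD) ^+ k.+1
  | (true, 0%N, w) => gam w
  | (true, k.+1, w) => gam w * (alpha%:C * mS) * ((alpha + beta)%:C * mP) ^+ k
  end.

(** The square sum factors into one over rays and one over words, both geometric. Prefixing a digit
    multiplies the word weight by [|beta mT|^2] or [|beta mT|^2 |alpha mS|^2], whence the first
    hypothesis. *)
Lemma green_l2 :
  normsq (beta%:C * mT) * (1 + normsq (alpha%:C * mS)) < 1 ->
  normsq (alpha%:C * mD) < 1 -> normsq ((alpha + beta)%:C * mP) < 1 ->
  l2 (fun y : orbitF (@half_pt R) => green (vcoord y)).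
Proof.
move=> hT hD hP.
pose x2 := normsq (alpha%:C * mD); pose t2 := normsq ((alpha + beta)%:C * mP).
pose a2 := normsq (alpha%:C * mS).
pose rho (c : bool * nat) : R := match c with
  | (false, k) => x2 * x2 ^+ k | (true, 0%N) => 1 | (true, k.+1) => a2 * t2 ^+ k end.
have n0 (z : R[i]) : 0 <= normsq z by exact: normsq_ge0.
have nX (z : R[i]) k : normsq (z ^+ k) = normsq z ^+ k.
  by rewrite -!nc_sqr ncX -!exprM mulnC.
have gE c : normsq (green c) = rho c.1 * normsq (gam c.2).
  case: c => [[[] [|k]] w]; rewrite /green /rho /fst /snd.
  - by rewrite mul1r.
  - by rewrite 2!normsqM nX -/a2 -/t2; ring.
  - by rewrite normsqM nX expr1 expr0 mulr1 mulrC.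
  - by rewrite normsqM nX -/x2 -exprS mulrC.
have x20 : 0 <= x2 := n0 _; have t20 : 0 <= t2 := n0 _; have a20 : 0 <= a2 := n0 _.
have rho0 c : 0 <= rho c.
  by case: c => [[] [|k]]; rewrite /rho ?ler01 ?mulr_ge0 ?exprn_ge0 ?n0.
pose Cw := normsq G / (1 - (normsq (beta%:C * mT) * (1 + a2))).
have hW N : \sum_(w <- words N) normsq (gam w) <= Cw.
  rewrite /Cw mulrDr mulr1; apply: (@words_sum R (fun w => normsq (gam w))).
  - exact: n0.
  - exact: mulr_ge0 (n0 _) (n0 _).
  - by move: hT; rewrite mulrDr mulr1.
  - exact: n0.
  - by move=> w; rewrite /= normsqM.
  - by move=> w; rewrite /= normsqM -normsqM /a2 -normsqM -normsqM; congr normsq; ring.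
pose Cr := x2 * (1 - x2)^-1 + (1 + a2 * (1 - t2)^-1).
have hR N : \sum_(c <- [seq (b, k) | b <- [:: false; true], k <- iota 0 N]) rho c <= Cr.
  rewrite big_allpairs !big_cons big_nil /= addr0 /Cr.
  apply: lerD; first by rewrite -mulr_sumr ler_wpM2l// geom_le.
  case: N => [|N].
    rewrite big_nil; apply: addr_ge0 => //; apply: mulr_ge0 => //.
    by rewrite invr_ge0 subr_ge0; exact: ltW.
  rewrite -[iota 0 N.+1]/(0%N :: iota 1 N) big_cons lerD2l.
  rewrite (iotaDl 1 0) big_map.
  rewrite (eq_bigr (fun k => a2 * t2 ^+ k))//.
  by rewrite -mulr_sumr ler_wpM2l// geom_le.
rewrite /l2.
have -> : \esum_(y in [set: orbitF (@half_pt R)]) (normsq (green (vcoord y)))%:E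
    = \esum_(c in range (@vcoord R)) (normsq (green c))%:E.
  rewrite (@reindex_esum R _ _ setT (range (@vcoord R)) (@vcoord R))//.
  by split=> [y _|y y' _ _ /coord_inj//|c [y _ <-]]; exists y.
apply: (@le_lt_trans _ _ (Cr * Cw)%:E); last by rewrite ltry.
apply: (@le_trans _ _ (\esum_(c in [set: vertex]) (normsq (green c))%:E)).
  rewrite esum_mkcond; apply: le_esum => c _.
  by case: ifP => // _; rewrite lee_fin.
apply: esum_le_seq => // s.
pose N := (\max_(c <- s) (c.1.2 + size c.2).+1)%N.
exists [seq (bk, w) | bk <- [seq (b, k) | b <- [:: false; true], k <- iota 0 N],
   w <- words N].
  move=> [[b k] w] cs; have : ((k + size w).+1 <= N)%N.
    by apply: (@leq_bigmax_seq _ s xpredT (fun c : vertex => (c.1.2 + size c.2).+1) _ cs).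
  move=> h; apply: (allpairs_f (fun (bk : bool * nat) (w : seq bool) => (bk, w))).
    apply: (allpairs_f (fun (b : bool) (k : nat) => (b, k))); first by case: (b).
    by rewrite mem_iota add0n (leq_ltn_trans _ h)// leq_addr.
  by apply: mem_words; rewrite (leq_trans _ (ltnW h))// leq_addl.
rewrite big_allpairs.
rewrite (eq_bigr (fun c => rho c * \sum_(w <- words N) normsq (gam w))); last first.
  by move=> c _; rewrite mulr_sumr; apply: eq_bigr => w _; rewrite gE.
by rewrite -mulr_suml; apply: ler_pM => //; apply: sumr_ge0.
Qed.

End green.

Section hop.
Context {R : realType}.
Variables alpha beta : R.
Local Notation T := (orbitF (@half_pt R)).
Local Notation H := (@Hop R alpha beta half_pt).
Implicit Types f g : T -> R[i].

Let oa := @orbit_act R half_pt tha thompsonF_a.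
Let oa' := @orbit_act R half_pt thainv thompsonF_ainv.
Let ob := @orbit_act R half_pt thb thompsonF_b.
Let ob' := @orbit_act R half_pt thbinv thompsonF_binv.

Let oaK : cancel oa oa'. Proof. by move=> y; apply: val_inj; exact: thaK. Qed.
Let oa'K : cancel oa' oa. Proof. by move=> y; apply: val_inj; exact: thainvK. Qed.
Let obK : cancel ob ob'. Proof. by move=> y; apply: val_inj; exact: thbK. Qed.
Let ob'K : cancel ob' ob. Proof. by move=> y; apply: val_inj; exact: thbinvK. Qed.

Let HE f : H f = ladd
  (lscale alpha%:C (ladd (fun y => f (oa' y)) (fun y => f (oa y))))
  (lscale beta%:C (ladd (fun y => f (ob' y)) (fun y => f (ob y)))).
Proof. by []. Qed.

Lemma Hop_D f g : H (ladd f g) = ladd (H f) (H g).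
Proof. by apply/funext => y; rewrite !HE /ladd /lscale; ring. Qed.

Lemma Hop_Z c f : H (lscale c f) = lscale c (H f).
Proof. by apply/funext => y; rewrite !HE /ladd /lscale; ring. Qed.

Lemma l2_Hop f : l2 f -> l2 (H f).
Proof.
move=> lf; rewrite HE; apply: l2D; apply: l2Z; apply: l2D.
- exact: l2_reindex oa'K oaK lf.
- exact: l2_reindex oaK oa'K lf.
- exact: l2_reindex ob'K obK lf.
- exact: l2_reindex obK ob'K lf.
Qed.

Lemma Hop_sym f g : l2 f -> l2 g -> rin (H f) g = rin f (H g).
Proof.
move=> lf lg; rewrite !HE.
have a1 := l2_reindex oa'K oaK lf; have a2 := l2_reindex oaK oa'K lf.
have b1 := l2_reindex ob'K obK lf; have b2 := l2_reindex obK ob'K lf.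
have a1g := l2_reindex oa'K oaK lg; have a2g := l2_reindex oaK oa'K lg.
have b1g := l2_reindex ob'K obK lg; have b2g := l2_reindex obK ob'K lg.
have swap (e e' : T -> T) : cancel e e' -> cancel e' e ->
    rin (fun y => f (e y)) g = rin f (fun y => g (e' y)).
  move=> ee' e'e; rewrite -(rin_reindex f (fun y => g (e' y)) ee' e'e).
  by congr rin; apply/funext => y; rewrite ee'.
rewrite (rinDl (l2Z _ (l2D a1 a2)) (l2Z _ (l2D b1 b2)) lg).
rewrite (rinDr (l2Z _ (l2D a1g a2g)) (l2Z _ (l2D b1g b2g)) lf).
rewrite (rinZl _ (l2D a1 a2) lg) (rinZl _ (l2D b1 b2) lg).
rewrite (rinZr _ (l2D a1g a2g) lf) (rinZr _ (l2D b1g b2g) lf).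
rewrite (rinDl a1 a2 lg) (rinDl b1 b2 lg) (rinDr a1g a2g lf) (rinDr b1g b2g lf).
rewrite (swap _ _ oa'K oaK) (swap _ _ oaK oa'K) (swap _ _ ob'K obK) (swap _ _ obK ob'K).
by ring.
Qed.

(** The hypotheses are the continued-fraction recursions of the branches; at each vertex the
    resolvent equation is the matching recursion times the value at the parent. The root and the
    downward vertices are fixed by [b], which accounts for [2 * beta]. *)
Lemma green_eq (z mD mP mS mT G : R[i]) :
  mT != 0 ->
  mD * (z - (2 * beta)%:C - (alpha ^+ 2)%:C * mD) = 1 ->
  mP * (z - ((alpha + beta) ^+ 2)%:C * mP) = 1 ->
  mS * (z - ((alpha + beta) ^+ 2)%:C * mP - (beta ^+ 2)%:C * mT) = 1 ->
  mT * (z - (alpha ^+ 2)%:C * mD - (alpha ^+ 2)%:C * mS - (beta ^+ 2)%:C * mT) = 1 ->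
  G * (z - (2 * beta)%:C - (alpha ^+ 2)%:C * mD - (alpha ^+ 2)%:C * mS) = 1 ->
  let g := fun y : T => green alpha beta mD mP mS mT G (vcoord y) in
  delta (base_point half_pt) = ladd (lscale z g) (lscale (-1)%:C (H g)).
Proof.
move=> mT0 eD eP eS eT eG g; apply/funext => y.
rewrite /delta /ladd /lscale /Hop /g coord_a coord_ainv coord_b coord_binv.
have -> : (y == base_point half_pt) = (vcoord y == vroot).
  by rewrite -(@coord_base R) (inj_eq (@coord_inj R)).
have := coord_canon y; case: (vcoord y) => [[[] k] w]; last first.
  move=> _; rewrite (_ : (false, k, w) == vroot = false)//.
  apply/esym; case: k => [|k] /=.
    transitivity (gam alpha beta mS mT G w * alpha%:C *
       (mD * (z - (2 * beta)%:C - (alpha ^+ 2)%:C * mD) - 1)).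
      by rewrite rmorphN rmorph1; ring.
    by rewrite eD subrr mulr0.
  transitivity (gam alpha beta mS mT G w * (alpha%:C * mD) ^+ k.+1 * alpha%:C *
       (mD * (z - (2 * beta)%:C - (alpha ^+ 2)%:C * mD) - 1)).
    by rewrite rmorphN rmorph1 !exprS; ring.
  by rewrite eD subrr mulr0.
case: k => [|[|k]]; last 2 first.
- move=> _; rewrite (_ : (true, 1%N, w) == vroot = false)//; apply/esym => /=.
  transitivity (gam alpha beta mS mT G w * alpha%:C *
     (mS * (z - ((alpha + beta) ^+ 2)%:C * mP - (beta ^+ 2)%:C * mT) - 1)).
    by rewrite rmorphN rmorph1 expr0 expr1; ring.
  by rewrite eS subrr mulr0.
- move=> _; rewrite (_ : (true, k.+2, w) == vroot = false)//; apply/esym => /=.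
  transitivity (gam alpha beta mS mT G w * (alpha%:C * mS) *
     ((alpha + beta)%:C * mP) ^+ k * (alpha + beta)%:C *
     (mP * (z - ((alpha + beta) ^+ 2)%:C * mP) - 1)).
    by rewrite rmorphN rmorph1 !exprS; ring.
  by rewrite eP subrr mulr0.
case: w => [|[] w].
- move=> _; rewrite eqxx -[LHS]eG /=.
  by rewrite rmorphN rmorph1 expr0 expr1; ring.
- move=> _; rewrite (_ : (true, 0%N, true :: w) == vroot = false)//; apply/esym => /=.
  transitivity (gam alpha beta mS mT G w * (alpha%:C * beta%:C * mS) *
     (mT * (z - (alpha ^+ 2)%:C * mD - (alpha ^+ 2)%:C * mS - (beta ^+ 2)%:C * mT) - 1)).
    by rewrite rmorphN rmorph1 expr0 expr1; ring.
  by rewrite eT subrr mulr0.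
- move=> _; rewrite (_ : (true, 0%N, false :: w) == vroot = false)//; apply/esym => /=.
  transitivity (gam alpha beta mS mT G w * beta%:C *
     (mT * (z - (alpha ^+ 2)%:C * mD - (alpha ^+ 2)%:C * mS - (beta ^+ 2)%:C * mT) - 1)).
    by rewrite rmorphN rmorph1 expr0 expr1; ring.
  by rewrite eT subrr mulr0.
Qed.

End hop.

(** * The Poisson integral of the spectral measure *)

Section poisson.
Context {R : realType}.
Variables alpha beta : R.
Hypotheses (alpha0 : alpha != 0) (beta0 : beta != 0).
Local Notation T := (orbitF (@half_pt R)).
Local Notation H := (@Hop R alpha beta half_pt).
Variable E : pvm R T.
Hypothesis EH : spectral_resolution H E.

Lemma green_exists (z v : R[i]) : 0 < complex.Im z -> gsol alpha beta z v ->
  exists2 g : T -> R[i], l2 g &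
    delta (base_point half_pt) = ladd (lscale z g) (lscale (-1)%:C (H g)) /\
    g (base_point half_pt) = - Gf beta v.
Proof.
move=> z0 hv; have den := gsol_den alpha0 beta0 hv.
case: hv => [P [D [hP hD h v0]]].
have zb : 0 < complex.Im (z - (2 * beta)%:C) by rewrite cImD cImN cImR oppr0 addr0.
have [P0 nP] := isP_Im_gt0 hP z0; have [D0 nD] := isP_Im_gt0 hD zb.
have Q0 : 0 < complex.Im (D + (2 * beta)%:C) by rewrite cImD cImR addr0.
have [pE _ _] := hP; have [dE _ _] := hD.
have vn0 := Im_gt0_neq0 v0; have Pn0 := Im_gt0_neq0 P0; have Dn0 := Im_gt0_neq0 D0.
have r0 := rr_Im_gt0 beta0 (ltW P0) v0; have rn0 := Im_gt0_neq0 r0.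
have w0 : beta%:C * v + 1 != 0 by rewrite -nc_gt0.
have inv := cubic_inv beta0 (ltW P0) v0 h.
have mDE : z - (2 * beta)%:C - (alpha ^+ 2)%:C * D^-1 = D.
  by rewrite -dE mulrAC divff// mul1r opprB addrC subrK.
have mPE : z - ((alpha + beta) ^+ 2)%:C * P^-1 = P.
  by rewrite -pE mulrAC divff// mul1r opprB addrC subrK.
have mDE' : z - (alpha ^+ 2)%:C * D^-1 = D + (2 * beta)%:C.
  by rewrite -[in RHS]mDE; ring.
pose g := fun y : T => green alpha beta D^-1 P^-1 (rr beta P v)^-1 (- v) (- Gf beta v) (vcoord y).
exists g; last split.
- apply: green_l2.
  + have normsqN (u : R[i]) : normsq (- u) = normsq u.
      by case: u => a b; rewrite /normsq /= !sqrrN.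
    rewrite mulrN normsqN.
    apply: lt_le_trans (cubic_energy beta0 (ltW P0) (ltW Q0) v0 h).
    by rewrite ltrDl mulr_gt0// divr_gt0// normsq_gt0.
  + by rewrite normsqM normsqR normsqV ltr_pdivrMr ?mul1r// normsq_gt0.
  + by rewrite normsqM normsqR normsqV ltr_pdivrMr ?mul1r// normsq_gt0.
- apply: green_eq.
  + by rewrite oppr_eq0.
  + by rewrite mDE mulVf.
  + by rewrite mPE mulVf.
  + by rewrite mPE mulrN opprK -/(rr beta P v) mulVf.
  + rewrite mDE' -[RHS](mulfV vn0) -[v^-1]opprK inv.
    by move: (_ ^+ 2)%:C (_ ^+ 2)%:C (rr _ _ _) => s t r; ring.
  (* The right-hand side is [- (beta v + 1)^2 / v], which is the origin of the formula for the
     density. *)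
  + rewrite (_ : z - _ - _ - _ = - v^-1 - (beta ^+ 2)%:C * v - (2 * beta)%:C); last first.
      rewrite inv -mDE'.
      by move: (_ ^+ 2)%:C (_ ^+ 2)%:C (rr _ _ _) => s t r; ring.
    rewrite /Gf (_ : (beta ^+ 2)%:C = beta%:C ^+ 2); last by rewrite rmorphXn.
    rewrite (_ : (2 * beta)%:C = 2 * beta%:C); last by rewrite rmorphM rmorph_nat.
    by move: w0; move: (beta%:C) => b w0; field; rewrite vn0.
- by rewrite /g coord_base.
Qed.

Local Notation mu := (spectral_measure E (l2_delta (base_point half_pt))).

(** The integral is [|g|^2]. Pairing [delta = (z - H) g] with [i g] gives [y |g|^2], because
    [(g, g)] and [(H g, g)] are real, and also equals [- Im g] at the base point. *)
Lemma poisson_integral (x y : R) : 0 < y ->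
  (\int[mu]_t (((t - x) ^+ 2 + y ^+ 2)^-1)%:E = (ImG alpha beta (x +i* y) / y)%:E)%E.
Proof.
move=> y0; have z0 : 0 < complex.Im (x +i* y) by [].
have [v hv] := gsol_exists alpha beta0 z0.
have [g lg [dE gE]] := green_exists z0 hv.
have [[M0 hM0] HE] := EH.
(* Enlarging the bound of the spectrum secures [0 <= x + M]. *)
pose M := Num.max M0 `|x|.
have hM f : l2 f -> E `[- M, M]%classic f = f.
  move=> lf; rewrite -[in LHS](hM0 f lf) -pvm_setI//.
  have -> : `[- M, M]%classic `&` `[- M0, M0]%classic = `[- M0, M0]%classic :> set R.
    apply/setIidPr => t /=; rewrite !in_itv /= => /andP[h1 h2].
    have : M0 <= M by rewrite le_max lexx.
    by move=> h; apply/andP; split; lra.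
  exact: hM0.
have xM : 0 <= x + M.
  have : `|x| <= M by rewrite le_max lexx orbT.
  by have := ler_norm (- x); rewrite normrN; lra.
rewrite (resolvent_integral (@l2_Hop R alpha beta) (@Hop_D R alpha beta)
  (@Hop_Z R alpha beta) (@Hop_sym R alpha beta) HE hM lg _ xM (lt0r_neq0 y0) dE).
congr (_%:E); apply: (mulIf (lt0r_neq0 y0)); rewrite divfK ?gt_eqF//.
have lig := l2Z 'i%C lg; have lHg := l2_Hop alpha beta lg.
have : rin (delta (base_point half_pt)) (lscale 'i%C g) = ImG alpha beta (x +i* y).
  rewrite rinC rin_delta /lscale gE /ImG (Vc_gsol alpha0 beta0 hv).
  by rewrite cReM /= cImN; ring.
move=> <-; rewrite dE.
have sp : lscale (x +i* y) g = ladd (lscale x%:C g) (lscale y%:C (lscale 'i%C g)).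
  apply/funext => t; rewrite /lscale /ladd [x +i* y]complexE /=; ring.
have lN := l2Z (-1)%:C lHg; have lx := l2Z x%:C lg; have ly := l2Z y%:C lig.
rewrite sp (rinDl (l2D lx ly) lN lig) (rinDl lx ly lig).
rewrite (rinZl _ lg lig) (rinZl _ lig lig) (rinZl _ lHg lig) (rin_ii lg lg).
have g0 : rin g (lscale 'i%C g) = 0.
  by have := rin_i lg lg; rewrite rinC; lra.
have h0 : rin (H g) (lscale 'i%C g) = 0.
  have := rin_i lHg lg; rewrite -Hop_Z (Hop_sym alpha beta lig lg) rinC; lra.
by rewrite g0 h0; ring.
Qed.

End poisson.

(** * Stieltjes inversion *)

Section stieltjes_inversion.
Local Open Scope ereal_scope.
Context {R : realType}.
Variable mu : {finite_measure set (measurableTypeR R) -> \bar R}.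
Variables (u : R -> R -> R) (h : R -> R).
Local Notation leb := (@lebesgue_measure R).

Let kern (x y t : R) : R := (y / ((t - x) ^+ 2 + y ^+ 2))%R.

Hypothesis uE : forall x y, (0 < y)%R -> \int[mu]_t (kern x y t)%:E = (u x y)%:E.
Hypothesis uh : forall x, (u x n.+1%:R^-1 @[n --> \oo] --> pi * h x)%R.
Hypothesis u_bound : forall a b, exists C, forall x y,
  (a <= x <= b -> 0 < y <= 1 -> u x y <= C)%R.
Hypothesis hc : continuous h.

Let kern_ge0 x y t : (0 < y)%R -> (0 <= kern x y t)%R.
Proof. by move=> y0; rewrite /kern divr_ge0 ?addr_ge0 ?sqr_ge0// ltW. Qed.

Let u_ge0 x y : (0 < y)%R -> (0 <= u x y)%R.
Proof.
by move=> y0; rewrite -lee_fin -uE//; apply: integral_ge0 => t _; rewrite lee_fin kern_ge0.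
Qed.

Let measurable_kern y : (0 < y)%R ->
  measurable_fun setT (fun p : measurableTypeR R * measurableTypeR R =>
    kern p.1 y p.2).
Proof.
move=> y0; apply: measurable_funM => //.
have y20 : (0 < y ^+ 2)%R by rewrite exprn_gt0.
apply: (measurable_inv_ge y20) => [p|]; first by rewrite lerDr sqr_ge0.
by apply: measurable_funD => //; apply: measurable_funX; apply: measurable_funB.
Qed.

Let atanF (t y x : R) : R := atan ((x - t) / y).

Let atanF_derive (t y x : R) : (0 < y)%R -> is_derive x 1%R (atanF t y) (kern x y t).
Proof.
move=> y0; have -> : atanF t y = (@atan R) \o (fun x => ((x - t) / y)%R) by [].
have d2 : is_derive x 1%R (fun x : R => ((x - t) / y)%R) (y^-1)%R.
  by apply: is_derive_eq; rewrite !(scaler0, addr0, add0r, subr0) /GRing.scale /= mulr1.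
apply: is_derive_eq; rewrite /kern /GRing.scale /=.
have y20 : (0 < y ^+ 2)%R by rewrite exprn_gt0.
by field; apply/andP; split; rewrite gt_eqF// ltr_wpDl ?sqr_ge0.
Qed.

Let kern_continuous (t y : R) : (0 < y)%R -> continuous (fun x => kern x y t).
Proof.
move=> y0 x; apply: cvgM; first exact: cvg_cst.
have y20 : (0 < y ^+ 2)%R by rewrite exprn_gt0.
apply: cvgV; first by rewrite gt_eqF// ltr_wpDl ?sqr_ge0.
apply: cvgD; last exact: cvg_cst.
under [X in X @ _]funext do rewrite expr2.
rewrite expr2.
by apply: cvgM; apply: cvgB; (exact: cvg_cst || exact: cvg_id).
Qed.

Let kern_integral (a b y t : R) : (a < b)%R -> (0 < y)%R ->
  \int[leb]_(x in `[a, b]) (kern x y t)%:E =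
  (atan ((b - t) / y) - atan ((a - t) / y))%:E.
Proof.
move=> ab y0; have dF x := atanF_derive t x y0.
have cF x : {for x, continuous (atanF t y)}.
  by apply: differentiable_continuous; apply/derivable1_diffP; exact: (@ex_derive _ _ _ _ _ _ _ (dF x)).
rewrite (@continuous_FTC2 _ _ (atanF t y))//.
- by apply: continuous_subspaceT => x; exact: kern_continuous.
- split.
  + by move=> x _; exact: (@ex_derive _ _ _ _ _ _ _ (dF x)).
  + by apply: cvg_at_right_filter; exact: cF.
  + by apply: cvg_at_left_filter; exact: cF.
- by move=> x _; rewrite derive1E; exact: (@derive_val _ _ _ _ _ _ _ (dF x)).
Qed.

Let tonelli (a b y : R) : (a < b)%R -> (0 < y)%R ->
  \int[leb]_(x in `[a, b]) (u x y)%:E =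
  \int[mu]_t (atan ((b - t) / y) - atan ((a - t) / y))%:E.
Proof.
move=> ab y0; pose D := `[a, b]%classic : set (measurableTypeR R).
pose f (p : measurableTypeR R * measurableTypeR R) : \bar R := (kern p.1 y p.2 * \1_D p.1)%:E.
have mf : measurable_fun setT f.
  apply/measurable_EFinP; apply: measurable_funM; first exact: measurable_kern.
  have m1 : measurable_fun setT (\1_D : measurableTypeR R -> R).
    by apply: measurable_indic; exact: measurable_itv.
  exact: (measurableT_comp m1 measurable_fst).
have f0 p : 0 <= f p by rewrite lee_fin mulr_ge0// kern_ge0.
have := @fubini_tonelli _ _ _ _ _ leb mu f mf f0.
rewrite (_ : \int[leb]_x \int[mu]_t f (x, t) = \int[leb]_(x in `[a, b]) (u x y)%:E); last first.
  rewrite [RHS]integral_mkcond; apply: eq_integral => x _.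
  rewrite /patch /f /D /= indicE; case: ifPn => xD; rewrite ?xD.
    by rewrite -uE//; apply: eq_integral => t _; rewrite mulr1.
  by apply: integral0_eq => t _; rewrite mulr0.
move=> ->; apply: eq_integral => t _; rewrite -(kern_integral t ab y0).
rewrite [RHS]integral_mkcond; apply: eq_integral => x _.
rewrite /patch /f /D /= indicE; case: ifPn => xD; rewrite ?xD ?mulr1//.
by rewrite mulr0.
Qed.

Let atan_scaled (c : R) : (atan (c / n.+1%:R^-1) @[n --> \oo] --> pi / 2 * Num.sg c)%R.
Proof.
have pos (d : R) : (0 < d)%R -> (atan (d * n.+1%:R) @[n --> \oo] --> pi / 2)%R.
  move=> d0; apply: (cvg_comp _ _ _ (@cvgy_atan R)).
  apply/cvgryPge => A; near=> n; rewrite -ler_pdivrMl// (le_trans (ler_norm _))//.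
  have : (`|d^-1 * A| <= n%:R)%R by near: n; exact: nbhs_infty_ger.
  by move=> /le_trans; apply; rewrite ler_nat.
under [X in X @ _]funext do rewrite invrK.
have [c0|c0|->] := ltgtP c 0%R.
- rewrite ltr0_sg// mulrN1.
  have -> : (fun n => atan (c * n.+1%:R)) = (fun n => - atan (- c * n.+1%:R))%R :> (nat -> R).
    by apply/funext => n; rewrite mulNr atanN opprK.
  by apply: cvgN; apply: pos; rewrite oppr_gt0.
- by rewrite gtr0_sg// mulr1; exact: pos.
- rewrite sgr0 mulr0; under [X in X @ _]funext do rewrite mul0r atan0.
  exact: cvg_cst.
Unshelve. all: by end_near. Qed.

Let h_ge0 x : (0 <= h x)%R.
Proof.
have : (0 <= pi * h x)%R.
  rewrite -(cvg_lim (@Rhausdorff R) (@uh x)).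
  apply: limr_ge; first by apply/cvg_ex; eexists; exact: uh.
  by apply: nearW => n; exact: u_ge0.
by rewrite pmulr_rge0// pi_gt0.
Qed.

(** The limit of the integrated Poisson kernel: [pi] inside []a, b[], half of it at the endpoints,
    [0] outside. *)
Let L (a b t : R) : R := (pi / 2 * (Num.sg (b - t) - Num.sg (a - t)))%R.

(** Dominated convergence on both sides of [tonelli] along [y = 1 / (n + 1)]: the arctangents are
    dominated by [pi], the functions [u] by their local bound. *)
Let bulk (a b : R) : (a < b)%R ->
  \int[mu]_t (L a b t)%:E = \int[leb]_(x in `[a, b]) (pi * h x)%:E /\
  measurable_fun setT (fun t : measurableTypeR R => (L a b t)%:E).
Proof.
move=> ab; have [C uC] := u_bound a b.
pose y n : R := (n.+1%:R^-1)%R.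
have y0 n : (0 < y n)%R by rewrite /y invr_gt0.
have y1 n : (y n <= 1)%R by rewrite /y invf_le1// ler1n.
pose f_ n (t : measurableTypeR R) : \bar R := (atan ((b - t) / y n) - atan ((a - t) / y n))%:E.
pose g_ n (x : measurableTypeR R) : \bar R := (u x (y n))%:E.
have mf_ n : measurable_fun setT (f_ n).
  apply/measurable_EFinP; apply: measurable_funB; apply: (measurableT_comp (f := @atan R));
    by [apply: continuous_measurable_fun => ?; exact: continuous_atan |
        apply: measurable_funM => //; exact: measurable_funB].
have f_cvg t : f_ n t @[n --> \oo] --> (L a b t)%:E.
  apply: cvg_EFin; first exact: nearW.
  rewrite /L mulrBr; apply: cvgB; exact: atan_scaled.
have mL : measurable_fun setT (fun t : measurableTypeR R => (L a b t)%:E).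
  by apply: (emeasurable_fun_cvg f_) => // t _; exact: f_cvg.
split=> //.
have fb n t : `|f_ n t| <= pi%:E.
  rewrite /f_ /= lee_fin; have h1 := atan_gtNpi2 ((b - t) / y n).
  have h2 := atan_ltpi2 ((b - t) / y n); have h3 := atan_gtNpi2 ((a - t) / y n).
  have h4 := atan_ltpi2 ((a - t) / y n).
  by rewrite ler_norml; lra.
have ipi : mu.-integrable setT (EFin \o cst pi) by exact: finite_measure_integrable_cst.
have [_ _ H1] := @dominated_convergence _ _ _ mu setT measurableT f_ _ _ mf_ mL
  (aeW mu (fun t _ => f_cvg t)) ipi (aeW mu (fun t n _ => fb n t)).
have mg_ n : measurable_fun `[a, b] (g_ n).
  apply: measurable_funTS; rewrite /g_.
  have -> : (fun x => (u x (y n))%:E) = fun x => \int[mu]_t (kern x (y n) t)%:E.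
    by apply/funext => x; rewrite uE.
  pose f (p : measurableTypeR R * measurableTypeR R) : \bar R := (kern p.1 (y n) p.2)%:E.
  have mf : measurable_fun setT f by apply/measurable_EFinP; exact: measurable_kern.
  have f0 p : 0 <= f p by rewrite lee_fin kern_ge0.
  exact: (@measurable_fun_fubini_tonelli_F _ _ _ _ _ mu f mf f0).
have g_cvg (x : measurableTypeR R) : g_ n x @[n --> \oo] --> (pi * h x)%:E.
  by apply: cvg_EFin; [exact: nearW | exact: uh].
have mh : measurable_fun `[a, b] (fun x : measurableTypeR R => (pi * h x)%:E).
  apply: (emeasurable_fun_cvg g_) => // x _; exact: g_cvg.
have gb n x : `[a, b]%classic x -> `|g_ n x| <= C%:E.
  rewrite /= in_itv /= => xab; rewrite /g_ /= lee_fin ger0_norm ?u_ge0//.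
  by apply: uC => //; rewrite y0 y1.
have iC : leb.-integrable `[a, b] (EFin \o cst C).
  apply: continuous_compact_integrable; first exact: segment_compact.
  by apply: continuous_subspaceT => ?; exact: cvg_cst.
have [_ _ H2] := @dominated_convergence _ _ _ leb `[a, b]%classic (measurable_itv _) g_ _ _ mg_ mh
  (aeW leb (fun x _ => g_cvg x)) iC (aeW leb (fun x n xab => gb n x xab)).
have e : (fun n => \int[mu]_t f_ n t) = (fun n => \int[leb]_(x in `[a, b]) g_ n x).
  by apply/funext => n; rewrite -tonelli.
rewrite e in H1.
exact: (cvg_unique _ H1 H2).
Qed.

Let mEh (D : set (measurableTypeR R)) : measurable D ->
  measurable_fun D (fun x : measurableTypeR R => (h x)%:E).
Proof.
move=> mD; apply/measurable_EFinP; apply: measurable_funTS.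
exact: continuous_measurable_fun.
Qed.

Let J a b := \int[leb]_(x in `[a, b]) (pi * h x)%:E.

Let sg_bound (c : R) : (-1 <= Num.sg c <= 1)%R.
Proof. by have [?|?|->] := ltgtP c 0%R; [rewrite ltr0_sg|rewrite gtr0_sg|rewrite sgr0]; lra. Qed.

Let L_ge a b t : (a < b)%R -> ((pi * \1_(`]a, b[%classic : set R) t) <= L a b t)%R.
Proof.
move=> ab; rewrite /L indicE; case: (boolP (t \in _)) => [/set_mem /=|_].
  rewrite in_itv /= => /andP[ta tb].
  by rewrite gtr0_sg ?subr_gt0// ltr0_sg ?subr_lt0//; lra.
rewrite mulr0 mulr_ge0// ?divr_ge0 ?pi_ge0// subr_ge0.
have [at0|at0] := ltP (a - t)%R 0%R; first by rewrite (ltr0_sg at0); have := sg_bound (b - t)%R; lra.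
have bt0 : (0 < b - t)%R by lra.
by rewrite (gtr0_sg bt0); have := sg_bound (a - t)%R; lra.
Qed.

Let L_le a b t : (a < b)%R -> (L a b t <= pi * \1_(`[a, b]%classic : set R) t)%R.
Proof.
move=> ab; rewrite /L indicE; have p0 := @pi_ge0 R.
case: (boolP (t \in _)) => [_|].
  rewrite mulr1 -[leRHS](divfK (_ : 2 != 0)%R)// ler_wpM2l ?divr_ge0//.
  by have := sg_bound (b - t)%R; have := sg_bound (a - t)%R; lra.
rewrite notin_setE /= in_itv /= => /negP; rewrite negb_and -!ltNge => /orP[ta|tb].
  by rewrite !gtr0_sg ?subr_gt0 ?subrr ?mulr0//; exact: lt_trans ab.
by rewrite !ltr0_sg ?subr_lt0 ?subrr ?mulr0//; exact: lt_trans tb.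
Qed.

Let indic_int (A : set (measurableTypeR R)) : measurable A ->
  \int[mu]_t (pi * \1_A t)%:E = pi%:E * mu A.
Proof.
move=> mA; under eq_integral do rewrite EFinM.
rewrite ge0_integralZl ?lee_fin ?pi_ge0//.
  by rewrite integral_indic// setIT.
by apply/measurable_EFinP; exact: measurable_indic.
Qed.

Let L_ge0 a b t : (a < b)%R -> (0 <= L a b t)%R.
Proof. by move=> ab; apply: le_trans (L_ge t ab); rewrite mulr_ge0// pi_ge0. Qed.

Let mu_oo a b : (a < b)%R -> pi%:E * mu `]a, b[%classic <= J a b.
Proof.
move=> ab; have [e mL] := bulk ab; rewrite /J -e -indic_int//.
apply: ge0_le_integral => //.
- by move=> t _; rewrite lee_fin mulr_ge0// pi_ge0.
- apply/measurable_EFinP; exact: measurable_funM.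
- by move=> t _; rewrite lee_fin L_ge.
Qed.

Let mu_cc a b : (a < b)%R -> J a b <= pi%:E * mu `[a, b]%classic.
Proof.
move=> ab; have [e mL] := bulk ab; rewrite /J -e -indic_int//.
apply: ge0_le_integral => //.
- by move=> t _; rewrite lee_fin L_ge0.
- apply/measurable_EFinP; exact: measurable_funM.
- by move=> t _; rewrite lee_fin L_le.
Qed.

Let J_le a b : exists C, forall a' b', (a <= a')%R -> (a' < b')%R -> (b' <= b)%R ->
  J a' b' <= (C * (b' - a'))%:E.
Proof.
have [C uC] := u_bound a b; exists C => a' b' aa ab bb.
have hC x : (a' <= x <= b')%R -> (pi * h x <= C)%R.
  move=> xab; rewrite -(cvg_lim (@Rhausdorff R) (@uh x)).
  apply: limr_le; first by apply/cvg_ex; eexists; exact: uh.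
  apply: nearW => n; apply: uC; first by lra.
  by rewrite invr_gt0 ltr0n invf_le1// ler1n.
apply: (@le_trans _ _ (\int[leb]_(x in `[a', b']) (cst C%:E) x)).
  apply: ge0_le_integral => //.
  - by move=> x _; rewrite lee_fin mulr_ge0// pi_ge0.
  - apply/measurable_EFinP; apply: measurable_funM => //.
    by apply: measurable_funTS; exact: continuous_measurable_fun.
have l : leb `[a', b']%classic = (b' - a')%:E.
  by rewrite lebesgue_measure_itv /= lte_fin ab.
rewrite integral_cst// EFinM (_ : (b' - a')%:E = leb `[a', b']%classic)//.
Qed.

(** Endpoints carry only half weight in [L], so [mu_oo] and [mu_cc] differ by atoms. An atom would
    lie in arbitrarily short intervals, whose mass is at most proportional to their length. *)
Let mu_set1 c : mu [set c] = 0.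
Proof.
apply/eqP; rewrite eq_le measure_ge0 andbT.
have [C hC] := J_le (c - 1)%R (c + 1)%R.
have muc : mu [set c] \is a fin_num by rewrite fin_num_measure.
rewrite -(fineK muc) lee_fin leNgt; apply/negP => m0.
have C0 : (0 <= C)%R.
  have J0 : 0 <= J c (c + 1)%R by apply: integral_ge0 => x _; rewrite lee_fin mulr_ge0// pi_ge0.
  have a1 : (c - 1 <= c)%R by lra.
  have a2 : (c < c + 1)%R by lra.
  have := le_trans J0 (hC _ _ a1 a2 (lexx _)); rewrite lee_fin.
  by rewrite (_ : c + 1 - c = 1)%R ?mulr1//; ring.
pose m := fine (mu [set c]).
(* The interval of length [2 e] then has [pi] times its mass at most [2 e C < pi m]; [C + 1] avoids
   a zero denominator. *)
pose e : R := (Num.min 1 (pi * m / (4 * (C + 1))))%R.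
have pm : (0 < pi * m)%R by rewrite mulr_gt0 ?pi_gt0.
have e0 : (0 < e)%R by rewrite lt_min ltr01 divr_gt0// mulr_gt0//; lra.
have e1 : (e <= 1)%R by rewrite ge_min lexx.
have e2 : (e * (4 * (C + 1)) <= pi * m)%R.
  by rewrite -ler_pdivlMr; [rewrite ge_min lexx orbT | lra].
have ab : (c - e < c + e)%R by lra.
have h1 : (pi * m)%:E <= pi%:E * mu `](c - e)%R, (c + e)%R[%classic.
  rewrite EFinM /m fineK// lee_wpmul2l ?lee_fin ?pi_ge0// le_measure ?inE//.
  by move=> x /= ->; rewrite in_itv /=; lra.
have a1 : (c - 1 <= c - e)%R by lra.
have a2 : (c + e <= c + 1)%R by lra.
have := le_trans (le_trans h1 (mu_oo ab)) (hC (c - e)%R (c + e)%R a1 ab a2).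
rewrite lee_fin => h2; have : (e * (C + 1) > 0)%R by rewrite mulr_gt0//; lra.
nra.
Qed.

Let mu_oc a b : (a < b)%R -> mu `]a, b]%classic = \int[leb]_(x in `]a, b]) (h x)%:E.
Proof.
move=> ab.
have mcc : mu `[a, b]%classic = mu `]a, b]%classic.
  rewrite -(@setU1itv _ _ (BRight b) a false) ?bnd_simp ?ltW// measureU//.
    by rewrite -[RHS]add0e; congr (_ + _); exact: mu_set1.
  by apply/seteqP; split=> // x /= [->]; rewrite in_itv /= ltxx.
have moo : mu `]a, b[%classic = mu `]a, b]%classic.
  rewrite -[in RHS](@setUitv1 _ _ (BRight a) b true) ?bnd_simp// measureU//.
    by rewrite -[LHS]adde0; congr (_ + _); symmetry; exact: mu_set1.
  by apply/seteqP; split=> // x /= [+ xb]; rewrite xb in_itv /= ltxx andbF.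
have h1 := mu_oo ab; have h2 := mu_cc ab; rewrite moo in h1; rewrite mcc in h2.
have e : pi%:E * mu `]a, b]%classic = J a b by apply/le_anti/andP.
have : pi%:E * mu `]a, b]%classic = pi%:E * \int[leb]_(x in `]a, b]) (h x)%:E.
  rewrite e /J; under eq_integral do rewrite EFinM.
  rewrite ge0_integralZl ?lee_fin ?pi_ge0//; [|exact: mEh|by move=> x _; rewrite lee_fin].
  by congr (_ * _); symmetry; apply: integral_itv_obnd_cbnd; exact: mEh.
move=> /(congr1 (fun x => (pi^-1)%:E * x)); rewrite !muleA -EFinM mulVf ?mul1e//.
by rewrite gt_eqF// pi_gt0.
Qed.

Lemma stieltjes_inversion (A : set (measurableTypeR R)) : measurable A ->
  mu A = \int[leb]_(x in A) (h x)%:E.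
Proof.
have mh : measurable_fun setT (h : measurableTypeR R -> R) by exact: continuous_measurable_fun.
pose nu := with_density leb h_ge0 mh.
move=> mA; rewrite -[RHS]/(nu A).
pose g (k : nat) : set R := `](- k%:R)%R, (k%:R)%R]%classic.
have mG : (measurable : set (set (measurableTypeR R))) = <<s @ocitv R >> by [].
apply: (@measure_unique _ R (measurableTypeR R) (@ocitv R) g mG _ _ _ mu nu) => //.
- exact: ocitvI.
- by move=> k; exact: is_ocitv.
- apply/seteqP; split=> // x _.
  pose k := Num.truncn `|x|.
  exists k.+1 => //=; rewrite /g /= in_itv /=.
  have : (`|x| < k.+1%:R)%R by exact: truncnS_gt.
  by rewrite ltr_norml => /andP[-> /ltW].
- move=> X /ocitvP[->|[x xx ->]]; first by rewrite !measure0.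
  exact: mu_oc.
- move=> k; rewrite ltey_eq; apply/orP; left; apply: fin_num_measure.
  exact: measurable_itv.
Qed.

End stieltjes_inversion.

(** * The boundary of the support *)

Section boundary.
Context {R : realType}.
Variables alpha beta : R.
Hypotheses (alpha0 : alpha != 0) (beta0 : beta != 0).
Implicit Types (P D v r : R[i]).

Lemma isP_disc (p z : R) P : isP p z%:C P -> complex.Im P = 0 \/
  complex.Re P = z / 2 /\ z ^+ 2 <= 4 * p ^+ 2.
Proof.
move=> [e _ _].
have := congr1 (@complex.Im R) e; have := congr1 (@complex.Re R) e.
case: P {e} => a c; rewrite cReM cImM !cReD !cImD !cReN !cImN cReR cImR /= => hre him.
have [->|c0] := eqVneq c 0; first by left.
right; have a2 : a = z / 2.
  have : c * (z - 2 * a) = 0 by move: him; lra.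
  by move/eqP; rewrite mulf_eq0 (negbTE c0) /= => /eqP; lra.
split=> //; have := sqr_ge0 c; rewrite a2 in hre; move: hre; rewrite !expr2; lra.
Qed.

Lemma isP_Im0 (p z : R) P : isP p z%:C P -> 4 * p ^+ 2 < z ^+ 2 -> complex.Im P = 0.
Proof. by move=> /isP_disc[//|[_]]; lra. Qed.

Lemma isP_Im0_disc (p z : R) P : isP p z%:C P -> complex.Im P = 0 ->
  4 * p ^+ 2 <= z ^+ 2.
Proof.
move=> [e _ _]; case: P e => a c e /= c0.
have := congr1 (@complex.Re R) e.
rewrite cReM !cReD !cImD !cReN !cImN !cReR !cImR /= c0 => h.
have := sqr_ge0 (2 * a - z); move: h; rewrite !expr2; lra.
Qed.

(** The imaginary part of the fixed-point equation at a real root is a sum of two nonnegative terms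
    equal to zero. *)
Lemma cubic_real_root P Q (x : R) : P != 0 -> 0 <= complex.Im P ->
  0 <= complex.Im Q -> cubic alpha beta P Q x%:C = 0 ->
  [/\ x != 0, rr beta P x%:C != 0, complex.Im P = 0 & complex.Im Q = 0].
Proof.
move=> P0 iP iQ; rewrite cubicE => h.
have x0 : x != 0.
  apply/eqP => x0; move/eqP: P0; apply; rewrite -[RHS]h x0 /rr rmorph0; ring.
have xC : (x%:C : R[i]) != 0 by rewrite fmorph_eq0.
have aC : ((alpha ^+ 2)%:C : R[i]) != 0 by rewrite fmorph_eq0 expf_neq0.
have r0 : rr beta P x%:C != 0.
  apply/eqP => r0; move/eqP: h; rewrite r0 mulr0 mul0r addr0 add0r oppr_eq0.
  by rewrite mulf_eq0 (negbTE aC) (negbTE xC).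
have iR : complex.Im (rr beta P x%:C) = complex.Im P.
  by rewrite /rr -rmorphM cImD cImR addr0.
have e : (- x^-1)%:C = Q + (beta ^+ 2 * x)%:C - (alpha ^+ 2)%:C / rr beta P x%:C :> R[i].
  move: aC r0 h; rewrite !rmorphM rmorphN fmorphV.
  move: (rr _ _ _) ((alpha ^+ 2)%:C) ((beta ^+ 2)%:C) => y c d aC r0 h.
  apply: (mulfI (mulf_neq0 r0 xC)); apply/eqP; rewrite -subr_eq0 -oppr_eq0.
  by apply/eqP; rewrite -[RHS]h; field; rewrite r0 xC.
have N0 : 0 < normsq (rr beta P x%:C) by rewrite normsq_gt0.
have := congr1 (@complex.Im R) e.
rewrite !cImD cImN !cImR cImM cImR mul0r addr0 cReR cImV iR addr0.
have a2 : 0 < alpha ^+ 2 by rewrite exprn_even_gt0.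
move=> h2; have k0 : 0 <= alpha ^+ 2 * (complex.Im P / normsq (rr beta P x%:C)).
  by apply: mulr_ge0; [exact: ltW|apply: divr_ge0 => //; exact: ltW].
have hQ : complex.Im Q = 0 by move: h2; rewrite mulNr mulrN; lra.
have : alpha ^+ 2 * (complex.Im P / normsq (rr beta P x%:C)) = 0.
  by move: h2; rewrite mulNr mulrN; lra.
move/eqP; rewrite mulf_eq0 (gt_eqF a2) mulf_eq0 invr_eq0 (gt_eqF N0) orbF /= => /eqP.
by split.
Qed.

Definition gsupp : set R := [set x | exists v, gsol alpha beta x%:C v].

Lemma closure_dist (A : set R) x : closure A x -> forall d, 0 < d ->
  exists2 y, A y & `|y - x| < d.
Proof.
move=> Ax d d0; have [y [Ay xy]] := Ax _ (nbhsx_ballx x d d0).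
by exists y => //; rewrite distrC.
Qed.

(** The values [V(x')] for [x'] near [x] come close to one of the three roots at [x]. If every root
    without the property [K] repels such solutions, some root must satisfy [K]. *)
Lemma boundary_root x P D : isP (alpha + beta) x%:C P ->
  isP alpha (x - 2 * beta)%:C D -> closure gsupp x -> ~ gsupp x ->
  forall K : R[i] -> Prop,
  (forall r, cubic alpha beta P (D + (2 * beta)%:C) r = 0 -> ~ K r ->
    exists2 e, 0 < e & forall x' P' D' v, `|x' - x| < e ->
      isP (alpha + beta) x'%:C P' -> isP alpha (x' - 2 * beta)%:C D' ->
      cubic alpha beta P' (D' + (2 * beta)%:C) v = 0 -> 0 < complex.Im v ->
      nc (v - r) < e -> False) ->
  exists r, cubic alpha beta P (D + (2 * beta)%:C) r = 0 /\ K r.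
Proof.
move=> hP hD cx nx K hK; apply: contrapT => nK.
set C := cubic alpha beta P (D + (2 * beta)%:C) in hK nK.
have hr r : exists2 e, 0 < e & C r = 0 -> forall x' P' D' v, `|x' - x| < e ->
      isP (alpha + beta) x'%:C P' -> isP alpha (x' - 2 * beta)%:C D' ->
      cubic alpha beta P' (D' + (2 * beta)%:C) v = 0 -> 0 < complex.Im v ->
      nc (v - r) < e -> False.
  have [Cr|Cr] := pselect (C r = 0); last by exists 1.
  by have [|e e0 h] := hK r Cr; [move=> Kr; apply: nK; exists r|exists e].
have [r1 [r2 [r3 C3]]] := cubic_split alpha beta0 P (D + (2 * beta)%:C).
have [e1 e10 h1] := hr r1; have [e2 e20 h2] := hr r2; have [e3 e30 h3] := hr r3.
pose e := Num.min e1 (Num.min e2 e3).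
have e0 : 0 < e by rewrite !lt_min e10 e20.
have ep : 0 < beta ^+ 4 * e ^+ 3 by rewrite mulr_gt0 ?(exprn_gt0 _ e0)// exprn_even_gt0.
have hD' : isP alpha (x%:C - (2 * beta)%:C) D by rewrite -rmorphB.
have [d d0 hd] := coef_cont beta0 hP hD' ep.
have de0 : 0 < Num.min e d by rewrite lt_min e0.
have [x' [v gv]] := closure_dist cx de0; rewrite lt_min => /andP[xe xd].
have [P' [D' [hP' hD1 Cv v0]]] := gv.
have w1 := ltW (gsol_lt1 alpha0 beta0 gv).
have xd' : nc (x'%:C - x%:C) < d by rewrite -rmorphB ncR.
have := hd _ _ _ hP' hD1 xd' v w1.
rewrite Cv sub0r ncN => /(cubic_near_root beta0 e0)[r Cr].
rewrite !lt_min => /andP[ve1 /andP[ve2 ve3]].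
move: xe; rewrite !lt_min => /andP[xe1 /andP[xe2 xe3]].
rewrite -rmorphB in hD1.
have : r \in [:: r1; r2; r3].
  move: Cr; rewrite C3 => /eqP; rewrite !mulf_eq0 fmorph_eq0 expf_eq0 (negbTE beta0) /=.
  by rewrite !inE !subr_eq0 -orbA.
rewrite !inE => /or3P[] /eqP rE; rewrite rE in Cr ve1 ve2 ve3.
- exact: (h1 Cr x' P' D' v).
- exact: (h2 Cr x' P' D' v).
- exact: (h3 Cr x' P' D' v).
Qed.

(** [bnd_num t / bnd_den t] is the real value of [P = rho - beta w] on the curve described below,
    and [bnd_point] recovers [x] as [P + (alpha + beta)^2 / P]. *)
Definition bnd_num (t : R) := (1 - t ^+ 2) * (alpha * (1 + t ^+ 2) - 2 * beta * t).
Definition bnd_den (t : R) := 2 * t * (1 + t ^+ 2).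
Definition bnd_point (t : R) :=
  bnd_num t / bnd_den t + (alpha + beta) ^+ 2 / (bnd_num t / bnd_den t).

(* With [w = beta r] and [rho = P + beta^2 r] for a real root [r], the relation
   [w^2 (rho^2 + alpha^2) = rho^2] is a rational curve, parametrized by
   [w = (1 - t^2) / (1 + t^2)], [rho = alpha (1 - t^2) / (2 t)]; the polynomial
   eliminates [z] between the quadratic equations of [P] and [Q - 2 beta]. *)
Definition bnd_poly : {poly R} :=
  let n := 1 - 'X ^+ 2 in let d := 1 + 'X ^+ 2 in
  let Pn := n * (alpha *: d - (2 * beta) *: 'X) in let Pd := 2 *: 'X * d in
  let Dn := (2 * alpha) *: 'X * d - (4 * beta)%:P in let Dd := n * d in
  (Pn ^+ 2 + (alpha + beta) ^+ 2 *: Pd ^+ 2 - (2 * beta) *: (Pn * Pd)) * Dn * Dd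
  - Pn * Pd * (Dn ^+ 2 + alpha ^+ 2 *: Dd ^+ 2).

Lemma bnd_poly_neq0 : bnd_poly != 0.
Proof.
have : bnd_poly.[0] != 0.
  rewrite /bnd_poly !hornerE /= (_ : _ - _ = (- 4) * (alpha ^+ 2 * beta)); last by ring.
  by rewrite !mulf_neq0 ?oppr_eq0 ?pnatr_eq0 ?expf_neq0.
by apply: contra_neq => ->; rewrite horner0.
Qed.

Lemma bnd_param (x c D w rho : R) : w != 0 -> rho != 0 -> c != 0 ->
  rho = c + beta * w -> c * (x - c) = (alpha + beta) ^+ 2 ->
  D * (x - 2 * beta - D) = alpha ^+ 2 ->
  w * rho * (D + 2 * beta + beta * w) - alpha ^+ 2 * w + beta * rho = 0 ->
  w ^+ 2 * (rho ^+ 2 + alpha ^+ 2) = rho ^+ 2 ->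
  exists2 t, root bnd_poly t & x = bnd_point t.
Proof.
move=> w0 r0 c0 rE hP hD hc hg.
have w1 : 1 + w != 0.
  apply/eqP => w1; have wN : w = -1 by lra.
  have /eqP : alpha ^+ 2 = 0 by move: hg; rewrite wN sqrrN expr1n; lra.
  by rewrite expf_eq0 (negbTE alpha0).
(* The last hypothesis places [(w, alpha w / rho)] on the unit circle; [t] is its stereographic
   projection from [(-1, 0)]. *)
pose t := alpha * w / (rho * (1 + w)).
have ht : t * (rho * (1 + w)) = alpha * w by rewrite /t divfK// mulf_neq0.
have t0 : t != 0 by rewrite /t !mulf_neq0 ?invr_eq0 ?mulf_neq0.
clearbody t.
have hd : (1 + t ^+ 2) * (1 + w) = 2.
  apply: (mulfI (expf_neq0 2 r0)); apply: (mulIf w1).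
  transitivity (rho ^+ 2 * (1 + w) ^+ 2 + (t * (rho * (1 + w))) ^+ 2); first by ring.
  rewrite ht; transitivity (rho ^+ 2 * (1 + w) ^+ 2 - w ^+ 2 * rho ^+ 2 +
    w ^+ 2 * (rho ^+ 2 + alpha ^+ 2)); first by ring.
  by rewrite hg; ring.
have d0 : 1 + t ^+ 2 != 0 by rewrite gt_eqF// ltr_pwDl ?sqr_ge0.
have hn : 1 - t ^+ 2 = w * (1 + t ^+ 2) by move: hd; lra.
have hr : 2 * t * rho = alpha * (1 - t ^+ 2).
  apply: (mulIf w1); transitivity (2 * (t * (rho * (1 + w)))); first by ring.
  transitivity (alpha * w * ((1 + t ^+ 2) * (1 + w))); last by rewrite hn; ring.
  by rewrite hd ht; ring.
have hPn : bnd_num t = c * bnd_den t.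
  rewrite /bnd_num /bnd_den.
  transitivity ((alpha * (1 - t ^+ 2)) * (1 + t ^+ 2) - 2 * beta * t * (1 - t ^+ 2)).
    by ring.
  by rewrite -hr hn rE; ring.
have hDn : 2 * alpha * t * (1 + t ^+ 2) - 4 * beta =
    D * ((1 - t ^+ 2) * (1 + t ^+ 2)).
  apply: (mulIf r0); rewrite hn.
  have hc' : w * rho * D = alpha ^+ 2 * w - beta * rho * (1 + w) ^+ 2 by move: hc; lra.
  transitivity ((1 + t ^+ 2) ^+ 2 * (w * rho * D)); last by ring.
  rewrite hc'; transitivity ((1 + t ^+ 2) * alpha * (1 + t ^+ 2) * (alpha * w)
    - beta * rho * ((1 + t ^+ 2) * (1 + w)) ^+ 2); last by ring.
  rewrite -ht; transitivity ((1 + t ^+ 2) * alpha * t * rho * ((1 + t ^+ 2) * (1 + w))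
    - beta * rho * ((1 + t ^+ 2) * (1 + w)) ^+ 2); last by ring.
  by rewrite hd; ring.
have den0 : bnd_den t != 0 by rewrite /bnd_den !mulf_neq0 ?pnatr_eq0.
exists t; last first.
  by rewrite /bnd_point hPn mulfK// -hP; field.
rewrite /root /bnd_poly !hornerE /= -[X in (X ^+ 2 + _)]/(bnd_num t).
apply/eqP; transitivity ((bnd_num t ^+ 2 + (alpha + beta) ^+ 2 * bnd_den t ^+ 2
   - 2 * beta * (bnd_num t * bnd_den t))
  * (2 * alpha * t * (1 + t ^+ 2) - 4 * beta) * ((1 - t ^+ 2) * (1 + t ^+ 2))
  - bnd_num t * bnd_den t * ((2 * alpha * t * (1 + t ^+ 2) - 4 * beta) ^+ 2 +
    alpha ^+ 2 * ((1 - t ^+ 2) * (1 + t ^+ 2)) ^+ 2)).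
  by rewrite /bnd_num /bnd_den; ring.
by rewrite hPn hDn -hP -hD; ring.
Qed.

Lemma sqr_near (x c : R) : c < x ^+ 2 ->
  exists2 e, 0 < e & forall x', `|x' - x| < e -> c < x' ^+ 2.
Proof.
move=> cx; have := @exprn_continuous R 2 x.
move/cvgr_gt => /(_ _ cx)/nbhs_ballP[e e0 h]; exists e => // x' hx.
by apply: h; rewrite /ball /= distrC.
Qed.

(** The energy identity with denominators cleared, for real [P = c] and [v = a + i b]. When [Q] is
    real as well, the correction terms of [cubic_energy_eq] vanish, so solutions are zeros of this
    polynomial. *)
Definition bnd_fun (c a b : R) := beta ^+ 2 * (a ^+ 2 + b ^+ 2) *
  ((c + beta ^+ 2 * a) ^+ 2 + (beta ^+ 2 * b) ^+ 2 + alpha ^+ 2)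
  - ((c + beta ^+ 2 * a) ^+ 2 + (beta ^+ 2 * b) ^+ 2).

Lemma bnd_fun_near (c a b : R) : bnd_fun c a b != 0 -> exists2 e, 0 < e &
  forall c' a' b', `|c' - c| < e -> `|a' - a| < e -> `|b' - b| < e ->
  bnd_fun c' a' b' != 0.
Proof.
move=> h0.
have cf : continuous (fun q : R * R * R => bnd_fun q.1.1 q.1.2 q.2).
  move=> q; rewrite /bnd_fun.
  have c1 : (fun q : R * R * R => q.1.1) @ q --> q.1.1.
    by apply: (@continuous_comp _ _ _ fst fst); apply: cvg_fst.
  have c2 : (fun q : R * R * R => q.1.2) @ q --> q.1.2.
    by apply: (@continuous_comp _ _ _ fst snd); [apply: cvg_fst|apply: cvg_snd].
  have c3 : (fun q : R * R * R => q.2) @ q --> q.2 by apply: cvg_snd.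
  have ad (f g : R * R * R -> R) (y z : R) : f @ q --> y -> g @ q --> z ->
      (fun q => f q + g q) @ q --> y + z by move=> fy gz; apply: cvgD.
  have ml (f g : R * R * R -> R) (y z : R) : f @ q --> y -> g @ q --> z ->
      (fun q => f q * g q) @ q --> y * z by move=> fy gz; apply: cvgM.
  have sb (f g : R * R * R -> R) (y z : R) : f @ q --> y -> g @ q --> z ->
      (fun q => f q - g q) @ q --> y - z by move=> fy gz; apply: cvgB.
  have ct (k : R) : (fun _ : R * R * R => k) @ q --> k by apply: cvg_cst.
  have c4 := ad _ _ _ _ c1 (ml _ _ _ _ (ct (beta ^+ 2)) c2).
  have c5 := ml _ _ _ _ (ct (beta ^+ 2)) c3.
  have c6 := ad _ _ _ _ (ml _ _ _ _ c4 c4) (ml _ _ _ _ c5 c5).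
  have c7 := ad _ _ _ _ (ml _ _ _ _ c2 c2) (ml _ _ _ _ c3 c3).
  exact: sb (ml _ _ _ _ (ml _ _ _ _ (ct (beta ^+ 2)) c7) (ad _ _ _ _ c6 (ct (alpha ^+ 2)))) c6.
have := cf (c, a, b) => /cvgr_neq0/(_ h0)/nbhs_ballP[e e0 h]; exists e => // c' a' b' hc ha hb.
by apply: (h (c', a', b')); split; [split|]; rewrite /ball /= distrC.
Qed.

(** A root above the axis contradicts [~ gsupp x], and one below repels solutions. At a real root
    both discriminants are strictly positive, hence remain so nearby; solutions near it satisfy
    [bnd_fun = 0], which passes to the limit. *)
Lemma boundary_bnd_poly (x : R) : closure gsupp x -> ~ gsupp x -> x != 0 ->
  x ^+ 2 != 4 * (alpha + beta) ^+ 2 -> (x - 2 * beta) ^+ 2 != 4 * alpha ^+ 2 ->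
  exists2 t, root bnd_poly t & x = bnd_point t.
Proof.
move=> cx nx x0 xp xd.
have [P hP] : exists P, isP (alpha + beta) x%:C P by apply: isP_exists; rewrite cImR.
have [D hD] : exists D, isP alpha (x - 2 * beta)%:C D by apply: isP_exists; rewrite cImR.
have P0 : P != 0.
  case: hP => e + _; apply: contraTneq => P0; rewrite P0 nc0 subr0 ncR.
  by rewrite -ltNge normr_gt0.
have [iP iD] : 0 <= complex.Im P /\ 0 <= complex.Im D by case: hP hD => _ _ ? [].
have ID2 D' : complex.Im (D' + (2 * beta)%:C) = complex.Im D'.
  by rewrite cImD cImR addr0.
have hD2 : isP alpha (x%:C - (2 * beta)%:C) D by rewrite -rmorphB.
pose K r := complex.Im r = 0 /\ bnd_fun (complex.Re P) (complex.Re r) (complex.Im r) = 0.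
have realroot r : cubic alpha beta P (D + (2 * beta)%:C) r = 0 -> complex.Im r = 0 ->
    [/\ complex.Re r != 0, rr beta P r != 0, complex.Im P = 0 & complex.Im D = 0].
  move=> hr r0; have rE : r = (complex.Re r)%:C by move: r0; case: (r) => ? ? /= ->.
  by have := @cubic_real_root P (D + (2 * beta)%:C) (complex.Re r);
    rewrite -rE ID2; apply.
have [|r [hr [r0 gr]]] := boundary_root hP hD cx nx (K := K).
  move=> r hr nK; have [ri|ri|ri] := ltgtP (complex.Im r) 0.
  - exists (- complex.Im r); first by rewrite oppr_gt0.
    move=> x' P' D' v _ _ _ _ v0 /(le_lt_trans (ler_Im _)).
    by rewrite cImD cImN ltr_norml => /andP[_]; lra.
  - by case: nx; exists r, P, D.
  have [_ _ ImP ImD] := realroot r hr ri.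
  have := isP_Im0_disc hP ImP; rewrite le_eqVlt eq_sym (negbTE xp) /= => dP.
  have := isP_Im0_disc hD ImD; rewrite le_eqVlt eq_sym (negbTE xd) /= => dD.
  have [e1 e10 h1] := sqr_near dP; have [e2 e20 h2] := sqr_near dD.
  have g0 : bnd_fun (complex.Re P) (complex.Re r) (complex.Im r) != 0.
    by apply/eqP => g0; apply: nK.
  have [e3 e30 h3] := bnd_fun_near g0; have [e4 e40 h4] := isP_cont hP e30.
  exists (Num.min (Num.min e1 e2) (Num.min e3 e4)); first by rewrite !lt_min e10 e20 e30.
  move=> x' P' D' v; rewrite !lt_min => /andP[/andP[x1 x2] /andP[_ x4]].
  move=> hP' hD' hv v0 /andP[_ /andP[v3 _]].
  have P'0 := isP_Im0 hP' (h1 _ x1).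
  have D'0 : complex.Im D' = 0.
    by apply: (isP_Im0 hD'); apply: h2; rewrite opprB addrA subrK.
  have PP : nc (P' - P) < e3 by apply: (h4 _ _ hP'); rewrite -rmorphB ncR.
  have small (u v' : R[i]) : nc (u - v') < e3 ->
      `|complex.Re u - complex.Re v'| < e3 /\ `|complex.Im u - complex.Im v'| < e3.
    move=> h; rewrite -cReN -cImN -cReD -cImD.
    by split; apply: le_lt_trans h; [exact: ler_Re|exact: ler_Im].
  have [PR _] := small _ _ PP; have [vR vI] := small _ _ v3.
  have := h3 _ _ _ PR vR vI => /eqP; apply.
  have iP' : 0 <= complex.Im P' by rewrite P'0.
  have := cubic_energy_eq beta0 iP' v0 hv.
  rewrite ID2 P'0 D'0 mul0r mulr0 addr0 mul0r addr0.
  have rr0 : 0 < normsq (rr beta P' v) by rewrite normsq_gt0 Im_gt0_neq0 ?rr_Im_gt0.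
  have rrE : normsq (rr beta P' v) = (complex.Re P' + beta ^+ 2 * complex.Re v) ^+ 2
      + (beta ^+ 2 * complex.Im v) ^+ 2.
    by rewrite /normsq /rr cReD cImD cReM cImM cReR cImR !mul0r subr0 addr0 P'0 add0r.
  rewrite normsqM normsqM normsqV !normsqR /bnd_fun -rrE.
  rewrite -[complex.Re v ^+ 2 + _]/(normsq v).
  move: (normsq (rr _ _ _)) (normsq v) rr0 => q m q0 h.
  have : (beta ^+ 2 * m * (1 + alpha ^+ 2 * q^-1)) * q = q by rewrite h mul1r.
  rewrite (_ : beta ^+ 2 * m * (1 + alpha ^+ 2 * q^-1) * q = beta ^+ 2 * m * (q + alpha ^+ 2)).
    by move->; rewrite subrr.
  by field; rewrite gt_eqF.
have [a0 rr0 ImP ImD] := realroot r hr r0.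
have [hP1 _ _] := hP; have [hD1 _ _] := hD.
have PE : P = (complex.Re P)%:C by move: ImP; case: (P) => ? ? /= ->.
have DE : D = (complex.Re D)%:C by move: ImD; case: (D) => ? ? /= ->.
have rE : r = (complex.Re r)%:C by move: r0; case: (r) => ? ? /= ->.
move: PE DE rE hP1 hD1 hr rr0 gr a0 P0 {ImP ImD realroot K hD2 iP iD hP hD}.
move: (complex.Re P) (complex.Re D) (complex.Re r) r0 => c D1 a -> -> -> ->.
rewrite /rr -!(rmorphB, rmorphD, rmorphM) => /(@complexI R) hP /(@complexI R) hD.
rewrite cubicE /rr -!(rmorphB, rmorphD, rmorphM) => /(@complexI R) hr.
rewrite !fmorph_eq0 => rr0 g0 a0 c0.
apply: (@bnd_param x c D1 (beta * a) (c + beta ^+ 2 * a)) => //.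
- by rewrite mulf_neq0.
- by ring.
- transitivity (beta * 0); last by rewrite mulr0.
  by rewrite -hr; ring.
by move: g0; rewrite /bnd_fun => /subr0_eq; rewrite !mulr0 expr0n /= !addr0 -exprMn => ->.
Qed.

Lemma boundary_finite : exists s : seq R,
  forall x, closure gsupp x -> ~ gsupp x -> x \in s.
Proof.
pose p := 2 * (alpha + beta); pose b := 2 * beta; pose a := 2 * alpha.
(* [P] may vanish at [0]; the next four points are the zeros of the two discriminants. *)
exists ([:: 0; p; - p; b + a; b - a] ++ map bnd_point (polyrcf.rootsR bnd_poly)).
move=> x cx nx; rewrite mem_cat !inE -!orbA.
have [//|x0 /=] := eqVneq x 0.
have [xp|xp] := eqVneq (x ^+ 2) (4 * (alpha + beta) ^+ 2).
  have : (x == p) || (x == - p) by rewrite -eqf_sqr xp /p exprMn; apply/eqP; ring.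
  by case/orP => ->; rewrite ?orbT.
have [xd|xd] := eqVneq ((x - 2 * beta) ^+ 2) (4 * alpha ^+ 2).
  have : (x - b == a) || (x - b == - a) by rewrite -eqf_sqr xd /a exprMn; apply/eqP; ring.
  by case/orP => /eqP e; rewrite -(subrK b x) e addrC eqxx ?orbT.
have [t rt ->] := boundary_bnd_poly cx nx x0 xp xd.
by rewrite map_f ?orbT// -polyrcf.roots_on_rootsR ?bnd_poly_neq0// rt.
Qed.

End boundary.

(** * Closures of bounded open sets with finite boundary *)

Section intervals.
Context {R : realType}.
Implicit Types (S : set R) (s : seq R).

Lemma right_endpoint S (M x : R) : open S -> (forall t, S t -> t <= M) -> S x ->
  exists q, [/\ x < q, closure S q, ~ S q & forall t, x <= t < q -> S t].
Proof.
move=> oS SM Sx.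
pose A := [set t | x <= t /\ ~ S t].
have hA : has_inf A.
  split; last by exists x => t [].
  have xM := SM _ Sx; exists (M + 1); split; first lra.
  by move=> /SM; lra.
have Aq t : x <= t < inf A -> S t.
  move=> /andP[xt tq]; apply: contrapT => nS.
  have : inf A <= t by apply: ge_inf; [case: hA|split].
  lra.
have xq : x <= inf A by apply: lb_le_inf; [case: hA|move=> t []].
have nSq : ~ S (inf A).
  move=> Sq; have [e /= e0 he] := (nbhs_ballP _ _).1 (open_nbhs_nbhs (conj oS Sq)).
  have [t [xt nS] tq] := inf_adherent e0 hA.
  have qt : inf A <= t by apply: ge_inf; [case: hA|split].
  by apply: nS; apply: he; rewrite /ball /= ltr_norml; lra.
have xq' : x < inf A by rewrite lt_neqAle xq andbT; apply: contra_not_neq nSq => <-.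
exists (inf A); split=> // B /nbhs_ballP[e /= e0 he].
pose t := Num.max x (inf A - e / 2).
have te : inf A - e / 2 <= t by rewrite le_max lexx orbT.
have xt : x <= t by rewrite le_max lexx.
have tq : t < inf A by rewrite gt_max xq'; lra.
by exists t; split; [apply: Aq; rewrite xt|apply: he; rewrite /ball /= ltr_norml; lra].
Qed.

Lemma left_endpoint S (M x : R) : open S -> (forall t, S t -> - M <= t) -> S x ->
  exists p, [/\ p < x, closure S p, ~ S p & forall t, p < t <= x -> S t].
Proof.
move=> oS SM Sx; pose S' := [set t : R | S (- t)].
have oS' : open S' by apply: open_comp => // t _; exact: opp_continuous.
have [||q [xq cq nq hq]] := @right_endpoint S' M (- x) oS'.
- by move=> t /SM; lra.
- by rewrite /S' /= opprK.
exists (- q); split=> //; first lra; last first.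
  by move=> t ht; rewrite -[t]opprK; apply: hq; lra.
move=> B /nbhs_ballP[e /= e0 he].
have [t St qt] := closure_dist cq e0.
by exists (- t); split => //; apply: he; rewrite /ball /= opprK addrC.
Qed.

Lemma closure_intervals S s (M : R) : open S -> (forall t, S t -> `|t| <= M) ->
  (forall x, closure S x -> ~ S x -> x \in s) ->
  exists l : seq (R * R), (forall p, p \in l -> p.1 < p.2) /\
    closure S = \bigcup_(p in [set` l]) `[p.1, p.2]%classic.
Proof.
move=> oS SM hs.
pose l := [seq p <- allpairs pair s s | (p.1 < p.2) && `[< `]p.1, p.2[%classic `<=` S >]].
have lP p q : (p, q) \in l -> p < q /\ `]p, q[%classic `<=` S.
  by rewrite mem_filter => /andP[/andP[/= pq /asboolP]].
exists l; split; first by move=> [p q] /lP[].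
apply/seteqP; split => [x|x [[p q] /= /lP[pq pqS]]]; last first.
  rewrite /= in_itv /= => xpq B /nbhs_ballP[e /= e0 he].
  (* Moving [x] a fraction [d] of the way to the midpoint enters the open interval, by a distance of
     at most [e / 2]. *)
  pose m := (p + q) / 2; pose d := Num.min 1 (e / (q - p)).
  have d1 : d <= 1 by rewrite ge_min lexx.
  have d0 : 0 < d by rewrite lt_min ltr01 divr_gt0// subr_gt0.
  have de : d * (q - p) <= e by rewrite -ler_pdivlMr ?subr_gt0// ge_min lexx orbT.
  have dm : d * (q - p) > 0 by rewrite mulr_gt0// subr_gt0.
  exists (x + d * (m - x)); split.
    apply: pqS; rewrite /= in_itv /= /m; apply/andP; split.
      have : (1 - d) * p <= (1 - d) * x by apply: ler_wpM2l; lra.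
      by move: dm; lra.
    have : (1 - d) * x <= (1 - d) * q by apply: ler_wpM2l; lra.
    by move: dm; lra.
  apply: he; rewrite /ball /= opprD addrA subrr sub0r normrN normrM gtr0_norm//.
  have : `|m - x| <= (q - p) / 2 by rewrite /m ler_norml; lra.
  by move=> /(ler_wpM2l (ltW d0)); lra.
have cl : closed (\bigcup_(p in [set` l]) `[p.1, p.2]%classic : set R).
  rewrite classical_sets.bigcup_seq; apply: closed_bigsetU => p _.
  exact: interval_closed.
rewrite [X in _ -> X x](iffLR (closure_id _) cl); apply: closureS => {}x Sx.
have [q [xq cq nq hq]] : exists q, [/\ x < q, closure S q, ~ S q & forall t, x <= t < q -> S t].
  by apply: (@right_endpoint _ M) => // t /SM /(le_trans (ler_norm _)).
have [p [px cp np hp]] : exists p, [/\ p < x, closure S p, ~ S p & forall t, p < t <= x -> S t].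
  by apply: (@left_endpoint _ M) => // t /SM; rewrite ler_norml => /andP[].
exists (p, q); last by rewrite /= in_itv /= !ltW.
rewrite /= mem_filter /= (lt_trans px xq) /=; apply/andP; split.
  apply/asboolP => t; rewrite /= in_itv /= => /andP[pt tq].
  by have [tx|xt] := leP t x; [apply: hp; rewrite pt|apply: hq; rewrite ltW].
by apply/allpairsP; exists (p, q); rewrite !hs.
Qed.

End intervals.

(** * Analytic implicit functions *)

Section l1_norm.
Context {R : realType}.
Implicit Types (p q u : {poly R[i]}) (s t : R) (c : nat -> R[i]).

(** A weighted [ell^1] norm: submultiplicative, and dominating the values on the disc of radius
    [s]. *)
Definition pn s p := \sum_(i < size p) nc p`_i * s ^+ i.

Lemma pn_wide s p n : (size p <= n)%N -> pn s p = \sum_(i < n) nc p`_i * s ^+ i.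
Proof.
move=> le_n; transitivity (\sum_(i < n | (i < size p)%N) nc p`_i * s ^+ i).
  exact: (big_ord_widen n (fun i => nc p`_i * s ^+ i)).
rewrite big_mkcond /=.
apply: eq_bigr => i _; case: ifPn => //; rewrite -leqNgt => h.
by rewrite nth_default// nc0 mul0r.
Qed.

Lemma pn_ge0 s p : 0 <= s -> 0 <= pn s p.
Proof. by move=> s0; apply: sumr_ge0 => i _; rewrite mulr_ge0 ?nc_ge0 ?exprn_ge0. Qed.

Lemma pn_le s s' p q : 0 <= s -> s <= s' -> (forall i, nc p`_i <= nc q`_i) ->
  pn s p <= pn s' q.
Proof.
move=> s0 ss h; rewrite !(@pn_wide _ _ (maxn (size p) (size q))) ?leq_max ?leqnn ?orbT//.
by apply: ler_sum => i _; rewrite ler_pM ?nc_ge0 ?exprn_ge0// lerXn2r ?nnegrE// (le_trans s0).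
Qed.

Lemma pnD s p q : 0 <= s -> pn s (p + q) <= pn s p + pn s q.
Proof.
move=> s0; rewrite !(@pn_wide _ _ (maxn (size p) (size q))) ?size_polyD ?leq_max ?leqnn ?orbT//.
by rewrite -big_split /=; apply: ler_sum => i _; rewrite coefD -mulrDl ler_wpM2r ?exprn_ge0 ?ncD.
Qed.

Lemma pnN s p : pn s (- p) = pn s p.
Proof. by rewrite /pn size_polyN; apply: eq_bigr => i _; rewrite coefN ncN. Qed.

Lemma pnC s (a : R[i]) : pn s a%:P = nc a.
Proof.
by rewrite (@pn_wide _ _ 1) ?size_polyC_leq1// big_ord1 coefC expr0 mulr1.
Qed.

Lemma pn0 s : pn s 0 = 0.
Proof. by rewrite /pn size_poly0 big_ord0. Qed.

Lemma pnX s p : pn s ('X * p) = s * pn s p.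
Proof.
rewrite (@pn_wide _ _ (size p).+1); last first.
  by rewrite (leq_trans (size_polyMleq _ _))// size_polyX.
rewrite big_ord_recl coefXM nc0 mul0r add0r /pn mulr_sumr; apply: eq_bigr => i _.
by rewrite coefXM /= exprS mulrCA.
Qed.

Lemma pnXn s n p : pn s ('X^n * p) = s ^+ n * pn s p.
Proof.
by elim: n => [|n IH]; rewrite ?mul1r ?expr0 ?mul1r// exprS -mulrA pnX IH exprS mulrA.
Qed.

Lemma pnM s p q : 0 <= s -> pn s (p * q) <= pn s p * pn s q.
Proof.
move=> s0; elim/poly_ind: p => [|p a IH].
  by rewrite mul0r pn0 mul0r.
have aq (r : {poly R[i]}) : pn s (a%:P * r) = nc a * pn s r.
  rewrite (@pn_wide _ _ (size r)); last by rewrite mul_polyC size_scale_leq.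
  by rewrite /pn mulr_sumr; apply: eq_bigr => i _; rewrite coefCM ncM mulrA.
have -> : pn s (p * 'X + a%:P) = s * pn s p + nc a.
  rewrite (@pn_wide _ _ (size p).+1); last first.
    rewrite (leq_trans (size_polyD _ _))// geq_max (leq_trans (size_polyC_leq1 _))// andbT.
    by rewrite (leq_trans (size_polyMleq _ _))// size_polyX addn2.
  rewrite big_ord_recl expr0 mulr1 coefD coefMX coefC /= add0r addrC; congr (_ + _).
  rewrite /pn mulr_sumr; apply: eq_bigr => i _.
  by rewrite coefD coefMX coefC /= addr0 exprS mulrCA.
rewrite mulrDl (le_trans (pnD _ _ s0))// mulrDl aq lerD2r.
by rewrite (mulrC p 'X) -!mulrA pnX ler_wpM2l.
Qed.

Lemma nc_sum n (F : 'I_n -> R[i]) : nc (\sum_(i < n) F i) <= \sum_(i < n) nc (F i).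
Proof.
apply: (big_ind2 (fun x y => nc x <= y)) => [|x a y b xa yb|//]; first by rewrite nc0.
by rewrite (le_trans (ncD _ _))// lerD.
Qed.

Lemma horner_pn s p (z : R[i]) : nc z <= s -> nc p.[z] <= pn s p.
Proof.
move=> zs; rewrite horner_coef (le_trans (nc_sum _))//; apply: ler_sum => i _.
by rewrite ncM ncX ler_wpM2l ?nc_ge0// lerXn2r ?nnegrE ?nc_ge0// (le_trans (nc_ge0 z)).
Qed.

Lemma horner_pn_dvd s N p t : 0 < s -> `|t| <= s -> 'X^N %| p ->
  nc p.[t%:C] <= pn s p * (`|t| / s) ^+ N.
Proof.
move=> s0 ts /dvdpP[q ->]; rewrite hornerM hornerXn ncM ncX ncR (mulrC q) pnXn.
rewrite exprMn exprVn.
have -> : s ^+ N * pn s q * (`|t| ^+ N / s ^+ N) = pn s q * `|t| ^+ N.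
  by field; rewrite expf_neq0// gt_eqF.
by rewrite ler_wpM2r ?exprn_ge0// horner_pn// ncR.
Qed.

Lemma pn_shrink s s' p : 0 <= s' -> s' <= s -> 0 < s -> 'X %| p ->
  pn s' p <= s' / s * pn s p.
Proof.
move=> s0 ss s1 /dvdpP[q ->]; rewrite mulrC !pnX mulrA divfK ?gt_eqF//.
by rewrite ler_wpM2l// pn_le.
Qed.

Lemma pn_take s n p : 0 <= s -> pn s (take_poly n p) <= pn s p.
Proof.
move=> s0; apply: pn_le => // i; rewrite coef_take_poly; case: ifP => // _.
by rewrite nc0 nc_ge0.
Qed.

Lemma pn_sub_take s n p : 0 <= s -> pn s (p - take_poly n p) <= pn s p.
Proof.
move=> s0; apply: pn_le => // i; rewrite coefB coef_take_poly; case: ifP => _.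
  by rewrite subrr nc0 nc_ge0.
by rewrite subr0.
Qed.

Lemma dvdXn_take n p : 'X^n %| p - take_poly n p.
Proof.
rewrite -[in X in X - _](poly_take_drop n p) addrC addKr.
exact: dvdp_mulIr.
Qed.

Lemma dvdXn_coef n p : 'X^n %| p <-> forall i, (i < n)%N -> p`_i = 0.
Proof.
split=> [/dvdpP[q ->] i lin|h]; first by rewrite coefMXn lin.
rewrite -(poly_take_drop n p) (_ : take_poly n p = 0) ?add0r ?dvdp_mulIr//.
by apply/polyP => i; rewrite coef_take_poly coef0; case: ifP => // /h.
Qed.

(* Analyticity with values in [R[i]], by a geometric bound on the Taylor
   remainders; the [ell^1] bound on the coefficients makes it stable under
   products and fixed points. *)
Definition isan (f : R -> R[i]) (z0 : R) := exists c s M,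
  [/\ 0 < s, (forall N, pn s (\poly_(i < N) c i) <= M) &
      forall N t, `|t| <= s ->
        nc (f (z0 + t) - (\poly_(i < N) c i).[t%:C]) <= M * (`|t| / s) ^+ N].

Lemma isan_analytic f z0 : isan f z0 -> analytic_at (fun x => complex.Im (f x)) z0.
Proof.
move=> [c [s [M [s0 _ h]]]]; exists (fun n => complex.Im (c n)), s; split => // x xs.
apply/cvgrPdist_lt => e e0.
have M0 : 0 <= M.
  by have := h 0%N 0; rewrite normr0 expr0 mulr1 => /(_ (ltW s0)); apply: le_trans; exact: nc_ge0.
have q1 : `| (`|x - z0| / s) | < 1 by rewrite normrM normr_id normfV (gtr0_norm s0) ltr_pdivrMr ?mul1r.
have e1 : 0 < e / (M + 1) by rewrite divr_gt0// ltr_wpDl.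
have := cvg_expr q1 => /cvgrPdist_lt/(_ _ e1); apply: filterS => N.
rewrite sub0r normrN ger0_norm ?exprn_ge0 ?divr_ge0 ?(ltW s0)// => hN.
have := h N (x - z0) (ltW xs); rewrite (addrC z0) subrK.
have -> : pseries (fun n => complex.Im (c n)) (x - z0) N =
   complex.Im (\poly_(i < N) c i).[(x - z0)%:C].
  rewrite horner_poly (raddf_sum (@complex.Im R)) /pseries seriesEord /=.
  apply: eq_bigr => i _; rewrite -rmorphXn cImM cReR cImR mulr0 add0r.
  by rewrite mulrC.
rewrite -cImN -cImD => hx; apply: le_lt_trans (ler_Im _) _.
apply: (le_lt_trans hx); apply: (@le_lt_trans _ _ ((M + 1) * (`|x - z0| / s) ^+ N)).
  by rewrite ler_wpM2r ?exprn_ge0 ?divr_ge0 ?(ltW s0)// lerDl.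
by rewrite mulrC -ltr_pdivlMr// ltr_wpDl.
Qed.

Lemma isan_radius f z0 : isan f z0 -> exists c s0 M, [/\ 0 < s0, 0 <= M &
  forall s, 0 < s -> s <= s0 -> (forall N, pn s (\poly_(i < N) c i) <= M) /\
      forall N t, `|t| <= s ->
        nc (f (z0 + t) - (\poly_(i < N) c i).[t%:C]) <= M * (`|t| / s) ^+ N].
Proof.
move=> [c [s0 [M [s00 hM h]]]]; exists c, s0, M.
have M0 : 0 <= M by apply: le_trans (hM 0%N); rewrite pn_ge0 ?ltW.
split=> // s sp ss; split=> [N|N t ts].
  by apply: le_trans (hM N); apply: pn_le => //; exact: ltW.
apply: (le_trans (h _ _ (le_trans ts ss))); rewrite ler_wpM2l//.
rewrite lerXn2r ?nnegrE ?divr_ge0 ?(ltW s00) ?(ltW sp)//.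
by rewrite ler_wpM2l// lef_pV2.
Qed.

Lemma isan_cst (a : R[i]) z0 : isan (fun=> a) z0.
Proof.
pose c i : R[i] := if i is 0%N then a else 0.
have p0 : \poly_(i < 0) c i = 0 by apply/polyP => i; rewrite coef_poly coef0.
have p1 N : \poly_(i < N.+1) c i = a%:P.
  by apply/polyP => -[|i]; rewrite coef_poly coefC//= if_same.
exists c, 1, (nc a); split=> // [[|N]|[|N] t t1]; rewrite ?p0 ?p1 ?pnC//.
- by rewrite nc0 nc_ge0.
- by rewrite horner0 subr0 expr0 mulr1.
by rewrite hornerC subrr nc0 mulr_ge0 ?nc_ge0 ?exprn_ge0 ?divr_ge0.
Qed.

Lemma isan_id z0 : isan (fun x => x%:C) z0.
Proof.
pose c i : R[i] := match i with 0%N => z0%:C | 1%N => 1 | _ => 0 end.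
have p0 : \poly_(i < 0) c i = 0 by apply/polyP => i; rewrite coef_poly coef0.
have p1 : \poly_(i < 1) c i = z0%:C%:P.
  by apply/polyP => -[|i]; rewrite coef_poly coefC.
have p2 N : \poly_(i < N.+2) c i = z0%:C%:P + 'X.
  by apply/polyP => -[|[|i]]; rewrite coef_poly coefD coefC coefX /= ?(addr0, add0r) ?if_same.
have pX : pn 1 ('X : {poly R[i]}) = 1.
  by rewrite -[X in pn _ X]mulr1 pnX mul1r -polyC1 pnC -(rmorph1 (real_complex R)) ncR normr1.
exists c, 1, (`|z0| + 1); split=> // [[|[|N]]|[|[|N]] t t1]; rewrite ?p0 ?p1 ?p2.
- by rewrite pn0 addr_ge0.
- by rewrite pnC ncR lerDl.
- by rewrite (le_trans (pnD _ _ ler01))// pnC ncR pX.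
- by rewrite horner0 subr0 ncR expr0 mulr1 (le_trans (ler_normD _ _))// lerD2l.
- rewrite hornerC -rmorphB addrC addKr ncR expr1 divr1.
  by rewrite ler_peMl// lerDr.
by rewrite hornerD hornerC hornerX -rmorphD subrr nc0 mulr_ge0 ?addr_ge0 ?exprn_ge0 ?divr_ge0.
Qed.

Lemma isan_add f g z0 : isan f z0 -> isan g z0 -> isan (fun x => f x + g x) z0.
Proof.
move=> /isan_radius[c [s1 [M [s10 M0 hf]]]] /isan_radius[d [s2 [M' [s20 M0' hg]]]].
pose s := Num.min s1 s2.
have s0 : 0 < s by rewrite lt_min s10.
have [|hf1 hf2] := hf s s0; first by rewrite ge_min lexx.
have [|hg1 hg2] := hg s s0; first by rewrite ge_min lexx orbT.
have pE N : \poly_(i < N) (c i + d i) = \poly_(i < N) c i + \poly_(i < N) d i.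
  by apply/polyP => i; rewrite coefD !coef_poly; case: ifP; rewrite ?addr0.
exists (fun i => c i + d i), s, (M + M'); split=> // [N|N t ts]; rewrite pE.
  by rewrite (le_trans (pnD _ _ (ltW s0)))// lerD.
rewrite hornerD opprD addrACA (le_trans (ncD _ _))// mulrDl lerD//; [exact: hf2|exact: hg2].
Qed.

Lemma nc_mulB (x y p q : R[i]) (A B e e' : R) : nc (x - p) <= e -> nc (y - q) <= e' ->
  nc x <= A -> nc q <= B -> nc (x * y - p * q) <= A * e' + B * e.
Proof.
move=> xp yq xA qB; rewrite (_ : _ - _ = x * (y - q) + (x - p) * q); last by ring.
rewrite (le_trans (ncD _ _))// lerD// ncM; first by rewrite ler_pM ?nc_ge0.
by rewrite mulrC ler_pM ?nc_ge0.
Qed.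

Lemma isan_mul f g z0 : isan f z0 -> isan g z0 -> isan (fun x => f x * g x) z0.
Proof.
move=> /isan_radius[c [s1 [M [s10 M0 hf]]]] /isan_radius[d [s2 [M' [s20 M0' hg]]]].
pose s := Num.min s1 s2.
have s0 : 0 < s by rewrite lt_min s10.
have [|hf1 hf2] := hf s s0; first by rewrite ge_min lexx.
have [|hg1 hg2] := hg s s0; first by rewrite ge_min lexx orbT.
pose p N := \poly_(i < N) c i; pose q N := \poly_(i < N) d i.
pose k i := (p i.+1 * q i.+1)`_i.
have pE N : \poly_(i < N) k i = take_poly N (p N * q N).
  apply/polyP => i; rewrite coef_poly coef_take_poly; case: ifP => // iN.
  rewrite /k !coefM; apply: eq_bigr => j _; rewrite !coef_poly.
  rewrite !ltnS leq_subr -ltnS ltn_ord.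
  by rewrite (leq_ltn_trans _ iN) ?(leq_ltn_trans _ iN) ?leq_subr// -ltnS.
have f0 t : `|t| <= s -> nc (f (z0 + t)) <= M.
  move=> ts; have := hf2 0%N t ts; rewrite expr0 mulr1.
  by rewrite (_ : \poly_(i < 0) c i = 0) ?horner0 ?subr0//; apply/polyP => i; rewrite coef_poly coef0.
have pq N : pn s (p N * q N) <= M * M'.
  apply: le_trans (pnM _ _ (ltW s0)) _.
  by apply: ler_pM; [exact/pn_ge0/ltW|exact/pn_ge0/ltW|exact: hf1|exact: hg1].
(* Two terms [M M'] come from the remainders of the factors, the third from truncating the product
   of the Taylor polynomials. *)
exists k, s, (3 * (M * M')); split=> // [N|N t ts]; rewrite pE.
  rewrite (le_trans (pn_take _ _ (ltW s0)))// (le_trans (pq N))//.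
  by have := mulr_ge0 M0 M0'; lra.
have q0 : nc (q N).[t%:C] <= M'.
  by apply: le_trans (hg1 N); apply: horner_pn; rewrite ncR.
rewrite (_ : _ - _ = (f (z0 + t) * g (z0 + t) - (p N).[t%:C] * (q N).[t%:C]) +
  (p N * q N - take_poly N (p N * q N)).[t%:C]); last by rewrite hornerD hornerN hornerM; ring.
have := horner_pn_dvd s0 ts (dvdXn_take N (p N * q N)).
have := pn_sub_take N (p N * q N) (ltW s0).
have := nc_mulB (hf2 N t ts) (hg2 N t ts) (f0 t ts) q0.
have r0 : 0 <= (`|t| / s) ^+ N by rewrite exprn_ge0// divr_ge0// ltW.
move: (pq N) (ncD (f (z0 + t) * g (z0 + t) - (p N).[t%:C] * (q N).[t%:C])
  (p N * q N - take_poly N (p N * q N)).[t%:C]).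
move: (nc _) (nc _) (nc _) (pn _ _) (pn _ _) ((`|t| / s) ^+ N) r0 => x1 x2 x3 n1 n2 r r0.
move=> h1 h2 h3 h4 h5; have := ler_wpM2r r0 (le_trans h4 h1); lra.
Qed.

End l1_norm.

(** * Analytic solutions of cubic fixed-point equations *)

Section analytic_fixpoint.
Context {R : realType}.
Implicit Types (p q u : {poly R[i]}) (s t : R).

Lemma ncD_le (a b : R[i]) A B : nc a <= A -> nc b <= B -> nc (a + b) <= A + B.
Proof. by move=> aA bB; rewrite (le_trans (ncD _ _))// lerD. Qed.

Lemma ncM_le (a b : R[i]) A B : nc a <= A -> nc b <= B -> nc (a * b) <= A * B.
Proof. by move=> aA bB; rewrite ncM ler_pM ?nc_ge0. Qed.

Lemma pnD_le s p q A B : 0 <= s -> pn s p <= A -> pn s q <= B -> pn s (p + q) <= A + B.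
Proof. by move=> s0 pA qB; rewrite (le_trans (pnD _ _ s0))// lerD. Qed.

Lemma pnM_le s p q A B : 0 <= s -> pn s p <= A -> pn s q <= B -> pn s (p * q) <= A * B.
Proof. by move=> s0 pA qB; rewrite (le_trans (pnM _ _ s0))// ler_pM ?pn_ge0. Qed.

(** Stated over an arbitrary ring, to be used both for truncated power series and for their
    values. *)
Definition phi (T : pzRingType) (a0 a1 a2 a3 x : T) := a0 + x * (a1 + x * (a2 + x * a3)).

Lemma phi_subl (T : comPzRingType) (a0 a1 a2 a3 b0 b1 b2 b3 x : T) :
  phi a0 a1 a2 a3 x - phi b0 b1 b2 b3 x = phi (a0 - b0) (a1 - b1) (a2 - b2) (a3 - b3) x.
Proof. by rewrite /phi; ring. Qed.

Lemma phi_subr (T : comPzRingType) (a0 a1 a2 a3 x y : T) :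
  phi a0 a1 a2 a3 x - phi a0 a1 a2 a3 y =
  (x - y) * (a1 + (a2 * (x + y) + a3 * (x * x + (x * y + y * y)))).
Proof. by rewrite /phi; ring. Qed.

Section formal.
Variables q0 q1 q2 q3 : nat -> {poly R[i]}.
Hypotheses (X0 : forall N, 'X %| q0 N) (X1 : forall N, 'X %| q1 N).
Hypotheses (d0 : forall N, 'X^N %| q0 N.+1 - q0 N)
  (d1 : forall N, 'X^N %| q1 N.+1 - q1 N) (d2 : forall N, 'X^N %| q2 N.+1 - q2 N)
  (d3 : forall N, 'X^N %| q3 N.+1 - q3 N).

Let Phi N p := phi (q0 N) (q1 N) (q2 N) (q3 N) p.

(** The truncations of the formal solution of [x = phi x]; each iteration fixes one more
    coefficient. *)
Fixpoint phi_iter N : {poly R[i]} :=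
  if N is n.+1 then take_poly n.+1 (Phi n.+1 (phi_iter n)) else 0.

Lemma phi_iter_X N : 'X %| phi_iter N.
Proof.
elim: N => [|N IH]; first exact: dvdp0.
rewrite -[phi_iter N.+1](subKr (Phi N.+1 (phi_iter N))).
apply: dvdp_sub; first by rewrite dvdp_add// dvdp_mulr.
by apply: dvdp_trans (dvdXn_take _ _); rewrite -['X in X in X %| _]expr1 dvdp_exp2l.
Qed.

(** [Phi] is an [X]-adic contraction: in [phi_subr] the second factor is divisible by [X], because
    [q1] and both arguments are. *)
Lemma phi_iter_dvd N : 'X^N %| phi_iter N.+1 - phi_iter N.
Proof.
elim: N => [|N IH]; first by rewrite expr0 dvd1p.
set p := phi_iter N in IH; set p' := phi_iter N.+1 in IH *.
have h1 : 'X^(N.+1) %| Phi N.+2 p' - phi_iter N.+2.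
  by apply: dvdp_trans (dvdXn_take N.+2 _); rewrite dvdp_exp2l.
have h2 : 'X^(N.+1) %| Phi N.+1 p - p' by exact: dvdXn_take.
have h3 : 'X^(N.+1) %| Phi N.+2 p' - Phi N.+1 p'.
  rewrite phi_subl dvdp_add// dvdp_mull// dvdp_add// dvdp_mull// dvdp_add//.
  by rewrite dvdp_mull.
have h4 : 'X^(N.+1) %| Phi N.+1 p' - Phi N.+1 p.
  rewrite phi_subr exprSr dvdp_mul//.
  have [Xp Xp'] := (phi_iter_X N, phi_iter_X N.+1).
  by rewrite !(dvdp_add, dvdp_mull, dvdp_mulr).
rewrite (_ : phi_iter N.+2 - p' = (Phi N.+2 p' - Phi N.+1 p') +
  (Phi N.+1 p' - Phi N.+1 p) + (Phi N.+1 p - p') - (Phi N.+2 p' - phi_iter N.+2)).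
  exact: dvdp_sub (dvdp_add (dvdp_add h3 h4) h2) h1.
by rewrite /=; ring.
Qed.

Lemma phi_iter_poly N : phi_iter N = \poly_(i < N) (phi_iter i.+1)`_i.
Proof.
apply/polyP => i; rewrite coef_poly; case: ifP => [iN|/negbT].
  elim: N iN => // N IH; rewrite ltnS leq_eqVlt => /orP[/eqP->//|iN].
  rewrite -IH//; apply/subr0_eq; rewrite -coefB.
  by move: (phi_iter_dvd N) => /dvdXn_coef/(_ _ iN).
rewrite -leqNgt => Ni; case: N Ni => [|N] Ni; first by rewrite coef0.
by rewrite coef_take_poly ltnNge Ni.
Qed.

Lemma phi_iter_fix N : 'X^N %| Phi N.+1 (phi_iter N) - phi_iter N.
Proof.
rewrite -(subrKA (phi_iter N.+1)) dvdp_add ?phi_iter_dvd//.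
by apply: dvdp_trans (dvdXn_take N.+1 _); rewrite dvdp_exp2l.
Qed.

End formal.

Lemma isan_coef0 (A : R -> R[i]) z0 c s M : 0 < s ->
  (forall N t, `|t| <= s ->
     nc (A (z0 + t) - (\poly_(i < N) c i).[t%:C]) <= M * (`|t| / s) ^+ N) ->
  c 0%N = A z0.
Proof.
move=> s0 h; have := h 1%N 0; rewrite normr0 mul0r expr0n mulr0 addr0 => /(_ (ltW s0)).
rewrite (_ : \poly_(i < 1) c i = (c 0%N)%:P); last first.
  by apply/polyP => -[|i]; rewrite coef_poly coefC.
rewrite hornerC => h0; apply/esym/eqP; rewrite -subr_eq0 -nc_eq0.
by rewrite eq_le h0 nc_ge0.
Qed.

(** The three estimates say that the ball of radius [dl] is mapped to itself, that the contraction
    factor is at most [1/2], and that errors in the coefficients are amplified by at most [2 K]. *)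
Lemma fix_constants (M0 M1 M2 M3 : R) :
  0 <= M0 -> 0 <= M1 -> 0 <= M2 -> 0 <= M3 ->
  exists K dl, [/\ [/\ 1 <= K, M0 <= K, M1 <= K, M2 <= K & M3 <= K],
    0 < dl, dl <= 2^-1,
    dl / 4 + dl * (dl / 4 + dl * (K + dl * K)) <= dl &
    dl / 4 + (K * (dl + dl) + K * (dl * dl + (dl * dl + dl * dl))) <= 2^-1 /\
    K + dl * (K + dl * (K + dl * K)) <= 2 * K].
Proof.
move=> h0 h1 h2 h3; pose K := M0 + M1 + M2 + M3 + 1; exists K, (32 * K)^-1.
have K1 : 1 <= K by rewrite /K; lra.
have -> : [/\ 1 <= K, M0 <= K, M1 <= K, M2 <= K & M3 <= K] = True.
  by apply/propext; split=> // _; rewrite /K; split; lra.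
set dl := _^-1; have dlE : K * dl = 32^-1 by rewrite /dl; field; lra.
have dl0 : 0 < dl by rewrite invr_gt0; lra.
have dl1 : dl <= 32^-1 by rewrite -dlE ler_peMl// ltW.
clearbody K dl; split=> //; first lra.
  rewrite (_ : _ + _ = dl * (4^-1 + dl / 4 + K * dl + dl * (K * dl))); last by ring.
  by rewrite dlE ler_piMr ?(ltW dl0)//; lra.
split.
  rewrite (_ : _ + _ = dl / 4 + 2 * (K * dl) + 3 * (dl * (K * dl))); last by ring.
  by rewrite dlE; lra.
rewrite (_ : _ + _ = K + K * dl * (1 + dl + dl * dl)); last by ring.
have : dl * dl <= 1 by rewrite mulr_ile1 ?(ltW dl0)//; lra.
by rewrite dlE; lra.
Qed.

(* The formal solution [phi_iter] has [ell^1] norm at most [dl], and [phi] is a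
   contraction with factor [1/2] on the corresponding ball. *)
Lemma isan_fix (w A0 A1 A2 A3 : R -> R[i]) (z0 : R) :
  isan A0 z0 -> isan A1 z0 -> isan A2 z0 -> isan A3 z0 ->
  A0 z0 = 0 -> A1 z0 = 0 ->
  (forall e, 0 < e -> exists2 d, 0 < d & forall t, `|t| < d -> nc (w (z0 + t)) < e) ->
  (exists2 d, 0 < d & forall t, `|t| < d -> w (z0 + t) =
    phi (A0 (z0 + t)) (A1 (z0 + t)) (A2 (z0 + t)) (A3 (z0 + t)) (w (z0 + t))) ->
  isan w z0.
Proof.
move=> /isan_radius[c0 [r0 [M0 [r00 M00 h0]]]] /isan_radius[c1 [r1 [M1 [r10 M10 h1]]]].
move=> /isan_radius[c2 [r2 [M2 [r20 M20 h2]]]] /isan_radius[c3 [r3 [M3 [r30 M30 h3]]]].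
move=> A00 A10 wc [d d0 wE].
have [K [dl [[K1 f0 f1 f2 f3] dl0 dl1 dlK [dlL dlK2]]]] := fix_constants M00 M10 M20 M30.
have half (x : R) : 0 < x -> x / 2 < x by move=> x0; rewrite ltr_pdivrMr// mulr_natr mulr2n ltrDl.
have K0 : 0 < K := lt_le_trans ltr01 K1.
have cst2 : 2^-1 <= 4 * K + 2 by clear -K1; lra.
have cst3 : dl + dl <= 1 by clear -dl1; lra.
have [d' d'0 wd] := wc _ dl0.
have [r [rp rr0 rr1 [rr2 rr3]]] :
    exists r, [/\ 0 < r, r <= r0, r <= r1 & r <= r2 /\ r <= r3].
  exists (Num.min (Num.min r0 r1) (Num.min r2 r3)).
  by rewrite !lt_min r00 r10 r20 r30 !ge_min !lexx !orbT.
have rdl : 0 < r * (dl / 4 / K) by rewrite mulr_gt0// !divr_gt0.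
have [s [s0 sr srK sd sd']] :
    exists s, [/\ 0 < s, s <= r, s <= r * (dl / 4 / K), s < d & s < d'].
  (* Shrinking the radius brings the norms of the two coefficients that vanish at [z0] below
     [dl / 4], by [pn_shrink]. *)
  pose s := Num.min (Num.min (d / 2) (d' / 2)) (Num.min r (r * (dl / 4 / K))).
  exists s; split.
  - by rewrite !lt_min rdl rp !divr_gt0.
  - by rewrite /s !ge_min lexx !orbT.
  - by rewrite /s !ge_min lexx !orbT.
  - by apply: le_lt_trans (half _ d0); rewrite /s !ge_min lexx.
  - by apply: le_lt_trans (half _ d'0); rewrite /s !ge_min lexx orbT.
have sK : s / r * K <= dl / 4.
  have srK' : s / r <= dl / 4 / K by rewrite ler_pdivrMr// mulrC.
  by rewrite -ler_pdivlMr.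
have sge := ltW s0.
pose q c N : {poly R[i]} := \poly_(i < N) c i.
have hq c (N : nat) (M : R) : (forall N, pn r (q c N) <= M) -> M <= K -> pn s (q c N) <= K.
  by move=> h MK; apply: le_trans MK; apply: le_trans (h N); apply: pn_le.
have hqX c N (M : R) : (forall N, pn r (q c N) <= M) -> M <= K -> c 0%N = 0 ->
    'X %| q c N /\ pn s (q c N) <= dl / 4.
  move=> h MK c00; have Xq : 'X %| q c N.
    rewrite -['X]expr1; apply/dvdXn_coef => -[|//] _.
    by rewrite coef_poly; case: ifP.
  split => //; apply: le_trans (pn_shrink sge sr rp Xq) _.
  apply: le_trans sK; rewrite ler_wpM2l ?divr_ge0 ?(ltW rp)//.
  exact: le_trans (h N) MK.
have [g0 e0] := h0 r rp rr0; have [g1 e1] := h1 r rp rr1.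
have [g2 e2] := h2 r rp rr2; have [g3 e3] := h3 r rp rr3.
have z00 : c0 0%N = 0 by rewrite (isan_coef0 rp e0).
have z10 : c1 0%N = 0 by rewrite (isan_coef0 rp e1).
have X0 N : 'X %| q c0 N by have [] := hqX _ N _ g0 f0 z00.
have X1 N : 'X %| q c1 N by have [] := hqX _ N _ g1 f1 z10.
have Q0 N : pn s (q c0 N) <= dl / 4 by have [] := hqX _ N _ g0 f0 z00.
have Q1 N : pn s (q c1 N) <= dl / 4 by have [] := hqX _ N _ g1 f1 z10.
have Q2 N : pn s (q c2 N) <= K := hq _ N _ g2 f2.
have Q3 N : pn s (q c3 N) <= K := hq _ N _ g3 f3.
pose Phi N (p : {poly R[i]}) := phi (q c0 N) (q c1 N) (q c2 N) (q c3 N) p.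
have hd c N : 'X^N %| q c N.+1 - q c N.
  apply/dvdXn_coef => i iN; rewrite coefB !coef_poly iN ltnS (ltnW iN) subrr //.
pose p := phi_iter (q c0) (q c1) (q c2) (q c3).
have pE N := phi_iter_poly X0 X1 (hd c0) (hd c1) (hd c2) (hd c3) N.
have pF N := phi_iter_fix X0 X1 (hd c0) (hd c1) (hd c2) (hd c3) N.
have Phin N u : pn s u <= dl -> pn s (Phi N u) <= dl.
  move=> ud; apply: le_trans dlK; do 3!(apply: pnD_le => //; apply: pnM_le => //).
have pd N : pn s (p N) <= dl.
  elim: N => [|N IH]; first by rewrite pn0 ltW.
  by rewrite (le_trans (pn_take _ _ sge))// Phin.
(* The error [x] will satisfy [x <= 2 K rho + x / 2 + rho], hence [x <= (4 K + 2) rho]. *)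
exists (fun i => (p i.+1)`_i), s, (4 * K + 2); split=> // [N|N t ts]; rewrite -pE -/p.
  by apply: le_trans (pd N) _; apply: le_trans dl1 _; apply: cst2.
set rho := (`|t| / s) ^+ N.
have rho0 : 0 <= rho by rewrite exprn_ge0// divr_ge0.
have tr : `|t| <= r := le_trans ts sr.
have rN : (`|t| / r) ^+ N.+1 <= rho.
  have q1 : `|t| / r <= `|t| / s by rewrite ler_wpM2l// lef_pV2.
  have qs : `|t| / s <= 1 by rewrite ler_pdivrMr// mul1r.
  apply: le_trans (_ : (`|t| / s) ^+ N.+1 <= _).
    by rewrite lerXn2r ?nnegrE// divr_ge0// ltW.
  by rewrite exprS ler_piMl.
have hc (A : R -> R[i]) c (M : R) : M <= K -> 0 <= M -> (forall N t, `|t| <= r ->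
    nc (A (z0 + t) - (q c N).[t%:C]) <= M * (`|t| / r) ^+ N) ->
    nc (A (z0 + t) - (q c N.+1).[t%:C]) <= K * rho.
  move=> MK M_ge0 h; apply: le_trans (h N.+1 t tr) _.
  by rewrite ler_pM// exprn_ge0// divr_ge0// ltW.
have := hc _ _ _ f0 M00 e0; have := hc _ _ _ f1 M10 e1.
have := hc _ _ _ f2 M20 e2; have := hc _ _ _ f3 M30 e3.
have ev u B : pn s u <= B -> nc u.[t%:C] <= B.
  by move=> uB; apply: le_trans uB; apply: horner_pn; rewrite ncR.
have td : `|t| < d := le_lt_trans ts sd.
have td' : `|t| < d' := le_lt_trans ts sd'.
have wd1 := ltW (wd t td').
have Pd := ev _ _ (pd N).
have v1 := ev _ _ (Q1 N.+1); have v2 := ev _ _ (Q2 N.+1); have v3 := ev _ _ (Q3 N.+1).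
have := horner_pn_dvd s0 ts (pF N); rewrite -/p -/rho.
rewrite hornerD hornerN {1}/phi !(hornerD, hornerM).
rewrite -[X in X - _ ]/(phi (q c0 N.+1).[t%:C] (q c1 N.+1).[t%:C]
  (q c2 N.+1).[t%:C] (q c3 N.+1).[t%:C] (p N).[t%:C]).
have pn1 : pn s (Phi N.+1 (p N) - p N) <= 1.
  apply: le_trans cst3.
  apply: pnD_le => //; first exact: Phin.
  by rewrite pnN.
move/(fun h => le_trans h (ler_wpM2r rho0 pn1)); rewrite mul1r.
have := wE t td; move: wd1.
move: (A0 _) (A1 _) (A2 _) (A3 _) (w _) => a0 a1 a2 a3 y.
move: v1 v2 v3 Pd; move: (q c0 _).[_] (q c1 _).[_] (q c2 _).[_] (q c3 _).[_] (p N).[_].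
move=> b0 b1 b2 b3 P v1 v2 v3 Pd yd yE hP k3 k2 k1 k0.
have u1 : nc (phi a0 a1 a2 a3 y - phi b0 b1 b2 b3 y) <= 2 * K * rho.
  rewrite phi_subl; apply: le_trans (_ : (K + dl * (K + dl * (K + dl * K))) * rho <= _).
    rewrite (_ : _ * rho = K * rho + dl * (K * rho + dl * (K * rho + dl * (K * rho)))).
      by do 3!(apply: ncD_le => //; apply: ncM_le => //).
    by ring.
  by rewrite ler_wpM2r.
have u2 : nc (phi b0 b1 b2 b3 y - phi b0 b1 b2 b3 P) <= nc (y - P) * 2^-1.
  rewrite phi_subr; apply: ncM_le => //; apply: le_trans dlL.
  do !(apply: ncD_le => //); apply: ncM_le => //; do !(apply: ncD_le => //); exact: ncM_le.
have : nc (y - P) <= nc (phi a0 a1 a2 a3 y - phi b0 b1 b2 b3 y) +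
    nc (phi b0 b1 b2 b3 y - phi b0 b1 b2 b3 P) + nc (phi b0 b1 b2 b3 P - P).
  rewrite [X in nc (X - _)]yE.
  rewrite (_ : _ - P = (phi a0 a1 a2 a3 y - phi b0 b1 b2 b3 y) +
    (phi b0 b1 b2 b3 y - phi b0 b1 b2 b3 P) + (phi b0 b1 b2 b3 P - P)); last by ring.
  by apply: ncD_le => //; exact: ncD_le.
move: u1 u2 hP; move: (nc _) (nc _) (nc _) (nc _) => x1 x2 x3 x4; clear; lra.
Qed.

End analytic_fixpoint.

Section analytic_ift.
Context {R : realType}.
Implicit Types f g : R -> R[i].

Definition eps_cont f z0 := forall e, 0 < e -> exists2 d, 0 < d &
  forall t, `|t| < d -> nc (f (z0 + t) - f z0) < e.

Lemma isan_cont f z0 : isan f z0 -> eps_cont f z0.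
Proof.
move=> /isan_radius[c [s [M [s0 M0 /(_ s s0 (lexx s))[_ h]]]]] e e0.
exists (Num.min s (e * s / (M + 1))); first by rewrite lt_min s0 !(divr_gt0, mulr_gt0)// ltr_wpDl.
move=> t; rewrite lt_min => /andP[ts te].
have := h 1%N t (ltW ts); rewrite (_ : \poly_(i < 1) c i = (f z0)%:P); last first.
  by apply/polyP => -[|i]; rewrite coef_poly coefC//= (isan_coef0 s0 h).
rewrite hornerC expr1 => /le_lt_trans; apply.
have M1 : 0 < M + 1 by rewrite ltr_wpDl.
have : (M + 1) * (`|t| / s) < e by rewrite mulrA ltr_pdivrMr// mulrC -ltr_pdivlMr.
by apply: le_lt_trans; rewrite ler_wpM2r ?divr_ge0 ?(ltW s0)// lerDl.
Qed.

(** With [F] the given cubic, [y = f z0] and [k] the inverse of its derivative there, [w = f - y]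
    satisfies the Newton form [w = w - k F(w + y)]. Its constant and linear coefficients vanish at
    [z0], as [isan_fix] requires. *)
Lemma isan_ift f a0 a1 a2 a3 z0 :
  isan a0 z0 -> isan a1 z0 -> isan a2 z0 -> isan a3 z0 -> eps_cont f z0 ->
  (exists2 d, 0 < d & forall t, `|t| < d ->
    phi (a0 (z0 + t)) (a1 (z0 + t)) (a2 (z0 + t)) (a3 (z0 + t)) (f (z0 + t)) = 0) ->
  a1 z0 + 2 * a2 z0 * f z0 + 3 * a3 z0 * f z0 ^+ 2 != 0 -> isan f z0.
Proof.
move=> h0 h1 h2 h3 fc [d d0 hF] D0; set D := _ + _ + _ in D0.
pose k := D^-1; pose y := f z0.
have hy := isan_cst y z0; have hk := isan_cst (- k) z0.
have F0 : phi (a0 z0) (a1 z0) (a2 z0) (a3 z0) y = 0.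
  by have := hF 0; rewrite addr0 normr0; apply.
have -> : f = (fun x => (f x - y) + y) by apply/funext => x; rewrite subrK.
apply: isan_add => //; apply: (@isan_fix _ _
  (fun x => - k * (a0 x + y * (a1 x + y * (a2 x + y * a3 x))))
  (fun x => 1 + - k * (a1 x + y * (2 * a2 x + y * (3 * a3 x))))
  (fun x => - k * (a2 x + y * (3 * a3 x)))
  (fun x => - k * a3 x)).
- by do 4!(apply: isan_mul => //; try (apply: isan_add => //)).
- apply: isan_add; first exact: isan_cst.
  apply: isan_mul => //; apply: isan_add => //; apply: isan_mul => //.
  apply: isan_add; first by apply: isan_mul => //; exact: isan_cst.
  by do 2!(apply: isan_mul => //); exact: isan_cst.
- apply: isan_mul => //; apply: isan_add => //; apply: isan_mul => //.
  by apply: isan_mul => //; exact: isan_cst.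
- exact: isan_mul.
- by rewrite -[X in _ * X]/(phi (a0 z0) (a1 z0) (a2 z0) (a3 z0) y) F0 mulr0.
- transitivity (1 + - k * D); last by rewrite mulNr mulVf// subrr.
  by congr (1 + _ * _); rewrite /D -/y; move: (a1 _) (a2 _) (a3 _) (y) => *; ring.
- exact: fc.
exists d => // t td; have := hF t td.
rewrite -{1}(subrK y (f (z0 + t))); move: (f (z0 + t) - y) => w.
move: (a0 _) (a1 _) (a2 _) (a3 _) => b0 b1 b2 b3 hw.
transitivity (w - k * phi b0 b1 b2 b3 (w + y)); first by rewrite hw mulr0 subr0.
by rewrite /phi; clearbody k y; ring.
Qed.

(** The inverse solves the linear equation [g x - 1 = 0], whose derivative is [g]. *)
Lemma isan_inv g z0 : isan g z0 -> g z0 != 0 -> isan (fun x => (g x)^-1) z0.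
Proof.
move=> hg g0; have gc := isan_cont hg.
have n0 : 0 < nc (g z0) by rewrite nc_gt0.
have [d d0 hd] := gc _ (divr_gt0 n0 (ltr0n R 2)).
have gt t : `|t| < d -> nc (g z0) / 2 < nc (g (z0 + t)).
  move=> /hd; have := ncD (g (z0 + t)) (g z0 - g (z0 + t)).
  by rewrite addrC subrK (ncB _ (g z0)); lra.
have gt0 t : `|t| < d -> g (z0 + t) != 0.
  by move=> /gt h; rewrite -nc_gt0; apply: le_lt_trans h; rewrite divr_ge0 ?nc_ge0.
apply: (@isan_ift _ (fun=> - 1) g (fun=> 0) (fun=> 0)) => //; try exact: isan_cst.
- move=> e e0; have e'0 : 0 < e * (nc (g z0) / 2 * nc (g z0)) by rewrite !mulr_gt0 ?divr_gt0.
  have [d' d'0 hd'] := gc _ e'0; exists (Num.min d d'); first by rewrite lt_min d0.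
  move=> t; rewrite lt_min => /andP[td /hd'] h.
  have -> : (g (z0 + t))^-1 - (g z0)^-1 = - (g (z0 + t) - g z0) / (g (z0 + t) * g z0).
    by field; rewrite g0 gt0.
  rewrite ncM ncN ncV ncM ltr_pdivrMr ?mulr_gt0 ?nc_gt0 ?gt0//.
  by apply: (lt_le_trans h); rewrite ler_wpM2l ?(ltW e0)// ler_wpM2r ?nc_ge0// ltW// gt.
- by exists d => // t td; rewrite /phi /= !mulr0 !addr0 !mulr0 !addr0 mulVf ?gt0// addNr.
by rewrite !mulr0 !mul0r !addr0.
Qed.

End analytic_ift.

(** * Analyticity of the branches, of [V] and of the density *)

Section density_analytic.
Context {R : realType}.
Variables alpha beta : R.
Hypotheses (alpha0 : alpha != 0) (beta0 : beta != 0).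

(** Off the zeros of the discriminant the quadratic has simple roots, and [isP_cont] supplies the
    continuous choice that the implicit function theorem needs. *)
Lemma isP_isan (p m : R) f z0 : (forall x, isP p (x - m)%:C (f x)) ->
  (z0 - m) ^+ 2 != 4 * p ^+ 2 -> isan f z0.
Proof.
move=> hf hz; apply: (@isan_ift _ _ (fun=> (p ^+ 2)%:C)
  (fun x => m%:C + (- 1) * x%:C) (fun=> 1) (fun=> 0)); try exact: isan_cst.
- apply: isan_add; first exact: isan_cst.
  by apply: isan_mul; [exact: isan_cst|exact: isan_id].
- move=> e e0; have [d d0 hd] := isP_cont (hf z0) e0; exists d => // t td.
  apply: (hd _ _ (hf (z0 + t))); rewrite -rmorphB ncR.
  by rewrite (_ : _ - _ = t)//; ring.
- exists 1 => // t _; have [h _ _] := hf (z0 + t); move: h.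
  have -> : (z0 + t - m)%:C = (z0 + t)%:C - m%:C :> R[i] by exact: rmorphB.
  rewrite /phi => <-; cbv beta.
  by move: ((z0 + t)%:C : R[i]) (m%:C : R[i]) (f (z0 + t)) => x n y; ring.
have [h _ _] := hf z0; apply/eqP => D0; move/eqP: hz; apply.
have E : 2 * f z0 = (z0 - m)%:C by apply/eqP; rewrite -subr_eq0 -D0 rmorphB; apply/eqP; ring.
have e2 : ((z0 - m) ^+ 2)%:C = (z0 - m)%:C ^+ 2 :> R[i] by exact: rmorphXn.
have e4 : (4 * p ^+ 2)%:C = 4 * (p ^+ 2)%:C :> R[i] by rewrite rmorphM rmorph_nat.
by apply: complexI; rewrite e2 e4 -h -E; ring.
Qed.

Let V x := Vc alpha beta x%:C.
Let S := gsupp alpha beta.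

Lemma gsupp_gsol x : S x -> gsol alpha beta x%:C (V x).
Proof. by move=> [v h]; rewrite /V (Vc_gsol alpha0 beta0 h). Qed.

Lemma gsupp_near x : S x -> forall e, 0 < e ->
  exists2 d, 0 < d & forall t, `|t| < d -> S (x + t) /\ nc (V (x + t) - V x) < e.
Proof.
move=> /gsupp_gsol h e e0; have [d d0 hd] := gsol_cont alpha0 beta0 h e0.
exists d => // t td; have [||v gv vv] := hd (x + t)%:C.
- by rewrite cImR.
- by rewrite -rmorphB ncR addrC addKr.
split; first by exists v.
by rewrite /V (Vc_gsol alpha0 beta0 gv) ncB.
Qed.

Lemma gsupp_open : open S.
Proof.
rewrite openE => x /gsupp_near /(_ 1 ltr01)[d d0 hd].
apply/nbhs_ballP; exists d => // y; rewrite /ball /= distrC => /hd[].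
by rewrite addrC subrK.
Qed.

Lemma isan_V (z0 : R) : S z0 -> z0 ^+ 2 != 4 * (alpha + beta) ^+ 2 ->
  (z0 - 2 * beta) ^+ 2 != 4 * alpha ^+ 2 -> isan V z0.
Proof.
move=> Sz hp hd; have gz := gsupp_gsol Sz.
have /isV_gsol[eqz vz] := gz.
have aP : isan (fun x => Pstar alpha beta x) z0.
  apply: (@isP_isan (alpha + beta) 0); rewrite ?subr0// => x.
  by rewrite subr0; exact: Pstar_isP.
have aQ : isan (fun x => Qstar alpha beta x) z0.
  have aD : isan (fun x => Qstar alpha beta x - (2 * beta)%:C) z0.
    by apply: (@isP_isan alpha (2 * beta)) => // x; exact: Qstar_isP.
  rewrite (_ : (fun x => _) = fun x => (Qstar alpha beta x - (2 * beta)%:C) + (2 * beta)%:C).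
    by apply: isan_add aD _; exact: isan_cst.
  by apply/funext => x; rewrite subrK.
have ct a := @isan_cst R a z0.
apply: (@isan_ift _ V (fun x => Pstar alpha beta x)
  (fun x => Pstar alpha beta x * Qstar alpha beta x + (beta ^+ 2 - alpha ^+ 2)%:C)
  (fun x => (Pstar alpha beta x + Qstar alpha beta x) * (beta ^+ 2)%:C)
  (fun=> (beta ^+ 4)%:C)) => //.
- by apply: isan_add => //; exact: isan_mul.
- by apply: isan_mul => //; exact: isan_add.
- by move=> e e0; have [d d0 h] := gsupp_near Sz e0; exists d => // t /h[].
- have [d d0 h] := gsupp_near Sz ltr01; exists d => // t /h[/gsupp_gsol/isV_gsol[+ _] _].
  by rewrite /eqE /phi -/(V _) => <-; ring.
have [_ _ iP] := Pstar_isP alpha beta z0; have [_ _ iQ] := Qstar_isP alpha beta z0.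
rewrite cImD cImN cImR subr0 in iQ.
apply/eqP => D0; move/eqP: (cubic_simple alpha0 beta0 iP iQ vz eqz); apply; rewrite -[RHS]D0.
by rewrite /dcubic -/(V _); ring.
Qed.

Lemma density_analytic (z0 : R) : S z0 -> z0 ^+ 2 != 4 * (alpha + beta) ^+ 2 ->
  (z0 - 2 * beta) ^+ 2 != 4 * alpha ^+ 2 ->
  analytic_at (fun x => ImG alpha beta x%:C / pi) z0.
Proof.
move=> Sz hp hd; have aV := isan_V Sz hp hd.
have ct a := @isan_cst R a z0.
have aW : isan (fun x => beta%:C * V x + 1) z0 by apply: isan_add => //; exact: isan_mul.
have aG : isan (fun x => (pi^-1)%:C * (V x *
    ((beta%:C * V x + 1) * (beta%:C * V x + 1))^-1)) z0.
  apply: isan_mul => //; apply: isan_mul => //; apply: isan_inv; first exact: isan_mul.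
  by rewrite mulf_neq0// -nc_gt0 (gsol_den alpha0 beta0 (gsupp_gsol Sz)).
rewrite (_ : (fun x => _) = (fun x => complex.Im ((pi^-1)%:C * (V x *
    ((beta%:C * V x + 1) * (beta%:C * V x + 1))^-1)))); first exact: isan_analytic.
by apply/funext => x; rewrite cImM cReR cImR mul0r addr0 mulrC -expr2.
Qed.

Lemma density_analytic_off (z0 : R) : ~ closure S z0 ->
  analytic_at (fun x => ImG alpha beta x%:C / pi) z0.
Proof.
move=> nz; have : nbhs z0 (~` closure S).
  by apply: open_nbhs_nbhs; split => //; apply: closed_openC; exact: closed_closure.
move=> /nbhs_ballP[e /= e0 he]; exists (fun=> 0), e; split=> // x xe.
rewrite ImG_none ?mul0r; last first.
  by move=> h; apply: (he x); [rewrite /ball /= distrC|exact: subset_closure].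
rewrite (_ : pseries _ _ = fun=> 0); first exact: cvg_cst.
by apply/funext => n; rewrite /pseries seriesEord /= big1// => i _; rewrite mul0r.
Qed.

End density_analytic.

(** * The spectral density *)

Section spectral_density.
Context {R : realType}.
Variables alpha beta : R.
Hypotheses (alpha0 : alpha != 0) (beta0 : beta != 0).
Local Notation T := (orbitF (@half_pt R)).
Local Notation H := (@Hop R alpha beta half_pt).
Variable E : pvm R T.
Hypothesis EH : spectral_resolution H E.
Local Notation mu := (spectral_measure E (l2_delta (base_point half_pt))).
Local Notation leb := (@lebesgue_measure R).

Definition density (x : R) : R := ImG alpha beta x%:C / pi.
Local Notation h := density.
Local Notation S := (gsupp alpha beta).

Lemma density_continuous : continuous h.
Proof.
move=> x; apply/cvgrPdist_lt => e e0.
have e1 : 0 < e * pi by rewrite mulr_gt0// pi_gt0.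
have xI : 0 <= complex.Im (x%:C : R[i]) by rewrite cImR.
have [d d0 hd] := ImG_cont alpha0 beta0 xI e1.
apply/nbhs_ballP; exists d => // y; rewrite /ball /= => xy.
rewrite /density -mulrBl normrM (@ger0_norm _ (pi^-1)) ?invr_ge0 ?pi_ge0//.
rewrite ltr_pdivrMr ?pi_gt0// distrC; apply: hd; first by rewrite cImR.
by rewrite -rmorphB ncR distrC.
Qed.

Lemma density_ge0 x : 0 <= h x.
Proof. by rewrite divr_ge0 ?pi_ge0//; exact: ImG_ge0. Qed.

Lemma density_gt0 x : S x -> 0 < h x.
Proof. by move=> [v hv]; rewrite divr_gt0 ?pi_gt0//; exact: ImG_gt0 hv. Qed.

Lemma density_none x : ~ S x -> h x = 0.
Proof. by move=> nS; rewrite /density ImG_none// mul0r. Qed.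

Let measurable_h (A : set (measurableTypeR R)) :
  measurable_fun A (fun x => (h x)%:E).
Proof.
apply: measurable_funTS; apply/measurable_EFinP.
by apply: continuous_measurable_fun; exact: density_continuous.
Qed.

Lemma spectral_measure_density (A : set (measurableTypeR R)) : measurable A ->
  mu A = (\int[leb]_(x in A) (h x)%:E)%E.
Proof.
apply: (@stieltjes_inversion R mu (fun x y => ImG alpha beta (x +i* y)) h).
- move=> x y y0.
  under eq_integral do rewrite EFinM.
  rewrite ge0_integralZl_EFin//; last exact: ltW.
  + by rewrite (poisson_integral alpha0 beta0 EH)// -EFinM mulrCA divff ?mulr1// gt_eqF.
  + by move=> t _; rewrite lee_fin invr_ge0 addr_ge0 ?sqr_ge0.
  + apply/measurable_EFinP; apply: (@measurable_inv_ge _ _ R (y ^+ 2)).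
    * by rewrite exprn_gt0.
    * by move=> t; rewrite lerDr sqr_ge0.
    * by apply: measurable_funD => //; apply: measurable_funX; exact: measurable_funB.
- move=> x; rewrite /density mulrCA divff ?mulr1 ?gt_eqF ?pi_gt0//.
  apply/cvgrPdist_lt => e e0.
  have xI : 0 <= complex.Im (x%:C : R[i]) by rewrite cImR.
  have [d d0 hd] := ImG_cont alpha0 beta0 xI e0.
  near=> n; rewrite distrC; apply: hd; first by rewrite /= invr_ge0.
  rewrite (_ : _ - _ = 'i%C * (n.+1%:R^-1)%:C).
    rewrite ncM ncR (_ : nc _ = 1) ?mul1r; last by rewrite /Normc.normc /= expr0n expr1n add0r sqrtr1.
    rewrite ger0_norm ?invr_ge0//; near: n.
    exact: (near_infty_natSinv_lt (PosNum d0)).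
  by apply/eqP; rewrite eq_complex /= !(mul0r, mulr0, subrr, subr0, add0r, mul1r, addr0, oppr0) !eqxx.
- move=> a b; pose K := `|a| + `|b| + 1 + `|alpha + beta|.
  exists (`|beta|^-1 / gap alpha beta K ^+ 4) => x y /andP[ax xb] /andP[y0 y1].
  apply: ImG_bound => //; rewrite /K lerD2r.
  rewrite (_ : x +i* y = x%:C + 'i%C * y%:C); last by rewrite [LHS]complexE.
  have n1 : nc ('i%C : R[i]) = 1 by rewrite /Normc.normc /= expr0n expr1n add0r sqrtr1.
  rewrite (le_trans (ncD _ _))// ncM !ncR n1 mul1r lerD//.
    rewrite ler_norml; have := ler_norm (- a); have := ler_norm b; rewrite normrN.
    by have := normr_ge0 a; have := normr_ge0 b; lra.
  by rewrite ger0_norm// ltW.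
- exact: density_continuous.
Unshelve. all: by end_near. Qed.

Lemma spectral_measure_dominated : mu `<< leb.
Proof.
move=> A A0 B mB BA; rewrite spectral_measure_density//.
by apply: null_set_integral => //; exact: A0.
Qed.

Lemma spectral_measure_gt0 x (B : set R) : S x -> open B -> B x -> (0 < mu B)%E.
Proof.
move=> Sx oB Bx; have hx := density_gt0 Sx.
have [d /= d0 hd] := (nbhs_ballP _ _).1 (open_nbhs_nbhs (conj oB Bx)).
have h2 : h x / 2 < h x by rewrite ltr_pdivrMr// mulr_natr mulr2n ltrDl.
have /cvgr_gt/(_ _ h2)/nbhs_ballP[e /= e0 he] := @density_continuous x.
pose r := Num.min d e; have r0 : 0 < r by rewrite lt_min d0.
pose I : set R := `]x - r, x + r[%classic.
have Ir y : I y -> `|x - y| < r.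
  by rewrite /I /= in_itv /= => /andP[xy yx]; rewrite ltr_norml; lra.
have IB : I `<=` B.
  by move=> y /Ir; rewrite lt_min => /andP[yd _]; apply: hd.
have mI : measurable (I : set (measurableTypeR R)) by exact: measurable_itv.
have mB : measurable (B : set (measurableTypeR R)) by exact: open_measurable.
have muIB : (mu I <= mu B)%E by apply: le_measure; rewrite ?inE.
apply: lt_le_trans muIB.
rewrite spectral_measure_density//.
apply: (@lt_le_trans _ _ (\int[leb]_(y in I) (h x / 2)%:E)%E); last first.
  apply: ge0_le_integral => //; [by move=> y _; rewrite lee_fin divr_ge0 ?density_ge0|..].
  by move=> y /Ir; rewrite lt_min => /andP[_ ye]; rewrite lee_fin ltW//; exact: he.
have lI : leb I = (r + r)%:E.
  rewrite /I lebesgue_measure_itv /= lte_fin.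
  rewrite (_ : (x - r < x + r) = true); last by lra.
  by rewrite -EFinB; congr (_%:E); ring.
rewrite integral_cst// -[X in (_ * X)%E]/(leb I) lI -EFinM lte_fin.
by apply: mulr_gt0; [exact: divr_gt0|exact: addr_gt0].
Qed.

Lemma spectral_measure_msupport : msupport mu = closure S.
Proof.
apply/seteqP; split=> x.
  move=> hx B /nbhs_ballP[e /= e0 he].
  have := hx _ (@ball_open _ R x e) (ballxx x e0).
  have mb : measurable (ball x e : set (measurableTypeR R)) by exact: measurable_ball.
  rewrite spectral_measure_density// => mu0; apply: contrapT => nB.
  move: mu0; rewrite integral0_eq ?ltxx// => y xy.
  by rewrite density_none// => Sy; apply: nB; exists y; split=> //; exact: he.
move=> cx B oB Bx; have /cx[y [Sy By]] : nbhs x B by apply: open_nbhs_nbhs.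
exact: spectral_measure_gt0 Sy oB By.
Qed.

(** A point of [S] outside [[-M, M]] would give the open complement positive measure, although [E]
    is carried by the interval. *)
Lemma spectral_density_support_bounded : exists M, forall x, S x -> `|x| <= M.
Proof.
have [[M hM] _] := EH; exists M => x Sx; rewrite leNgt; apply/negP => Mx.
pose I : set R := `[- M, M]%classic.
have mI : measurable (I : set (measurableTypeR R)) by exact: measurable_itv.
have oI : open (~` I) by apply: closed_openC; exact: interval_closed.
have := spectral_measure_gt0 Sx oI.
have -> : mu (~` I) = 0%E.
  have l2d : l2 (delta (base_point half_pt) : T -> R[i]) := l2_delta _.
  rewrite spectral_measureE; last exact: measurableC.
  rewrite -{1}(hM _ l2d) -pvm_setI//; last exact: measurableC.
  by rewrite setICl pvm_set0// inner0.
rewrite ltxx => h0; have : false; last by [].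
apply: h0; rewrite /I /= in_itv /= => /andP[a b].
by move: Mx; rewrite ltNge ler_norml a b.
Qed.

Lemma density_Radon_Nikodym : {ae leb, forall z : R,
  Radon_Nikodym (charge_of_finite_measure mu) leb z = (h z)%:E}.
Proof.
have dom : charge_of_finite_measure mu `<< leb := spectral_measure_dominated.
have ae : ae_eq leb setT (Radon_Nikodym (charge_of_finite_measure mu) leb)
    (fun x => (h x)%:E).
  apply: integral_ae_eq => //; first exact: Radon_Nikodym_integrable.
  move=> A _ mA; rewrite -Radon_Nikodym_integral//.
  exact: spectral_measure_density.
by apply: filterS ae => x; apply.
Qed.

End spectral_density.

Local Open Scope charge_scope.

Lemma gsupp_isV (R : realType) (alpha beta : R) :
  [set z : R | exists v, isV alpha beta z v] = gsupp alpha beta.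
Proof.
by apply/seteqP; split=> z [v hv]; exists v; [apply/isV_gsol|apply/isV_gsol].
Qed.

Lemma density_isV (R : realType) (alpha beta z : R) v :
  alpha != 0 -> beta != 0 -> isV alpha beta z v ->
  density alpha beta z = complex.Im (v / ((pi : R)%:C * (beta%:C * v + 1) ^+ 2)).
Proof.
move=> alpha0 beta0 /isV_gsol h; rewrite /density /ImG (Vc_gsol alpha0 beta0 h).
have -> : v / ((pi : R)%:C * (beta%:C * v + 1) ^+ 2) = (pi^-1)%:C * Gf beta v.
  by rewrite invfM mulrCA; congr (_ * _); exact/esym/fmorphV.
by rewrite cImM cReR cImR mul0r addr0 mulrC.
Qed.

Theorem theorem1 (R : realType) (alpha beta : R)
  (alpha0 : alpha != 0) (beta0 : beta != 0)
  (E : pvm R (orbitF half_pt))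
  (EH : spectral_resolution (@Hop R alpha beta half_pt) E) :
  let mu := spectral_measure E (l2_delta (base_point half_pt)) in
  let S := [set z : R | exists v, isV alpha beta z v] in
  (forall (z : R) (v w : R[i]),
     isV alpha beta z v -> isV alpha beta z w -> v = w) /\
  mu `<< lebesgue_measure /\
  msupport mu = closure S /\
  (exists s : seq (R * R), (forall p, p \in s -> p.1 < p.2) /\
     msupport mu = \bigcup_(p in [set` s]) `[p.1, p.2]%classic) /\
  (exists h : R -> R,
     {ae lebesgue_measure, forall z : R,
        ('d (charge_of_finite_measure mu) '/d lebesgue_measure) z = (h z)%:E} /\
     (forall (z : R) (v : R[i]), msupport mu z -> isV alpha beta z v ->
        h z = complex.Im (v / ((pi : R)%:C * (beta%:C * v + 1) ^+ 2))) /\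
     continuous h /\
     (exists s : seq R, forall z, z \notin s -> analytic_at h z)).
Proof.
move=> mu S.
have SE : S = gsupp alpha beta := gsupp_isV alpha beta.
have supp := spectral_measure_msupport alpha0 beta0 EH.
have [bd hbd] := boundary_finite alpha0 beta0.
have [M hM] := spectral_density_support_bounded alpha0 beta0 EH.
split; first by move=> z v w /isV_gsol hv /isV_gsol hw; exact: (gsol_uniq alpha0 beta0 hv hw).
split; first exact: (spectral_measure_dominated alpha0 beta0 EH).
split; first by rewrite SE.
split.
  have [l [hl lE]] := closure_intervals (gsupp_open alpha0 beta0) hM hbd.
  by exists l; split=> //; rewrite -lE.
exists (density alpha beta); split; first exact: (density_Radon_Nikodym alpha0 beta0 EH).
split; first by move=> z v _; exact: density_isV.
split; first exact: density_continuous.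
pose p := 2 * (alpha + beta); pose b := 2 * beta; pose a := 2 * alpha.
(* Off the boundary points and the branch points of [P] and [Q], either [z] lies in [S], where [V]
   is analytic, or the density vanishes near [z]. *)
exists (bd ++ [:: p; - p; b + a; b - a]) => z.
rewrite mem_cat !inE !negb_or => /and5P[zbd zp zp' zba zba'].
have [cz|/(density_analytic_off (alpha := alpha))//] := pselect (closure (gsupp alpha beta) z).
have [Sz|nSz] := pselect (gsupp alpha beta z); last by rewrite (hbd z cz nSz) in zbd.
apply: (density_analytic alpha0 beta0 Sz).
  have -> : 4 * (alpha + beta) ^+ 2 = p ^+ 2 by rewrite /p; ring.
  by rewrite eqf_sqr negb_or zp.
have -> : 4 * alpha ^+ 2 = a ^+ 2 by rewrite /a; ring.
by rewrite eqf_sqr negb_or !subr_eq addrC zba addrC zba'.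
Qed.
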